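(* Let $n\ge 1$ and $p\in[1,\infty]$. Let $M,N,A,B$ be isotropic weight sequences (on $\mathbb{N}^n$), given by $M_\alpha=M_{|\alpha|}$, etc. Suppose that $M$ and $A$ are log-convex and that $\mathcal{S}^{[M]}_{[A],p}\neq\{0\}$. Then the following statements are equivalent: (i) There are $C,H>0$ such that $M_q\le CH^qN_q$ and $A_q\le CH^qB_q$ for all $q\in\mathbb{N}$. (ii) $\mathcal{S}^{[M]}_{[A],p}\subseteq\mathcal{S}^{[N]}_{[B],p}$ as sets. (iii) $\mathcal{S}^{[M]}_{[A],p}\subseteq\mathcal{S}^{[N]}_{[B],p}$ and the inclusion map is continuous. Here $[\,\cdot\,]$ stands either for $(\,\cdot\,)$ everywhere or for $\{\,\cdot\,\}$ everywhere; the result holds in both cases.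
   Context: $\mathbb{N}=\{0,1,2,\dots\}$, $\mathbb{R}_+=(0,\infty)$. A weight sequence is a family $M=(M_\alpha)_{\alpha\in\mathbb{N}^n}$ of positive numbers with $M_0=1$ and $\lim_{|\alpha|\to\infty}M_\alpha^{1/|\alpha|}=\infty$. It is isotropic if there is a sequence $(M_q)_{q\in\mathbb{N}}$ with $M_\alpha=M_{|\alpha|}$ for all $\alpha\in\mathbb{N}^n$. It is log-convex if there is a convex function $F:[0,\infty)^n\to\mathbb{R}$ with $F(\alpha)=\log M_\alpha$ for all $\alpha\in\mathbb{N}^n$. The associated function of a weight sequence $A$ is $\omega_A(x)=\sup_{\alpha\in\mathbb{N}^n}\log\frac{|x^\alpha|}{A_\alpha}$, $x\in\mathbb{R}^n$. For $\lambda>0$, let $X_\lambda=X_\lambda(M,A,p)$ be the Banach space of all $f\in C^\infty(\mathbb{R}^n)$ with $$\|f\|_{X_\lambda}=\sup_{\alpha\in\mathbb{N}^n}\frac{\|f^{(\alpha)}e^{\omega_A(\cdot/\lambda)}\|_{L^p(\mathbb{R}^n)}}{\lambda^{|\alpha|}M_\alpha}<\infty .$$ Then $\mathcal{S}^{(M)}_{(A),p}=\varprojlim_{\lambda\to0^+}X_\lambda$ (the intersection of all $X_\lambda$, with the projective limit topology; Beurling case) and $\mathcal{S}^{\{M\}}_{\{A\},p}=\varinjlim_{\lambda\to\infty}X_\lambda$ (the union of all $X_\lambda$, with the locally convex inductive limit topology; Roumieu case). $\mathcal{S}^{[M]}_{[A],p}$ is the common notation for both. *)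

(* Defs.v *)
From HB Require Import structures.
From mathcomp Require Import all_boot all_order all_algebra.
From mathcomp Require Import all_classical all_reals all_analysis.
From mathcomp Require Import complex.

Set Implicit Arguments.
Unset Strict Implicit.
Unset Printing Implicit Defensive.

Import Order.TTheory GRing.Theory Num.Theory.
Import numFieldNormedType.Exports.

Local Open Scope classical_set_scope.
Local Open Scope ring_scope.

Notation multi n := {ffun 'I_n -> nat}.

Section Multi_indices.
Variable n : nat.

Definition mlen (a : multi n) : nat := (\sum_(i < n) a i)%N.

Definition mlist (a : multi n) : seq 'I_n :=
  flatten [seq nseq (a i) i | i <- enum 'I_n].

End Multi_indices.

Section Weight_sequences.
Variables (R : realType) (n : nat).
Implicit Type M : multi n -> R.

Definition weight_sequence M : Prop :=
  [/\ forall a, 0 < M a,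
      M [ffun=> 0%N] = 1 &
      forall K : R, exists q : nat, forall a, (q <= mlen a)%N ->
        K <= M a `^ (mlen a)%:R^-1].

Definition isotropic (m : nat -> R) : multi n -> R := fun a => m (mlen a).

Definition log_convex M : Prop :=
  exists F : 'rV[R]_n -> R,
    convex_function [set x : 'rV[R]_n | forall i, 0 <= x ord0 i] F /\
    forall a : multi n, F (\row_i (a i)%:R) = ln (M a).

(* [lne 0 = -oo], so the indices with x^a = 0 do not contribute. *)
Definition omega (A : multi n -> R) (x : 'rV[R]_n) : \bar R :=
  ereal_sup [set lne (`|\prod_(i < n) x ord0 i ^+ a i| / A a)%:E
            | a in [set: multi n]].

End Weight_sequences.

Section Smooth.
Variables (R : realType) (n : nat).

(* [rpartial [:: i1; ...; ik] u] is the iterated partial derivative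
   d_{i1} ( ... (d_{ik} u)). *)
Definition rpartial (s : seq 'I_n) (u : 'rV[R]_n -> R) : 'rV[R]_n -> R :=
  foldr (fun i v => 'D_(delta_mx ord0 i) v) u s.

(* C^oo: the iterated partial derivatives of every order, taken in any order of
   the variables, exist and are continuous. *)
Definition rsmooth (u : 'rV[R]_n -> R) : Prop :=
  forall s : seq 'I_n, continuous (rpartial s u) /\
    forall (i : 'I_n) x, derivable (rpartial s u) x (delta_mx ord0 i).

(* Complex-valued functions are differentiated through their real and imaginary
   parts. *)
Definition smooth (f : 'rV[R]_n -> R[i]) : Prop :=
  rsmooth (fun x => complex.Re (f x)) /\ rsmooth (fun x => complex.Im (f x)).

Definition partial (a : multi n) (f : 'rV[R]_n -> R[i]) : 'rV[R]_n -> R[i] :=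
  fun x => (rpartial (mlist a) (fun y => complex.Re (f y)) x
        +i* rpartial (mlist a) (fun y => complex.Im (f y)) x)%C.

End Smooth.

Section Lebesgue.
Variable R : realType.

Section Step.
Variables (n : nat)
  (m : {sigma_finite_measure set (n.-tuple (measurableTypeR R)) -> \bar R}).

Definition tuple_cons (xt : measurableTypeR R * n.-tuple (measurableTypeR R)) :
  n.+1.-tuple (measurableTypeR R) := [tuple of xt.1 :: xt.2].

Fact measurable_tuple_cons : measurable_fun [set: _] tuple_cons.
Proof. by apply: measurable_cons. Qed.

Definition leb_step : set (n.+1.-tuple (measurableTypeR R)) -> \bar R :=
  pushforward (lebesgue_measure \x m)%E tuple_cons.

Fact leb_step0 : leb_step set0 = 0%E.
Proof. by rewrite /leb_step /pushforward preimage_set0 measure0. Qed.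

Fact leb_step_ge0 X : (0 <= leb_step X)%E.
Proof. by rewrite /leb_step /pushforward; apply: measure_ge0. Qed.

Fact leb_step_sigma_additive : semi_sigma_additive leb_step.
Proof.
move=> F mF tF mUF; rewrite /leb_step /pushforward preimage_bigcup.
apply: measure_semi_sigma_additive.
- by move=> k; rewrite -[X in measurable X]setTI; exact: measurable_tuple_cons.
- apply/trivIsetP => /= i j _ _ ij; rewrite -preimage_setI.
  by move/trivIsetP : tF => /(_ _ _ _ _ ij) ->//; rewrite preimage_set0.
- by rewrite -preimage_bigcup -[X in measurable X]setTI;
  exact: measurable_tuple_cons.
Qed.

HB.instance Definition _ := isMeasure.Build _ _ _
  leb_step leb_step0 leb_step_ge0 leb_step_sigma_additive.

Fact leb_step_sigma_finite : sigma_finite setT leb_step.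
Proof.
have /sigma_finiteP[F [TF ndF Foo]] := sigma_finiteT (@lebesgue_measure R).
have /sigma_finiteP[G [TG ndG Goo]] := sigma_finiteT m.
pose tl (t : n.+1.-tuple (measurableTypeR R)) := [tuple of behead t].
pose B k := ((fun t => tnth t ord0) @^-1` F k) `&` (tl @^-1` G k).
have consB k : tuple_cons @^-1` B k = F k `*` G k.
  by apply/seteqP; split=> -[x t]; rewrite /B /= (_ : tl _ = t)//; exact/val_inj.
exists B.
  rewrite predeqE => t; split=> // _.
  have : [set: R] (tnth t ord0) by [].
  rewrite TF => -[i _ Fi].
  have : [set: n.-tuple (measurableTypeR R)] (tl t) by [].
  rewrite TG => -[j _ Gj].
  exists (maxn i j) => //; split => /=.
    by move: Fi; exact/subsetPset/ndF/leq_maxl.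
  by move: Gj; exact/subsetPset/ndG/leq_maxr.
move=> k; have [? ?] := Foo k; have [? ?] := Goo k; split.
  apply: measurableI; rewrite -[X in measurable X]setTI.
    exact: measurable_tnth.
  exact: measurable_behead.
rewrite /leb_step /pushforward consB product_measure1E//.
by rewrite lte_mul_pinfty// ge0_fin_numE.
Qed.

HB.instance Definition _ := Measure_isSigmaFinite.Build _ _ _
  leb_step leb_step_sigma_finite.

End Step.

(* Lebesgue measure on R^n (product sigma-algebra), as the iterated product of the
   one-dimensional one; [leb_box] below is its value on boxes. *)
Fixpoint leb (n : nat) :
    {sigma_finite_measure set (n.-tuple (measurableTypeR R)) -> \bar R} :=
  match n with
  | 0 => dirac [tuple]
  | n'.+1 => leb_step (leb n')
  end.

End Lebesgue.

Section Lebesgue_box.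
Variable R : realType.

Lemma leb_box n (B : 'I_n -> set (measurableTypeR R)) :
  (forall i, measurable (B i)) ->
  leb R n [set t | forall i, B i (tnth t i)] =
  (\prod_(i < n) lebesgue_measure (B i))%E.
Proof.
elim: n B => [|n IH] B mB.
  rewrite big_ord0 /= diracE mem_set//; by case.
rewrite big_ord_recl -IH//= -product_measure1E//; last first.
  rewrite (_ : [set _ | _] =
    \big[setI/setT]_(i < n) ((@tnth n _ ^~ i) @^-1` B (lift ord0 i))).
    apply: bigsetI_measurable => i _; rewrite -[X in measurable X]setTI.
    exact: measurable_tnth.
  rewrite -bigcap_seq; apply/seteqP; split=> t /=.
    by move=> h i _; exact: h.
  by move=> h i; apply: h => /=; rewrite mem_index_enum.
rewrite /leb_step /pushforward; congr product_measure1.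
apply/seteqP; split=> -[x t] /=.
  by move=> h; split=> [|i]; [exact: (h ord0)|have := h (lift ord0 i); rewrite tnthS].
by move=> [h0 h] i; case: (unliftP ord0 i) => [j|] ->//; rewrite tnthS; exact: h.
Qed.

End Lebesgue_box.

Arguments isotropic {R} n m.

Inductive limit_case := Beurling | Roumieu.

Section Spaces.
Variables (R : realType) (n : nat) (M A : multi n -> R) (p : \bar R).
Implicit Types (f g : 'rV[R]_n -> R[i]) (l : R).

(* The Lebesgue measure lives on [n.-tuple R], while derivatives are taken on
   ['rV[R]_n]; the two copies of R^n are identified coordinatewise. *)
Definition Lp_norm (h : 'rV[R]_n -> \bar R) : \bar R :=
  Lnorm (leb R n) p (fun t => h (\row_i tnth t i)).

Definition X_norm l f : \bar R :=
  ereal_sup [set (Lp_norm (fun x =>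
      (Normc.normc (partial a f x))%:E * expeR (omega A (l^-1 *: x)))
      * ((l ^+ mlen a * M a)^-1)%:E)%E
    | a in [set: multi n]].

Definition X_set l : set ('rV[R]_n -> R[i]) :=
  [set f | smooth f /\ (X_norm l f < +oo)%E].

Definition X_space l : Type := X_set l.
HB.instance Definition _ l := Choice.on (X_space l).

Definition X_open l : set_system (X_space l) :=
  [set O : set (X_space l) | forall f : X_space l, O f -> exists2 e : R, 0 < e &
    forall g : X_space l, (X_norm l (val g - val f)%R < e%:E)%E -> O g].

Fact X_openT l : X_open [set: X_space l].
Proof. by move=> f _; exists 1. Qed.

Fact X_openI l : setI_closed (@X_open l).
Proof.
move=> U V oU oV f [Uf Vf].
have [e e0 He] := oU _ Uf; have [d d0 Hd] := oV _ Vf.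
exists (Num.min e d); first by rewrite lt_min e0.
move=> g; rewrite EFin_min lt_min => /andP[ge gd].
by split; [exact: He|exact: Hd].
Qed.

Fact X_open_bigU l (I : Type) (F : I -> set (X_space l)) :
  (forall i, X_open (F i)) -> X_open (\bigcup_i F i).
Proof.
move=> oF f [i _ Fif]; have [e e0 He] := oF i f Fif.
by exists e => // g /He; exists i.
Qed.

HB.instance Definition _ l := isOpenTopological.Build (X_space l)
  (@X_openT l) (@X_openI l) (@X_open_bigU l).

Definition GS (c : limit_case) : set ('rV[R]_n -> R[i]) :=
  match c with
  | Beurling => \bigcap_(l in [set l : R | 0 < l]) X_set l
  | Roumieu => \bigcup_(l in [set l : R | 0 < l]) X_set l
  end.

Definition GS_space (c : limit_case) : Type := GS c.
HB.instance Definition _ c := Choice.on (GS_space c).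

Definition proj (l : {posnum R}) : GS_space Beurling -> X_space l%:num :=
  subfun (bigcap_inf (gt0 l : [set l : R | 0 < l] l%:num)).

(* The coarsest topology making all inclusions into the steps continuous. *)
Definition proj_limit_topology : Type :=
  sup_topology (fun l : {posnum R} =>
    Topological.on (initial_topology (@proj l))).

Definition absolutely_convex (U : set ('rV[R]_n -> R[i])) : Prop :=
  forall u v (s t : R[i]), U u -> U v -> `|s| + `|t| <= 1 ->
    U (fun x => s * u x + t * v x).

(* Locally convex inductive limit topology (the finest locally convex topology
   making all inclusions of the steps continuous): the absolutely convex sets U
   such that U meets every step X_l in a 0-neighbourhood of X_l form a base of
   0-neighbourhoods; open sets are obtained by translation. *)
Definition ind_open : set_system (GS_space Roumieu) :=
  [set O | forall f : GS_space Roumieu, O f -> exists U : set ('rV[R]_n -> R[i]),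
    [/\ absolutely_convex U,
        forall l, 0 < l -> exists2 e : R, 0 < e &
          forall h, X_set l h -> (X_norm l h < e%:E)%E -> U h &
        forall g : GS_space Roumieu, U (val g - val f) -> O g]].

Fact ind_openT : ind_open [set: GS_space Roumieu].
Proof. by move=> f _; exists setT; split=> // l l0; exists 1. Qed.

Fact ind_openI : setI_closed ind_open.
Proof.
move=> O P oO oP f [Of Pf].
have [U [cU UX UO]] := oO f Of; have [V [cV VX VP]] := oP f Pf.
exists (U `&` V); split.
- by move=> u v s t [Uu Vu] [Uv Vv] st; split; [exact: cU|exact: cV].
- move=> l l0; have [e e0 He] := UX l l0; have [d d0 Hd] := VX l l0.
  exists (Num.min e d); first by rewrite lt_min e0.
  move=> h Xh; rewrite EFin_min lt_min => /andP[he hd].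
  by split; [exact: He|exact: Hd].
- by move=> g [Ug Vg]; split; [exact: UO|exact: VP].
Qed.

Fact ind_open_bigU (I : Type) (F : I -> set (GS_space Roumieu)) :
  (forall i, ind_open (F i)) -> ind_open (\bigcup_i F i).
Proof.
move=> oF f [i _ Fif]; have [U [cU UX UO]] := oF i f Fif.
by exists U; split=> // g /UO; exists i.
Qed.

Definition GS_open (c : limit_case) : set_system (GS_space c) :=
  match c with
  | Beurling => @open proj_limit_topology
  | Roumieu => ind_open
  end.

Fact GS_openT c : @GS_open c setT.
Proof. by case: c; [exact: openT|exact: ind_openT]. Qed.

Fact GS_openI c : setI_closed (@GS_open c).
Proof. by case: c; [move=> ? ?; exact: openI|exact: ind_openI]. Qed.

Fact GS_open_bigU c (I : Type) (F : I -> set (GS_space c)) :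
  (forall i, @GS_open c (F i)) -> @GS_open c (\bigcup_i F i).
Proof.
case: c F => F oF; last exact: ind_open_bigU.
by apply: bigcup_open => i _; exact: oF.
Qed.

HB.instance Definition _ c := isOpenTopological.Build (GS_space c)
  (@GS_openT c) (@GS_openI c) (@GS_open_bigU c).

End Spaces.

(* Main.v *)
Require Import Defs.
From HB Require Import structures.
From mathcomp Require Import all_boot all_order all_algebra.
From mathcomp Require Import all_classical all_reals all_analysis.
From mathcomp Require Import complex measurable_realfun ess_sup_inf.
From mathcomp Require Import ring lra.

Set Implicit Arguments.
Unset Strict Implicit.
Unset Printing Implicit Defensive.

Import Order.TTheory GRing.Theory Num.Theory.
Import numFieldNormedType.Exports.

Local Open Scope classical_set_scope.
Local Open Scope ring_scope.

(** If [M] and [A] are dominated by [N] and [B] with constants [C] and [H], the terms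
    of the norm of parameter [l] of the second space are at most [C ^ 2] times those
    of the norm of parameter [l / H] of the first one ([X_norm_domination]).
    This gives the inclusion and its continuity, for the projective and for the
    inductive limits alike. Conversely the domination has to be deduced from the
    inclusion of the sets alone. For each of the two dominations that could fail,
    a single element of the first space is built which is not in the second one.

    The building blocks come from [test_function]: as the first space is
    nonzero, it contains a function [h >= 0] with [h 0 > 0]. Averaging some element
    over a small cube gives uniform bounds besides the [L^p] ones without losing
    derivatives ([good_cube_average]), which is essential since the weight
    sequences need not be stable under shifts of the index; and log-convexity of [M]
    makes the space stable under products ([good_multiplier]), so that squaring
    gives nonnegativity.

    If [A] is not dominated by [B], log-convexity of [A] provides points [t j] and
    amplitudes [c j] ([gap_sequences]) such that [c j * growth A (t j / l)] is
    bounded in [j] for every [l] while [c j * growth B (t j / l)] is not, even after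
    multiplication by the terms [w j] of a convergent series. The sum of the
    functions [w j * c j * h (x - t j e0)] then is in the first space, and all its
    terms being nonnegative, it is too large near the points [t j e0] to be in
    the second one ([domination_translates]).

    If [M] is not dominated by [N], the same sequences, this time for [M] and [N],
    are used as frequencies: the product of [h] with the sum of the functions
    [w j * c j * cos (t j * x_0)] is in the first space. To see that its derivative
    of order [q] along the first axis is large in [L^p], one integrates it by parts
    against a cosine of frequency [t j] on the lines parallel to that axis, which
    brings the factor [t j ^ q] ([le_Rintegral_derive]), and compares integrals on
    lines with [L^p] norms ([Lp_norm_lines]). The terms of the series must not
    cancel each other. This is why [h] is an average over a period: its
    Fourier transform in the first variable vanishes at the nonzero integers
    ([Rintegral_cos_eq0]), and the [t j] are chosen to be integers, so that all the
    integrals involved are nonnegative ([Rintegral_cos_superposition_ge]). The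
    contradiction is drawn in [domination_modulations].

    The sums over [j] are integrals for a Poisson distribution, so that one theorem
    on the differentiation of superpositions ([rsmooth_superposition]) covers
    averages and series. *)

(** * Weight sequences on the natural numbers *)

Section Sequences.
Variable R : realType.
Implicit Types a b : nat -> R.

(** The last clause says without roots that [a q `^ q^-1] tends to infinity. *)
Definition weight_seq a : Prop :=
  [/\ forall q, 0 < a q, a 0%N = 1 &
      forall K : R, 0 <= K -> exists2 C : R, 0 < C & forall q, K ^+ q <= C * a q].

Definition log_convex_seq a : Prop :=
  forall q, a q.+1 ^+ 2 <= a q * a q.+2.

Lemma weight_sequence_isotropic n a :
  weight_sequence (isotropic n.+1 a) -> weight_seq a.
Proof.
pose e q : multi n.+1 := [ffun i => if i == ord0 then q else 0%N].
have eE q : mlen (e q) = q.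
  rewrite /mlen (bigD1 ord0)//= ffunE eqxx big1 ?addn0// => i /negbTE i0.
  by rewrite ffunE i0.
move=> [a0 a1 aoo].
have apos q : 0 < a q by have := a0 (e q); rewrite /isotropic eE.
split=> //.
  rewrite -a1 /isotropic; congr a; rewrite /mlen big1// => i _.
  by rewrite ffunE.
move=> K K0; have [q0 Hq0] := aoo K.
pose S := \sum_(q < q0.+1) K ^+ q / a q.
have S0 : 0 <= S.
  by apply: sumr_ge0 => q _; rewrite divr_ge0 ?exprn_ge0// ltW.
exists (1 + S); first by rewrite ltr_pwDl.
move=> q; have [qq0|q0q] := leqP q q0; last first.
  have := Hq0 (e q); rewrite eE /isotropic eE => /(_ (ltnW q0q)) Kq.
  apply: (@le_trans _ _ (a q)); last by rewrite ler_peMl ?lerDl// ltW.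
  have -> : a q = (a q `^ q%:R^-1) ^+ q.
    rewrite -powR_mulrn ?powR_ge0// -powRrM mulVf ?powRr1// ?ltW//.
    by rewrite pnatr_eq0 -lt0n (leq_ltn_trans _ q0q).
  by rewrite lerXn2r// nnegrE powR_ge0.
rewrite -ler_pdivrMr//.
have -> : K ^+ q / a q = K ^+ (Ordinal (qq0 : (q < q0.+1)%N)) / a (Ordinal (qq0 : (q < q0.+1)%N)) by [].
rewrite /S (bigD1 (Ordinal (qq0 : (q < q0.+1)%N)))//= addrCA lerDl.
by rewrite addr_ge0// sumr_ge0// => i _; rewrite divr_ge0 ?exprn_ge0// ltW.
Qed.

Lemma log_convex_isotropic n a : (forall q, 0 < a q) ->
  log_convex (isotropic n.+1 a) -> log_convex_seq a.
Proof.
move=> a0 [F [cF FE]] q.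
pose e q : multi n.+1 := [ffun i => if i == ord0 then q else 0%N].
have eE r : mlen (e r) = r.
  rewrite /mlen (bigD1 ord0)//= ffunE eqxx big1 ?addn0// => i /negbTE i0.
  by rewrite ffunE i0.
pose row r : 'rV[R]_n.+1 := \row_i (e r i)%:R.
have half : (0 <= 2^-1 :> R) && (2^-1 <= 1 :> R).
  by rewrite invr_ge0 ler0n/= invf_le1// ler1n.
pose t : {i01 R} := Itv01 (andP half).1 (andP half).2.
have rowD r : [set x : 'rV[R]_n.+1 | forall i, 0 <= x ord0 i] (row r).
  by move=> i; rewrite mxE.
have := cF t (row q) (row q.+2) (mem_set (rowD _)) (mem_set (rowD _)).
rewrite convRE.
have -> : @conv R (convex_lmodType 'rV[R]_n.+1) t (row q) (row q.+2) = row q.+1.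
  apply/rowP => i; rewrite !mxE/= !ffunE /unstable.onem; case: eqP => _.
    by rewrite -!natr1; field.
  by rewrite !mulr0 addr0.
rewrite !FE /isotropic !eE /= /unstable.onem => h.
rewrite -ler_ln ?posrE ?exprn_gt0 ?mulr_gt0// lnXn// lnM ?posrE//.
by rewrite -mulr_natr; lra.
Qed.


Section Log_convex.
Variable a : nat -> R.
Hypotheses (wa : weight_seq a) (lca : log_convex_seq a).

Let apos q : 0 < a q. Proof. by have [] := wa. Qed.
Let a0 : a 0%N = 1. Proof. by have [] := wa. Qed.

Definition ratio q := a q.+1 / a q.

Let ratio_gt0 q : 0 < ratio q. Proof. exact: divr_gt0. Qed.

Lemma ratio_homo : {homo ratio : p q / (p <= q)%N >-> p <= q}.
Proof.
apply: homo_leq => //; first exact: le_trans.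
move=> q; rewrite /ratio ler_pdivlMr// mulrAC ler_pdivrMr//.
by rewrite -expr2 mulrC lca.
Qed.

Let ratioE q : a q.+1 = ratio q * a q.
Proof. by rewrite /ratio divfK// gt_eqF. Qed.

(** As the ratios are nondecreasing, the product of [p] of them starting at [q] is
    at least the product of the first [p]. *)
Lemma log_convex_supermul p q : a p * a q <= a (p + q)%N.
Proof.
elim: p => [|p IH]; first by rewrite a0 mul1r.
rewrite addSn !ratioE -mulrA; apply: ler_pM => //.
- by rewrite ltW.
- by rewrite mulr_ge0// ltW.
- by apply: ratio_homo; rewrite leq_addr.
Qed.

(** The terms of [r ^ s / a s] increase while [ratio s <= r] and decrease
    afterwards, so that at [r = ratio q] the maximum is attained at [q.+1]. *)
Lemma log_convex_peak q s : ratio q ^+ s * a q.+1 <= ratio q ^+ q.+1 * a s.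
Proof.
have [sq|] := leqP s q.+1.
  rewrite -(subnKC sq); move: (q.+1 - s)%N (subnKC sq) => d sd.
  rewrite exprD -mulrA ler_wpM2l ?exprn_ge0 ?(ltW (ratio_gt0 _))//.
  elim: d {sq} s sd => [|d IH] s sd; first by rewrite expr0 mul1r addn0.
  rewrite addnS -addSn (le_trans (IH s.+1 _)) ?addSn -?addnS//.
  rewrite (ratioE s) exprSr -(mulrA (_ ^+ d)) ler_wpM2l ?exprn_ge0 ?(ltW (ratio_gt0 _))//.
  rewrite ler_wpM2r ?(ltW (apos _))// ratio_homo//.
  by rewrite -ltnS -sd addnS ltnS leq_addr.
move=> /ltnW qs; rewrite -(subnKC qs); move: (s - q.+1)%N => d.
rewrite exprD -mulrA ler_wpM2l ?exprn_ge0 ?(ltW (ratio_gt0 _))//.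
elim: d => [|d IH]; first by rewrite expr0 mul1r addn0.
rewrite exprS addnS (ratioE (q.+1 + d)) -(mulrA _ (_ ^+ d)) ler_pM//.
- by rewrite ltW.
- by rewrite mulr_ge0 ?exprn_ge0// ltW.
- by rewrite ratio_homo// addSn (leq_trans (leqnSn q))// leq_addr.
Qed.

Lemma weight_seq_min b : weight_seq b -> exists2 v : R, 0 < v & forall q, v <= b q.
Proof.
case=> b0 _ /(_ 1 ler01)[C C0 CB]; exists C^-1; first by rewrite invr_gt0.
by move=> q; rewrite -[leLHS]mulr1 mulrC ler_pdivrMr// mulrC -(expr1n _ q) CB.
Qed.

(** If [a] is not dominated by any [C * H ^ q * b q], the domination with
    constants of the order of [k] fails at some index [q k]. By
    [log_convex_peak], there is a frequency [r] for which [r ^ s / a s] is largest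
    at [s = q k]; the amplitude [a (q k) / r ^ q k] then gives
    [amplitude * r ^ s <= a s] for all [s], with equality at [q k]. Dividing
    the frequency by about [k.+1] gains a geometric factor that tends to zero, and
    the failure of the domination is large enough to survive that division. The
    weights [w] stand for the masses of the terms of a series. *)
Lemma gap_sequences b (w : nat -> R) : weight_seq b -> (forall k, 0 < w k) ->
  ~ (exists C H : R, [/\ 0 < C, 0 < H & forall q, a q <= C * H ^+ q * b q]) ->
  exists (c : nat -> R) (t q : nat -> nat),
    [/\ forall k, 0 < c k,
        forall l : R, 0 < l -> exists2 C : R, 0 < C &
          forall k s, c k * (t k)%:R ^+ s <= C * l ^+ s * a s &
        forall l C : R, 0 < l -> exists k,
          C * l ^+ q k * b (q k) < w k * c k * (t k)%:R ^+ q k].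
Proof.
move=> wb w0 nab; have [v v0 vb] := weight_seq_min wb.
have b0 q : 0 < b q by have [] := wb.
(* In [2 * k.+1 ^ 2], a factor [2 * k.+1] makes up for the division of the frequency
   and its rounding to a natural number, the other [k.+1] beats any [l]. *)
have ex k : exists q, k.+1%:R <= ratio q /\
    k.+1%:R / w k * (2 * k.+1%:R ^+ 2) ^+ q.+1 * b q.+1 < a q.+1.
  apply: contrapT => /forallNP nq; apply: nab.
  pose Ck := k.+1%:R / w k; pose Hk : R := 2 * k.+1%:R ^+ 2.
  have Ck0 : 0 < Ck by rewrite divr_gt0.
  have k1 : 1 <= k.+1%:R :> R by rewrite ler1n.
  have kH : k.+1%:R <= Hk by rewrite /Hk; nra.
  have Hk0 : 0 < Hk by rewrite (lt_le_trans _ kH).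
  exists (Ck + v^-1), Hk; split=> //; first by rewrite addr_gt0// invr_gt0.
  case=> [|q].
    have Ckb : 0 <= Ck * b 0%N by rewrite ltW// mulr_gt0.
    rewrite a0 expr0 mulr1 mulrDl ler_wpDl//.
    by rewrite mulrC ler_pdivlMr// mul1r.
  have X0 : 0 <= Hk ^+ q.+1 * b q.+1 by rewrite ltW// mulr_gt0// exprn_gt0.
  rewrite !mulrDl.
  (* Where the ratio is small, [a q.+1 <= ratio q ^+ q.+1] is already enough. *)
  have [kr|rk] := leP k.+1%:R (ratio q).
    apply: (@le_trans _ _ (Ck * Hk ^+ q.+1 * b q.+1)).
      by rewrite leNgt; apply/negP => h; apply: (nq q).
    by rewrite lerDl -mulrA mulr_ge0// invr_ge0 ltW.
  apply: (@le_trans _ _ (v^-1 * Hk ^+ q.+1 * b q.+1)); last first.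
    by rewrite lerDr -mulrA mulr_ge0// ltW.
  have := log_convex_peak q 0; rewrite expr0 mul1r a0 mulr1 => /le_trans; apply.
  apply: (@le_trans _ _ (Hk ^+ q.+1)).
    by rewrite lerXn2r// ?nnegrE ?(ltW (ratio_gt0 _)) ?(ltW Hk0)// (le_trans (ltW rk)).
  rewrite mulrAC ler_peMl ?exprn_ge0 ?(ltW Hk0)//.
  by rewrite mulrC ler_pdivlMr// mul1r.
have [q qP] := choice ex.
pose m k := ratio (q k).
have m0 k : 0 < m k by exact: ratio_gt0.
have mk k : 1 <= m k / k.+1%:R by rewrite ler_pdivlMr// mul1r; have [] := qP k.
pose t k := Num.truncn (m k / k.+1%:R).
have tm k : (t k)%:R <= m k / k.+1%:R.
  by rewrite truncn_le// (le_trans _ (mk k)).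
have t1 k : 1 <= (t k)%:R :> R.
  by rewrite ler1n -ltnS -(ltr_nat R) (le_lt_trans (mk k))// truncnS_gt.
have tm2 k : m k / (2 * k.+1%:R) <= (t k)%:R.
  have := truncnS_gt (m k / k.+1%:R); rewrite -/(t k) -natr1 => h.
  rewrite invfM mulrCA ler_pdivrMl//; have := t1 k; lra.
pose c k := a (q k).+1 / m k ^+ (q k).+1.
have c0 k : 0 < c k by rewrite divr_gt0// exprn_gt0.
have ct k s : c k * (t k)%:R ^+ s <= a s / k.+1%:R ^+ s.
  apply: (@le_trans _ _ (c k * (m k / k.+1%:R) ^+ s)).
    by rewrite ler_wpM2l ?(ltW (c0 _))// lerXn2r ?nnegrE// divr_ge0// ltW.
  rewrite expr_div_n mulrA ler_pM2r ?invr_gt0 ?exprn_gt0//.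
  by rewrite /c mulrAC ler_pdivrMr ?exprn_gt0// mulrC [leRHS]mulrC log_convex_peak.
exists c, t, (fun k => (q k).+1); split=> //.
- move=> l l0.
  have [_ _ wK] := wa.
  have /choice[D DP] k : exists D, 0 < D /\ forall s, ((t k)%:R / l) ^+ s <= D * a s.
    by have [|D D0 DP] := wK ((t k)%:R / l); [rewrite divr_ge0// ltW|exists D].
  have D0 k : 0 < D k by have [] := DP k.
  pose K := Num.truncn l^-1.
  have S0 : 0 <= \sum_(k < K.+1) c k * D k.
    by apply: sumr_ge0 => k _; rewrite mulr_ge0// ltW.
  exists (1 + \sum_(k < K.+1) c k * D k); first by rewrite ltr_pwDl.
  (* The terms with [l^-1 <= k.+1] obey the bound with constant 1. *)
  move=> k s; have [kK|Kk] := ltnP k K.+1; last first.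
    apply: (le_trans (ct k s)); apply: (@le_trans _ _ (l ^+ s * a s)).
      rewrite mulrC ler_wpM2r ?(ltW (apos _))// -exprVn.
      rewrite lerXn2r ?nnegrE ?invr_ge0 ?(ltW l0)//.
      rewrite -[leRHS]invrK lef_pV2 ?posrE ?invr_gt0//.
      by rewrite (le_trans (ltW (truncnS_gt _)))// ler_nat ltnW.
    by rewrite -mulrA ler_peMl ?lerDl// mulr_ge0 ?exprn_ge0 ?(ltW l0) ?(ltW (apos s)).
  have -> : c k * (t k)%:R ^+ s = c k * ((t k)%:R / l) ^+ s * l ^+ s.
    by rewrite expr_div_n mulrA divfK// expf_neq0// gt_eqF.
  rewrite [leRHS]mulrAC ler_wpM2r ?exprn_ge0 ?(ltW l0)//.
  have [_ /(_ s) h] := DP k.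
  apply: (@le_trans _ _ (c k * D k * a s)).
    by rewrite -mulrA ler_wpM2l// ltW.
  rewrite ler_wpM2r ?(ltW (apos _))// (bigD1 (Ordinal kK))//= addrCA lerDl.
  by rewrite addr_ge0// sumr_ge0// => i _; rewrite mulr_ge0// ltW.
- move=> l C l0.
  pose k := Num.truncn (`|C| + l); exists k.
  have k0 : 0 < k.+1%:R :> R by [].
  have := truncnS_gt (`|C| + l); rewrite -/k => Clk.
  have Ck : C <= k.+1%:R.
    by have := ler_norm C; move: (normr_ge0 C) Clk l0; set z := _.+1%:R; lra.
  have lk : l <= k.+1%:R by move: (normr_ge0 C) Clk; set z := _.+1%:R; lra.
  apply: (@le_lt_trans _ _ (k.+1%:R * k.+1%:R ^+ (q k).+1 * b (q k).+1)).
    rewrite ler_wpM2r ?(ltW (b0 _))// (@le_trans _ _ (k.+1%:R * l ^+ (q k).+1))//.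
      by rewrite ler_wpM2r// exprn_ge0// ltW.
    by rewrite ler_wpM2l// lerXn2r// nnegrE ltW.
  apply: (@lt_le_trans _ _ (w k * c k * (m k / (2 * k.+1%:R)) ^+ (q k).+1)); last first.
    have wc : 0 <= w k * c k by rewrite ltW// mulr_gt0.
    by rewrite ler_wpM2l// lerXn2r// nnegrE// divr_ge0// ltW.
  have -> : w k * c k * (m k / (2 * k.+1%:R)) ^+ (q k).+1 =
            w k * a (q k).+1 / (2 * k.+1%:R) ^+ (q k).+1.
    rewrite expr_div_n /c; have := lt0r_neq0 (m0 k).
    move=> /(expf_neq0 (q k).+1); set X := m k ^+ _ => X0.
    have : (2 * k.+1%:R : R) ^+ (q k).+1 != 0 by rewrite expf_neq0// gt_eqF// mulr_gt0.
    set Y := (2 * _) ^+ _ => Y0; field; by rewrite Y0 X0.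
  rewrite ltr_pdivlMr ?exprn_gt0//.
  have [_] := qP k; rewrite -(ltr_pM2l (w0 k)); congr (_ < _).
  have -> : 2 * k.+1%:R ^+ 2 = (2 * k.+1%:R) * k.+1%:R :> R by rewrite expr2 mulrA.
  rewrite exprMn; set X := (2 * _) ^+ _; set Y := _ ^+ _.
  by field; rewrite gt_eqF.
Qed.

End Log_convex.

End Sequences.

(** * The exponential of the associated function *)

Section Growth.
Variable R : realType.
Implicit Types (a : nat -> R) (r : R).

(** This is [exp (omega a x)] as a function of [r = `|x|]. *)
Definition growth a r : R := sup (range (fun q => r ^+ q / a q)).

Section Growth_theory.
Variable a : nat -> R.
Hypothesis wa : weight_seq a.

Let apos q : 0 < a q. Proof. by have [] := wa. Qed.

Lemma has_sup_growth r : 0 <= r -> has_sup (range (fun q => r ^+ q / a q)).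
Proof.
move=> r0; split; first by exists (r ^+ 0 / a 0%N); exists 0%N.
have [_ _ /(_ r r0)[C C0 HC]] := wa; exists C => _ [q _ <-].
by rewrite ler_pdivrMr.
Qed.

Lemma growth_ub r q : 0 <= r -> r ^+ q / a q <= growth a r.
Proof.
by move=> /has_sup_growth[_ ub]; apply: ub_le_sup => //; exists q.
Qed.

Lemma growth_le r K : (forall q, r ^+ q / a q <= K) -> growth a r <= K.
Proof.
move=> rK; apply: ge_sup; first by exists (r ^+ 0 / a 0%N); exists 0%N.
by move=> _ [q _ <-].
Qed.

Lemma growth_ge1 r : 0 <= r -> 1 <= growth a r.
Proof.
move=> r0; rewrite (le_trans _ (growth_ub 0 r0))//.
by have [_ -> _] := wa; rewrite expr0 divr1.
Qed.

Lemma growth_gt0 r : 0 <= r -> 0 < growth a r.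
Proof. by move=> /growth_ge1; apply: lt_le_trans. Qed.

Lemma growth_homo r s : 0 <= r -> r <= s -> growth a r <= growth a s.
Proof.
move=> r0 rs; apply: growth_le => q.
rewrite (le_trans _ (growth_ub q (le_trans r0 rs)))//.
by rewrite ler_wpM2r ?invr_ge0 ?(ltW (apos _))// lerXn2r// nnegrE (le_trans r0).
Qed.

(** A sum is at most twice the larger of its terms. *)
Lemma growthD r s : 0 <= r -> 0 <= s ->
  growth a (r + s) <= growth a (2 * r) * growth a (2 * s).
Proof.
move=> r0 s0; wlog rs : r s r0 s0 / r <= s.
  move=> wl; have [rs|/ltW sr] := leP r s; first exact: wl.
  by rewrite addrC mulrC; exact: wl.
apply: (@le_trans _ _ (growth a (2 * s))).
  by apply: growth_homo; [rewrite addr_ge0|lra].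
rewrite ler_peMl ?growth_ge1 ?mulr_ge0//.
by rewrite ltW// growth_gt0// mulr_ge0.
Qed.

(** Among the monomials of given degree, the power of a coordinate of largest
    modulus is maximal. *)
Lemma expeR_omega n (x : 'rV[R]_n.+1) :
  expeR (omega (isotropic n.+1 a) x) = (growth a `|x|)%:E.
Proof.
set S := [set lne (`|\prod_(i < n.+1) x ord0 i ^+ m i| / isotropic n.+1 a m)%:E
            | m in [set: multi n.+1]].
have monE (m : multi n.+1) :
    expeR (lne (`|\prod_(i < n.+1) x ord0 i ^+ m i| / isotropic n.+1 a m)%:E) =
    (`|\prod_(i < n.+1) x ord0 i ^+ m i| / isotropic n.+1 a m)%:E.
  by apply: lneK; rewrite in_itv/= leey andbT lee_fin divr_ge0// ltW// apos.
have xle i : `|x ord0 i| <= `|x|.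
  rewrite [leRHS]mx_normrE.
  by apply: (le_bigmax _ (fun ij : 'I_1 * 'I_n.+1 => `|x ij.1 ij.2|) (ord0, i)).
have [i0 xi0] : exists i, `|x| = `|x ord0 i|.
  have [x0|x0] := eqVneq `|x| 0.
    by exists ord0; apply/eqP; rewrite eq_le xle x0/= normr_ge0.
  have [[i j] xij] := mx_norm_neq0 x0; exists j.
  by rewrite -[LHS]/(mx_norm x) xij/= (ord1 i).
have Sle : (omega (isotropic n.+1 a) x <= lne (growth a `|x|)%:E)%E.
  apply: ge_ereal_sup => _ [m _ <-]; rewrite -lee_expeR monE lneK; last first.
    by rewrite in_itv/= leey andbT lee_fin ltW// growth_gt0.
  rewrite lee_fin (le_trans _ (growth_ub (mlen m) (normr_ge0 x)))//.
  rewrite ler_wpM2r ?invr_ge0 ?(ltW (apos _))// normr_prod /mlen.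
  rewrite expr_sum; apply: ler_prod => i _.
  by rewrite normr_ge0 normrX lerXn2r// nnegrE.
have leS q : ((`|x| ^+ q / a q)%:E <= expeR (omega (isotropic n.+1 a) x))%E.
  pose m : multi n.+1 := [ffun i => if i == i0 then q else 0%N].
  have mE : mlen m = q.
    rewrite /mlen (bigD1 i0)//= ffunE eqxx big1 ?addn0// => i /negbTE ii0.
    by rewrite ffunE ii0.
  have -> : (`|x| ^+ q / a q)%:E =
      (`|\prod_(i < n.+1) x ord0 i ^+ m i| / isotropic n.+1 a m)%:E.
    rewrite /isotropic mE (bigD1 i0)//= big1 ?mulr1; last first.
      by move=> i /negbTE ii0; rewrite ffunE ii0 expr0.
    by rewrite ffunE eqxx normrX -xi0.
  by rewrite -monE lee_expeR; apply: ereal_sup_ubound; exists m.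
apply/eqP; rewrite eq_le; apply/andP; split.
  rewrite (le_trans (_ : _ <= expeR (lne (growth a `|x|)%:E))%E) ?lee_expeR//.
  by rewrite lneK// in_itv/= leey andbT lee_fin ltW// growth_gt0.
move: (leS) Sle; case: (omega _ _) => [w| |] //= wS Sle.
- rewrite lee_fin; apply: growth_le => q; have := wS q.
  by rewrite lee_fin.
- by rewrite leey.
- have := wS 0%N; rewrite expr0 lee_fin leNgt => /negP[].
  by rewrite divr_gt0.
Qed.

Lemma expeR_omegaZ n (x : 'rV[R]_n.+1) (l : R) : 0 < l ->
  expeR (omega (isotropic n.+1 a) (l^-1 *: x)) = (growth a (`|x| / l))%:E.
Proof.
by move=> l0; rewrite expeR_omega normrZ ger0_norm ?invr_ge0 ?(ltW l0)// mulrC.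
Qed.

End Growth_theory.

Lemma growth_mono a b C H : weight_seq a -> weight_seq b -> 0 < C -> 0 < H ->
  (forall q, a q <= C * H ^+ q * b q) ->
  forall r, 0 <= r -> growth b r <= C * growth a (H * r).
Proof.
move=> wa wb C0 H0 ab r r0; apply: growth_le => q.
have [[a0 _ _] [b0 _ _]] := (wa, wb).
rewrite -ler_pdivrMl// (le_trans _ (growth_ub wa q _)) ?mulr_ge0 ?(ltW H0)//.
rewrite ler_pdivlMr// (le_trans (ler_wpM2l _ (ab q)))//.
  by rewrite !mulr_ge0 ?exprn_ge0 ?invr_ge0// ltW.
rewrite exprMn le_eqVlt; apply/orP; left; apply/eqP.
by field; rewrite !gt_eqF.
Qed.

End Growth.

(** * Measure theory on R^n *)

Section Measurability.
Context {R : realType} d {T : measurableType d} {n : nat}.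

(** Open subsets of R^n are countable unions of rational cubes, and those are
    measurable through the coordinates. *)
Lemma measurable_continuous_coords (g : T -> 'rV[R]_n) (F : 'rV[R]_n -> R) :
  (forall i, measurable_fun setT (fun t => g t ord0 i)) -> continuous F ->
  measurable_fun setT (F \o g).
Proof.
move=> mg cF _; apply: (measurability _ (RGenOInfty.measurableE R)) => //.
move=> /= _ [_ [a ->] <-]; rewrite setTI.
pose O := F @^-1` `]a, +oo[%classic.
have oO : open O by apply: open_comp => // x _; exact: cF.
pose cube (ce : 'rV[rat]_n * rat) : set 'rV[R]_n :=
  [set x | forall i, `|x ord0 i - ratr (ce.1 ord0 i)| < ratr ce.2].
have OE : O = \bigcup_ce (if `[< cube ce `<=` O >] then cube ce else set0).
  apply/seteqP; split; last first.
    by move=> x [ce _]; case: asboolP => // + cx; exact.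
  move=> x Ox; have : nbhs x O by apply: open_nbhs_nbhs.
  move=> /nbhs_ballP[e /= e0 xeO].
  have [q /[!in_itv]/= /andP[q0 qe]] := rat_in_itvoo (divr_gt0 e0 (ltr0n R 2)).
  have /choice[c cP] i : exists c : rat, x ord0 i - ratr q < ratr c < x ord0 i + ratr q.
    have [|c /[!in_itv]/= cP] := @rat_in_itvoo R (x ord0 i - ratr q) (x ord0 i + ratr q).
      by rewrite ltrD2l gt0_cp.
    by exists c.
  exists (\row_i c i, q) => //.
  have cx : cube (\row_i c i, q) x.
    move=> i; rewrite mxE/= ltr_norml.
    by have /andP[? ?] := cP i; apply/andP; split; lra.
  case: asboolP => // -[] y cy; apply: xeO.
  rewrite mx_norm_ball /ball_/= [X in X < _]mx_normrE.
  apply/bigmax_ltP; split=> // -[i j] _ /=; rewrite !mxE (ord1 i).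
  have := cx j; have := cy j; rewrite /= !mxE.
  rewrite !ltr_norml => /andP[? ?] /andP[? ?]; apply/andP; split; lra.
rewrite [X in measurable X](_ : _ = \bigcup_ce (if `[< cube ce `<=` O >] then g @^-1` cube ce else set0)); last first.
  rewrite -[LHS]/(g @^-1` O) {1}OE preimage_bigcup.
  by apply: eq_bigcup => // ce _; case: ifP.
apply: countable_bigcupT_measurable; first exact: countableP.
move=> ce; case: ifP => // _.
rewrite (_ : _ @^-1` _ = \big[setI/setT]_(i < n)
    [set t | `|g t ord0 i - ratr (ce.1 ord0 i)| < ratr ce.2]).
  apply: bigsetI_measurable => i _.
  rewrite -[X in measurable X]setTI (_ : [set t | _] =
    (fun t => g t ord0 i - ratr (ce.1 ord0 i)) @^-1` `]- ratr ce.2, ratr ce.2[).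
    by apply: measurable_funB.
  by apply/seteqP; split=> t /=; rewrite in_itv/= ltr_norml.
rewrite -bigcap_seq; apply/seteqP; split=> t /=.
  by move=> h i _; exact: h.
by move=> h i; apply: h => /=; rewrite mem_index_enum.
Qed.

End Measurability.

Section Weighted_integrals.
Context {R : realType} d {T : measurableType d}.
Variable mu : {measure set T -> \bar R}.
Implicit Types F psi : T -> R.

Lemma powR_Young (r K x : R) : 1 <= r -> 0 < K -> 0 <= x ->
  x <= K + K * (x / K) `^ r.
Proof.
move=> r1 K0 x0; have [xK|Kx] := leP x K.
  by rewrite (le_trans xK)// lerDl mulr_ge0 ?powR_ge0// ltW.
rewrite (le_trans (_ : _ <= K * (x / K) `^ r)) ?lerDr ?(ltW K0)//.
rewrite -ler_pdivrMl// mulrC le1r_powR// ler_pdivlMr// mul1r ltW//.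
Qed.

Local Open Scope ereal_scope.

Lemma ge0_le_poweR (r : R) (x y : \bar R) : (0 <= r)%R -> 0 <= x -> x <= y ->
  x `^ r <= y `^ r.
Proof.
move=> r0 x0 xy; apply: gt0_ler_poweR => //; rewrite in_itv/= leey andbT//.
exact: le_trans xy.
Qed.

Lemma integral_Young (r K : R) F psi : (1 <= r)%R -> (0 < K)%R ->
  measurable_fun setT F -> measurable_fun setT psi ->
  (forall x, 0 <= F x)%R -> (forall x, 0 <= psi x <= 1)%R ->
  \int[mu]_x (F x * psi x)%:E <=
  K%:E * \int[mu]_x (psi x)%:E + K%:E * \int[mu]_x ((F x / K) `^ r)%:E.
Proof.
move=> r1 K0 mF mpsi F0 psi01.
have mFr : measurable_fun setT (fun x => (F x / K) `^ r)%R.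
  by apply: (measurableT_comp (measurable_powR r)); apply: measurable_funM.
have psi0 x : (0 <= psi x)%R by have /andP[] := psi01 x.
rewrite -!ge0_integralZl ?lee_fin ?(ltW K0)//; try exact/measurable_EFinP;
  try by move=> x _; rewrite lee_fin ?powR_ge0.
rewrite -ge0_integralD//;
  try by apply/measurable_EFinP; exact: measurable_funM.
all: try by move=> x _; rewrite lee_fin mulr_ge0 ?powR_ge0// ltW.
apply: ge0_le_integral => //.
- by move=> x _; rewrite lee_fin mulr_ge0.
- by apply/measurable_EFinP; exact: measurable_funM.
- by apply/measurable_EFinP; apply: measurable_funD; exact: measurable_funM.
- move=> x _; rewrite -EFinD lee_fin.
  rewrite (le_trans (ler_wpM2r (psi0 x) (powR_Young r1 K0 (F0 x))))//.
  have /andP[p0 p1] := psi01 x; rewrite mulrDl lerD2l.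
  by rewrite ler_piMr// mulr_ge0 ?powR_ge0// ltW.
Qed.

(** An elementary substitute for Hoelder's inequality, covering at once
    all exponents. *)
Lemma Lnorm_integral (p : \bar R) (K : R) F psi : 1 <= p -> (0 < K)%R ->
  measurable_fun setT F -> measurable_fun setT psi ->
  (forall x, 0 <= F x)%R -> (forall x, 0 <= psi x <= 1)%R ->
  'N[mu]_p[EFin \o F] <= K%:E ->
  \int[mu]_x (F x * psi x)%:E <= K%:E * (\int[mu]_x (psi x)%:E + 1).
Proof.
move=> p1 K0 mF mpsi F0 psi01.
have psi0 x : (0 <= psi x)%R by have /andP[] := psi01 x.
have I0 : 0 <= \int[mu]_x (psi x)%:E by apply: integral_ge0 => x _; rewrite lee_fin.
rewrite ge0_muleDr ?lee_fin// mule1.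
case: p p1 => [r| |//]; rewrite ?lee_fin => r1 NK.
  have r0 : (0 < r)%R by rewrite (lt_le_trans _ r1).
  apply: (le_trans (integral_Young r1 K0 mF mpsi F0 psi01)).
  rewrite leeD2l// -[leRHS]mule1 lee_wpmul2l ?lee_fin ?(ltW K0)//.
  under eq_integral => x _.
    rewrite powRM ?invr_ge0 ?F0 ?(ltW K0)// mulrC EFinM; over.
  rewrite ge0_integralZl//=;
    try (by apply/measurable_EFinP; exact: (measurableT_comp (measurable_powR r)));
    try by move=> *; rewrite lee_fin powR_ge0.
  have : 'N[mu]_r%:E[EFin \o F] `^ r <= (K `^ r)%:E.
    by rewrite -poweR_EFin ge0_le_poweR ?Lnorm_ge0 ?(ltW r0).
  rewrite poweR_Lnorm ?gt_eqF// => h.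
  rewrite (_ : \int[mu]_x ((F x) `^ r)%:E = \int[mu]_x `|(EFin \o F) x| `^ r); last first.
    by apply: eq_integral => x _ /=; rewrite ger0_norm.
  rewrite (le_trans (lee_wpmul2l _ h)) ?lee_fin ?powR_ge0//.
  by rewrite -powRM ?invr_ge0 ?(ltW K0)// mulVf ?gt_eqF// powR1.
apply: (@le_trans _ _ (K%:E * \int[mu]_x (psi x)%:E)); last first.
  by rewrite leeDl// lee_fin ltW.
move: NK; rewrite unlock; case: ifPn => [mu0 NK|]; last first.
  rewrite -leNgt measure_le0 => /eqP mu0 _.
  rewrite null_set_integral//.
    by rewrite mule_ge0// lee_fin ltW.
  by apply/measurable_EFinP; exact: measurable_funM.
rewrite -ge0_integralZl//; try exact/measurable_EFinP;
  try by move=> *; rewrite lee_fin ?(ltW K0).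
apply: ae_ge0_le_integral => //;
  try by apply/measurable_EFinP; exact: measurable_funM.
all: try by move=> x _; rewrite -?EFinM lee_fin mulr_ge0// ltW.
have /ess_supP := NK; apply: filterS => x /= + _.
rewrite ger0_norm// lee_fin => FK; rewrite -EFinM lee_fin.
exact: ler_wpM2r.
Qed.

(** Jensen's inequality up to a constant: Young's inequality with the best
    parameter. *)
Lemma integral_powR_le (r m : R) F : (1 <= r)%R -> mu setT <= m%:E ->
  measurable_fun setT F -> (forall x, 0 <= F x)%R ->
  (\int[mu]_x (F x)%:E) `^ r <= ((m + 1) `^ r)%:E * \int[mu]_x (F x `^ r)%:E.
Proof.
move=> r1 mm mF F0.
have r0 : (0 < r)%R by rewrite (lt_le_trans _ r1).
have m0 : (0 <= m)%R by rewrite -lee_fin (le_trans _ mm).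
have mFr : measurable_fun setT (fun x => F x `^ r)%R.
  exact: (measurableT_comp (measurable_powR r)).
have I0 : 0 <= \int[mu]_x (F x)%:E by apply: integral_ge0 => x _; rewrite lee_fin.
have J0 : 0 <= \int[mu]_x (F x `^ r)%:E.
  by apply: integral_ge0 => x _; rewrite lee_fin powR_ge0.
have H (K : R) : (0 < K)%R ->
    \int[mu]_x (F x)%:E <= (K * m)%:E + K%:E * ((K^-1 `^ r)%:E * \int[mu]_x (F x `^ r)%:E).
  move=> K0.
  have one01 (x : T) : (0 <= cst (1 : R) x <= (1 : R))%R by rewrite /cst ler01 lexx.
  have := integral_Young r1 K0 mF (measurable_cst _) F0 one01.
  under eq_integral do rewrite mulr1.
  move=> /le_trans; apply.
  rewrite (_ : \int[mu]_x (cst (1 : R) x)%R%:E = mu setT); last first.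
    by rewrite -[RHS]mul1e -integral_cst.
  rewrite EFinM leeD//.
    by rewrite lee_wpmul2l// lee_fin ltW.
  rewrite lee_wpmul2l ?lee_fin ?(ltW K0)// -ge0_integralZl//;
    try exact/measurable_EFinP; try by move=> *; rewrite lee_fin powR_ge0.
  rewrite le_eqVlt; apply/orP; left; apply/eqP.
  apply: eq_integral => x _; rewrite powRM ?invr_ge0 ?F0 ?(ltW K0)//.
  by rewrite mulrC EFinM.
move: J0 H; move: (\int[mu]_x (F x `^ r)%:E) => J J0 H.
case: J J0 H => [J| |//]; last first.
  by move=> _ _; rewrite gt0_muley ?leey// lte_fin powR_gt0// ltr_pwDr.
rewrite lee_fin le_eqVlt => /predU1P[<-|J0] H.
  rewrite mule0 (_ : \int[mu]_x (F x)%:E = 0) ?poweR0r ?gt_eqF//.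
  apply/eqP; rewrite eq_le I0 andbT; apply/lee_addgt0Pr => e e0.
  have e1 : (0 < e / (m + 1))%R by rewrite divr_gt0// ltr_pwDr.
  rewrite (le_trans (H _ e1))// !mule0 adde0 add0e lee_fin mulrAC ler_pdivrMr ?ltr_pwDr//.
  by rewrite ler_wpM2l ?(ltW e0)// lerDl.
have [K K0 JK] : exists2 K : R, (0 < K)%R & (J = K `^ r)%R.
  exists (J `^ r^-1)%R; first by rewrite powR_gt0.
  by rewrite -powRrM mulVf ?gt_eqF// powRr1// ltW.
have {}H : \int[mu]_x (F x)%:E <= ((m + 1) * K)%:E.
  rewrite (le_trans (H _ K0))// JK -!EFinM -EFinD lee_fin -powRM ?invr_ge0 ?(ltW K0)//.
  by rewrite mulVf ?gt_eqF// powR1 mulr1 mulrDl mul1r mulrC.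
rewrite (le_trans (ge0_le_poweR (ltW r0) I0 H))//.
by rewrite poweR_EFin powRM ?(ltW K0) ?addr_ge0// JK.
Qed.

End Weighted_integrals.

(** * Lebesgue measure on R^n *)

Section Translation.
Variable R : realType.
Local Notation mR := (measurableTypeR R).
Local Open Scope ereal_scope.

Lemma measurable_shift (c : R) : measurable_fun setT (fun x : mR => (x + c)%R : mR).
Proof. exact: measurable_funD. Qed.

Lemma lebesgue_measure_shift (c : R) (A : set mR) : measurable A ->
  pushforward (@lebesgue_measure R) (fun x : mR => (x + c)%R : mR) A =
  lebesgue_measure A.
Proof.
move=> mA.
pose m := pushforward (@lebesgue_measure R) (fun x : mR => (x + c)%R : mR).
have ms := measurable_shift c.
pose fm : {mfun mR >-> mR} := HB.pack (fun x : mR => (x + c)%R : mR)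
  (isMeasurableFun.Build _ _ _ _ _ ms).
rewrite -[LHS]/(pushforward (@lebesgue_measure R) fm A).
apply/esym/lebesgue_measure_unique => //= _ [[a b]] _ <-.
rewrite /pushforward.
have -> : fm @^-1` `]a, b] = `](a - c)%R, (b - c)%R]%classic.
  by apply/seteqP; split=> x /=; rewrite !in_itv/= ltrBlDr lerBrDr.
rewrite !lebesgue_measure_itv/= !lte_fin ltrD2r; case: ifP => // _.
by rewrite -!EFinB; congr (_%:E); ring.
Qed.

Lemma integral_shift (c : R) (f : mR -> \bar R) : measurable_fun setT f ->
  (forall x, 0 <= f x) ->
  \int[lebesgue_measure]_x f (x + c)%R = \int[lebesgue_measure]_x f x.
Proof.
move=> mf f0; have ms := measurable_shift c.
transitivity (\int[pushforward (@lebesgue_measure R) (fun x : mR => (x + c)%R : mR)]_x f x).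
  by rewrite (ge0_integral_pushforward ms)//= preimage_setT.
by apply: eq_measure_integral => //= A mA _; exact: lebesgue_measure_shift.
Qed.

End Translation.

Section Leb.
Variable R : realType.
Local Notation mR := (measurableTypeR R).
Local Open Scope ereal_scope.

Lemma tnth_tuple_consS n (x : mR) (t : n.-tuple mR) i :
  tnth (tuple_cons (x, t)) (lift ord0 i) = tnth t i.
Proof. by rewrite /tuple_cons/= tnthS. Qed.

Section Step.
Variables (n : nat) (f : n.+1.-tuple mR -> \bar R).
Hypotheses (mf : measurable_fun setT f) (f0 : forall t, 0 <= f t).

Let mfc : measurable_fun setT (f \o @tuple_cons R n).
Proof. exact: measurableT_comp mf (@measurable_tuple_cons R n). Qed.

Lemma integral_lebS : \int[leb R n.+1]_t f t =
  \int[leb R n]_t \int[lebesgue_measure]_x f (tuple_cons (x, t)).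
Proof.
rewrite [LHS](ge0_integral_pushforward (@measurable_tuple_cons R n))//.
by rewrite preimage_setT fubini_tonelli2//= => z; exact: f0.
Qed.

End Step.

Definition cube n (z : 'rV[R]_n) (e : R) : set (n.-tuple mR) :=
  [set t | forall i, `[z ord0 i, (z ord0 i + e)%R]%classic (tnth t i)].

Lemma measurable_cube n (z : 'rV[R]_n) (e : R) : measurable (cube z e).
Proof.
rewrite (_ : cube z e = \big[setI/setT]_(i < n)
    ((@tnth n mR ^~ i) @^-1` `[z ord0 i, (z ord0 i + e)%R]%classic)).
  apply: bigsetI_measurable => i _; rewrite -[X in measurable X]setTI.
  by apply: measurable_tnth => //; exact: measurable_itv.
rewrite -bigcap_seq; apply/seteqP; split=> t /=.
  by move=> h i _; exact: h.
by move=> h i; apply: h => /=; rewrite mem_index_enum.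
Qed.

Lemma leb_cube n (z : 'rV[R]_n) (e : R) : (0 < e)%R ->
  leb R n (cube z e) = (e ^+ n)%:E.
Proof.
move=> e0; have -> : (e ^+ n)%:E = \prod_(i < n) e%:E.
  by rewrite prodEFin prodr_const card_ord.
transitivity (\prod_(i < n)
    lebesgue_measure (`[z ord0 i, (z ord0 i + e)%R]%classic : set mR)).
  by apply: (@leb_box R n (fun i => `[z ord0 i, (z ord0 i + e)%R]%classic)) => i; exact: measurable_itv.
apply: eq_bigr => i _; rewrite lebesgue_measure_itv/= lte_fin ltrDl e0.
by rewrite -EFinB addrAC subrr add0r.
Qed.

Definition tshift n (c : 'I_n -> R) (t : n.-tuple mR) : n.-tuple mR :=
  [tuple (tnth t i + c i)%R | i < n].

Lemma measurable_tshift n (c : 'I_n -> R) : measurable_fun setT (tshift c).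
Proof.
apply/measurable_fun_tnthP => i.
rewrite (_ : _ \o _ = (fun t : n.-tuple mR => (tnth t i + c i)%R)); last first.
  by apply/funext => t /=; rewrite tnth_mktuple.
by apply: measurable_funD => //; exact: measurable_tnth.
Qed.

Lemma integral_tshift n (c : 'I_n -> R) (f : n.-tuple mR -> \bar R) :
  measurable_fun setT f -> (forall t, 0 <= f t) ->
  \int[leb R n]_t f (tshift c t) = \int[leb R n]_t f t.
Proof.
elim: n c f => [|n IH] c f mf f0.
  by apply: eq_integral => t _; congr f; rewrite tuple0 [RHS]tuple0.
rewrite integral_lebS//; last exact: measurableT_comp mf (measurable_tshift c).
rewrite [RHS]integral_lebS//.
pose c' i := c (lift ord0 i).
have mfc : measurable_fun setT (f \o @tuple_cons R n).
  exact: measurableT_comp mf (@measurable_tuple_cons R n).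
have cE x t : tshift c (tuple_cons (x, t)) =
    tuple_cons ((x + c ord0)%R, tshift c' t).
  apply: eq_from_tnth => i; rewrite tnth_mktuple.
  by case: (unliftP ord0 i) => [j|] ->; rewrite ?tnth_tuple_consS ?tnth_mktuple.
transitivity (\int[leb R n]_t \int[lebesgue_measure]_x f (tuple_cons (x, tshift c' t))).
  apply: eq_integral => t _; under eq_integral do rewrite cE.
  rewrite (integral_shift _ (f := fun x => f (tuple_cons (x, tshift c' t))))//.
  by apply: (measurableT_comp mfc); apply: measurable_fun_pair.
rewrite (IH c' (fun t => \int[lebesgue_measure]_x f (tuple_cons (x, t))))//.
  by apply: (measurable_fun_fubini_tonelli_G (m1 := lebesgue_measure) _ mfc) => z; exact: f0.
by move=> t; apply: integral_ge0.
Qed.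

End Leb.

Section Row.
Context {R : realType} {n : nat}.
Local Notation mR := (measurableTypeR R).

(** The identification of tuples with row vectors used by [Lp_norm]. *)
Definition rowt (t : n.-tuple mR) : 'rV[R]_n := \row_i tnth t i.

Lemma measurable_rowt (F : 'rV[R]_n -> R) : continuous F ->
  measurable_fun setT (F \o rowt).
Proof.
apply: measurable_continuous_coords => i.
under eq_fun do rewrite mxE; exact: measurable_tnth.
Qed.

Lemma rowt_tshift (x : 'rV[R]_n) (t : n.-tuple mR) :
  rowt (tshift (x ord0) t) = rowt t + x.
Proof. by apply/rowP => i; rewrite !mxE tnth_mktuple. Qed.

Lemma integral_row_shift (c : 'rV[R]_n) (F : 'rV[R]_n -> \bar R) :
  measurable_fun setT (F \o rowt) -> (forall x, (0 <= F x)%E) ->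
  (\int[leb R n]_t F (rowt t + c)%R = \int[leb R n]_t F (rowt t))%E.
Proof.
move=> mF F0.
transitivity (\int[leb R n]_t (F \o rowt) (tshift (c ord0) t))%E.
  by apply: eq_integral => t _; rewrite /= rowt_tshift.
by apply: integral_tshift => // t; exact: F0.
Qed.

End Row.

(** * Iterated partial derivatives *)

Section Lines.
Context {R : realType} {V : normedModType R}.
Implicit Types (f : V -> R) (x v : V).

Lemma is_derive_line f x v (s : R) : derivable f (x + s *: v) v ->
  is_derive s (1 : R) (fun r : R => f (x + r *: v)) ('D_v f (x + s *: v)).
Proof.
move=> df.
have E : (fun h : R => h^-1 *: ((fun r => f (x + r *: v)) (h *: (1:R) + s) - f (x + s *: v))) =
         (fun h : R => h^-1 *: (f (h *: v + (x + s *: v)) - f (x + s *: v))).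
  apply/funext => h; congr (_ *: (f _ - _)).
  by rewrite [h *: _]mulr1 scalerDl addrCA.
by apply: DeriveDef; rewrite /derivable /derive E.
Qed.

Lemma MVT_line f x v (h : R) : 0 < h -> (forall y, derivable f y v) ->
  exists2 s, 0 < s < h & f (x + h *: v) - f x = h * 'D_v f (x + s *: v).
Proof.
move=> h0 df; pose g (r : R) := f (x + r *: v).
have dg (r : R) : is_derive r (1:R) g ('D_v f (x + r *: v)) by exact: is_derive_line.
have [|c /[!in_itv]/= ch] := @MVT R g _ 0 h h0 (fun r _ => dg r).
  apply: derivable_within_continuous => r _.
  by have [] := dg r.
by rewrite /g scale0r addr0 subr0 => ->; exists c => //; rewrite mulrC.
Qed.

End Lines.

Section Schwarz.
Context {R : realType} {V : normedModType R}.
Implicit Types (f : V -> R) (x v w : V).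

Lemma second_difference f x v w (h : R) : 0 < h ->
  (forall y, derivable f y v) -> (forall y, derivable ('D_v f) y w) ->
  exists st : R * R, [/\ 0 < st.1 < h, 0 < st.2 < h &
    f (x + h *: v + h *: w) - f (x + h *: v) - (f (x + h *: w) - f x) =
    h ^+ 2 * 'D_w ('D_v f) (x + st.1 *: v + st.2 *: w)].
Proof.
move=> h0 dv dw.
pose g y := f (y + h *: w) - f y.
have dgv y : is_derive y v g ('D_v f (y + h *: w) - 'D_v f y).
  have tr : is_derive y v (fun y => f (y + h *: w)) ('D_v f (y + h *: w)).
    have E : (fun t : R => t^-1 *: (f (t *: v + y + h *: w) - f (y + h *: w))) =
             (fun t : R => t^-1 *: (f (t *: v + (y + h *: w)) - f (y + h *: w))).
      by apply/funext => t; rewrite addrA.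
    by apply: DeriveDef; rewrite /derivable /derive E//; exact: dv.
  exact: (is_deriveB tr (DeriveDef (dv y) erefl)).
have [|s sh gE] := @MVT_line R V g x v h h0.
  by move=> y; have [] := dgv y.
have [t th tE] := @MVT_line R V ('D_v f) (x + s *: v) w h h0 dw.
exists (s, t); split=> //=.
rewrite -[LHS]/(g (x + h *: v) - g x) gE.
by have [_ ->] := dgv (x + s *: v); rewrite tE mulrA -expr2.
Qed.

Lemma eq_of_close_values (P Q : V -> R) x :
  {for x, continuous P} -> {for x, continuous Q} ->
  (forall d : R, 0 < d -> exists y z, [/\ ball x d y, ball x d z & P y = Q z]) ->
  P x = Q x.
Proof.
move=> cP cQ close; apply/eqP; rewrite -subr_eq0 -normr_le0.
apply/ler_addgt0Pr => e e0; rewrite add0r.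
have e2 : 0 < e / 2 by rewrite divr_gt0.
have /cvgrPdist_lt/(_ _ e2)/nbhs_ballP[d1 /= d10 H1] := cP.
have /cvgrPdist_lt/(_ _ e2)/nbhs_ballP[d2 /= d20 H2] := cQ.
have [|y [z [xy xz yz]]] := close (Num.min d1 d2); first by rewrite lt_min d10.
have {}xy : ball x d1 y by move: xy; apply: le_ball; rewrite ge_min lexx.
have {}xz : ball x d2 z by move: xz; apply: le_ball; rewrite ge_min lexx orbT.
move: (H1 _ xy) (H2 _ xz); rewrite yz; clear.
rewrite !ltr_norml => /andP[? ?] /andP[? ?].
by rewrite ler_norml; apply/andP; split; lra.
Qed.

(** Both mixed derivatives are limits of the same second difference. *)
Lemma derive_comm f x v w :
  (forall y, derivable f y v) -> (forall y, derivable f y w) ->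
  (forall y, derivable ('D_v f) y w) -> (forall y, derivable ('D_w f) y v) ->
  {for x, continuous ('D_w ('D_v f))} -> {for x, continuous ('D_v ('D_w f))} ->
  'D_w ('D_v f) x = 'D_v ('D_w f) x.
Proof.
move=> dv dw dvw dwv cvw cwv; apply: (eq_of_close_values cvw cwv) => d d0.
pose m := `|v| + `|w| + 1.
have m0 : 0 < m by rewrite ltr_wpDl// addr_ge0.
pose h := d / m.
have h0 : 0 < h by rewrite divr_gt0.
have close (a b : R) : 0 < a < h -> 0 < b < h ->
    forall v' w', `|v'| + `|w'| = `|v| + `|w| -> ball x d (x + a *: v' + b *: w').
  move=> /andP[a0 ah] /andP[b0 bh] v' w' vw.
  rewrite -ball_normE/= -addrA opprD addNKr normrN.
  rewrite (le_lt_trans (ler_normD _ _))// !normrZ !gtr0_norm//.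
  apply: (@le_lt_trans _ _ (h * (`|v'| + `|w'|))).
    by rewrite mulrDr lerD// ler_wpM2r// ltW.
  by rewrite vw /h mulrAC ltr_pdivrMr// ltr_pM2l// ltrDl.
have [st [sh th E1]] := second_difference x h0 dv dvw.
have [st' [sh' th' E2]] := second_difference x h0 dw dwv.
move: E1 E2; move: ('D_w ('D_v f)) ('D_v ('D_w f)) => P Q E1 E2.
exists (x + st.1 *: v + st.2 *: w), (x + st'.1 *: w + st'.2 *: v); split.
- exact: close.
- by apply: close => //; exact: addrC.
- apply: (@mulfI _ (h ^+ 2)); first by rewrite expf_neq0// gt_eqF.
  rewrite -[LHS]E1 -[RHS]E2 (addrAC x (h *: v)); clear.
  by move: (f _) (f _) (f _) (f x) => a b c k; ring.
Qed.

End Schwarz.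

Section Rpartial.
Context {R : realType} {n : nat}.
Implicit Types (u v : 'rV[R]_n -> R) (s t : seq 'I_n) (i : 'I_n).
Local Notation e i := (delta_mx ord0 i : 'rV[R]_n).

Lemma rsmooth_continuous s u : rsmooth u -> continuous (rpartial s u).
Proof. by move=> /(_ s)[]. Qed.

Lemma rsmooth_derivable s u i x : rsmooth u -> derivable (rpartial s u) x (e i).
Proof. by move=> /(_ s)[_]; exact. Qed.

Lemma rpartial_move s t i u : rsmooth u ->
  rpartial (s ++ i :: t) u = rpartial (i :: s ++ t) u.
Proof.
move=> su; elim: s => [//|j s IH].
rewrite [LHS]/= -/(rpartial _ u) IH /=; apply/funext => x.
set w := rpartial _ _.
have dw k y : derivable w y (e k) by exact: rsmooth_derivable.
have sw k : rpartial (k :: s ++ t) u = 'D_(e k) w by [].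
apply: derive_comm => //.
- by move=> y; rewrite -sw; exact: rsmooth_derivable.
- by move=> y; rewrite -sw; exact: rsmooth_derivable.
- exact: (@rsmooth_continuous [:: j, i & s ++ t]).
- exact: (@rsmooth_continuous [:: i, j & s ++ t]).
Qed.

(** Lists of directions are convenient for inductions; the norms only involve
    the derivatives along the sorted ones. *)
Lemma rpartial_perm s t u : rsmooth u -> perm_eq s t ->
  rpartial s u = rpartial t u.
Proof.
move=> su; elim: s t => [|i s IH] t pst.
  by move: pst; rewrite perm_sym => /perm_nilP ->.
have it : i \in t by rewrite -(perm_mem pst) mem_head.
case/splitPr: it pst => t1 t2; rewrite perm_sym -cat1s perm_catCA/= perm_cons.
by rewrite perm_sym => /IH E; rewrite rpartial_move//= -/(rpartial _ u) E.
Qed.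

Lemma derive_shift v (c : 'rV[R]_n) (x : 'rV[R]_n) (a : R) (w : 'rV[R]_n) :
  derivable v (x + c) w ->
  is_derive x w (fun y => a * v (y + c)) (a * 'D_w v (x + c)).
Proof.
move=> dv; have d1 : is_derive x w (fun y => v (y + c)) ('D_w v (x + c)).
  have E : (fun h : R => h^-1 *: (v (h *: w + x + c) - v (x + c))) =
           (fun h : R => h^-1 *: (v (h *: w + (x + c)) - v (x + c))).
    by apply/funext => h; rewrite addrA.
  by apply: DeriveDef; rewrite /derivable /derive E.
exact: (is_deriveZ a d1).
Qed.

Lemma rpartial_shift s u (c : 'rV[R]_n) (a : R) : rsmooth u ->
  rpartial s (fun y => a * u (y + c)) = fun y => a * rpartial s u (y + c).
Proof.
move=> su; elim: s => [//|i s IH]; apply/funext => x.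
rewrite [LHS]/= -/(rpartial _ _) IH.
by have [_ ->] := derive_shift a (@rsmooth_derivable s u i (x + c) su).
Qed.

Lemma continuous_shift v (c : 'rV[R]_n) (a : R) : continuous v ->
  continuous (fun y : 'rV[R]_n => a * v (y + c)).
Proof.
move=> cv x.
have cs : {for x, continuous (fun y : 'rV[R]_n => y + c)}.
  exact: (continuousD (@cvg_id _ _) (@cst_continuous _ _ c x)).
have cvs : {for x, continuous (fun y : 'rV[R]_n => v (y + c))}.
  exact: (continuous_comp cs (cv _)).
exact: (continuousM (@cst_continuous _ _ a x) cvs).
Qed.

Lemma rsmooth_shift u (c : 'rV[R]_n) (a : R) : rsmooth u ->
  rsmooth (fun y : 'rV[R]_n => a * u (y + c)).
Proof.
move=> su s; rewrite rpartial_shift//; split.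
  exact/continuous_shift/rsmooth_continuous.
by move=> i x; have [] := derive_shift a (@rsmooth_derivable s u i (x + c) su).
Qed.

(** Leibniz's formula: the derivatives are distributed among the two factors in
    all possible ways. *)
Fixpoint splits s : seq (seq 'I_n * seq 'I_n) :=
  if s is i :: s' then
    [seq (i :: p.1, p.2) | p <- splits s'] ++ [seq (p.1, i :: p.2) | p <- splits s']
  else [:: ([::], [::])].

Lemma size_splits s : size (splits s) = (2 ^ size s)%N.
Proof.
by elim: s => [//|i s IH]; rewrite /= size_cat !size_map IH expnS mul2n addnn.
Qed.

Lemma size_splitsP s p : p \in splits s -> (size p.1 + size p.2 = size s)%N.
Proof.
elim: s p => [|i s IH] p; first by rewrite inE => /eqP ->.
rewrite /= mem_cat => /orP[] /mapP[q /IH <- ->] /=; by rewrite ?addSn ?addnS.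
Qed.

Lemma is_derive_sum_seq (l : seq (seq 'I_n * seq 'I_n))
    (F : seq 'I_n * seq 'I_n -> 'rV[R]_n -> R) dF x (w : 'rV[R]_n) :
  (forall p, is_derive x w (F p) (dF p)) ->
  is_derive x w (fun y => \sum_(p <- l) F p y) (\sum_(p <- l) dF p).
Proof.
move=> dFP; elim: l => [|p l IH].
  rewrite big_nil (_ : (fun _ => _) = cst 0).
    exact: is_derive_cst.
  by apply/funext => y; rewrite big_nil.
rewrite big_cons (_ : (fun _ => _) = F p + (fun y => \sum_(p <- l) F p y)).
  exact: is_deriveD.
by apply/funext => y; rewrite big_cons.
Qed.

Lemma derive_rpartialM p i u v x : rsmooth u -> rsmooth v ->
  is_derive x (e i) (fun y => rpartial p.1 u y * rpartial p.2 v y)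
    (rpartial (i :: p.1) u x * rpartial p.2 v x +
     rpartial p.1 u x * rpartial (i :: p.2) v x).
Proof.
move=> su sv.
have := is_deriveM (DeriveDef (@rsmooth_derivable p.1 u i x su) erefl)
          (DeriveDef (@rsmooth_derivable p.2 v i x sv) erefl).
by rewrite addrC [X in X + _]mulrC.
Qed.

Lemma rpartialM s u v : rsmooth u -> rsmooth v ->
  rpartial s (fun y => u y * v y) =
  fun x => \sum_(p <- splits s) rpartial p.1 u x * rpartial p.2 v x.
Proof.
move=> su sv; elim: s => [|i s IH]; apply/funext => x.
  by rewrite big_seq1.
rewrite [LHS]/= -/(rpartial _ _) IH.
have [_ ->] := is_derive_sum_seq (splits s)
  (fun p => derive_rpartialM p i x su sv).
by rewrite big_split /= big_cat !big_map.
Qed.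

Lemma rsmoothM u v : rsmooth u -> rsmooth v -> rsmooth (fun y => u y * v y).
Proof.
move=> su sv s; rewrite rpartialM//; split; last first.
  move=> i x.
  by have [] := is_derive_sum_seq (splits s)
    (fun p => derive_rpartialM p i x su sv).
elim: (splits s) => [|p l IH].
  under eq_fun do rewrite big_nil.
  exact: (@cst_continuous _ _ (0 : R)).
under eq_fun do rewrite big_cons.
move=> x.
exact: (continuousD (continuousM (@rsmooth_continuous p.1 u su x)
  (@rsmooth_continuous p.2 v sv x)) (IH x)).
Qed.

End Rpartial.

(** * Superpositions of smooth functions *)

Lemma continuous_seq (R : realType) (V : normedModType R) (F : V -> R) (x : V) :
  (forall u : nat -> V, (forall k, ball x 1 (u k)) -> u k @[k --> \oo] --> x ->
     F (u k) @[k --> \oo] --> F x) -> {for x, continuous F}.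
Proof.
move=> cF; apply/cvgrPdist_lt => /= e e0; apply: contrapT => nF.
have /choice[u uP] (k : nat) : exists y, ball x k.+1%:R^-1 y /\ e <= `|F x - F y|.
  apply: contrapT => /forallNP nk; apply: nF; apply/nbhs_ballP.
  exists k.+1%:R^-1 => /=; first by rewrite invr_gt0.
  by move=> y xy; rewrite ltNge; apply/negP => ey; exact: (nk y).
have ub k : ball x 1 (u k).
  have [+ _] := uP k; apply: le_ball; rewrite invf_le1//.
  by rewrite ler1n.
have ux : u k @[k --> \oo] --> x.
  apply/cvgrPdist_lt => d d0; near=> k.
  have [+ _] := uP k; rewrite -ball_normE/= => /lt_trans; apply.
  by near: k; exact: near_infty_natSinv_lt (PosNum d0).
have /cvgrPdist_lt/(_ _ e0)[N _ /(_ N (leqnn N))] := cF u ub ux.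
by have [_ /le_lt_trans h] := uP N => /h; rewrite ltxx.
Unshelve. all: end_near. Qed.

Section Superposition.
Context {R : realType} d {T : measurableType d}.
Variables (mu : {measure set T -> \bar R}) (D : set T) (n : nat).
Variable U : T -> 'rV[R]_n -> R.
Hypotheses (mD : measurable D) (finD : (mu D < +oo)%E).
Hypothesis sU : forall t, D t -> rsmooth (U t).
Hypothesis mU : forall s x, measurable_fun D (fun t => rpartial s (U t) x).
Hypothesis bU : forall s (x : 'rV[R]_n), exists C : R,
  forall t (y : 'rV[R]_n), D t -> ball x 1 y ->
  `|rpartial s (U t) y| <= C.
Local Notation e i := (delta_mx ord0 i : 'rV[R]_n).

Let I s x := (\int[mu]_(t in D) rpartial s (U t) x)%R.

Lemma integrable_superposition s x :
  mu.-integrable D (EFin \o (fun t => rpartial s (U t) x)).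
Proof.
apply: measurable_bounded_integrable => //.
have [C HC] := bU s x; exists C; split; first exact: num_real.
by move=> M CM t Dt /=; rewrite (le_trans (HC t x Dt (ballxx _ _)))// ltW.
Qed.

Let integrable_bound (C : R) : mu.-integrable D (EFin \o cst C).
Proof.
apply: measurable_bounded_integrable => //.
by exists `|C|; split; [exact: num_real|move=> M CM t Dt /=; rewrite ltW].
Qed.

Let continuous_I s : continuous (I s).
Proof.
move=> x; apply: continuous_seq => u ub ux.
have [C HC] := bU s x.
apply: fine_cvg; rewrite fineK; last first.
  exact: integrable_fin_num (integrable_superposition s x).
apply: (dominated_cvg mD (f_ := fun k t => (rpartial s (U t) (u k))%:E)
  (f := fun t => (rpartial s (U t) x)%:E) (g := EFin \o cst C)) => //.
- by move=> k; apply/measurable_EFinP; exact: mU.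
- move=> t Dt; apply: cvg_EFin; first exact: nearW.
  have := @rsmooth_continuous _ _ s _ (sU Dt) x.
  by move=> /(continuous_cvg _)/(_ ux).
- by move=> k t Dt; rewrite lee_fin; exact: HC.
Qed.

Lemma norm_delta_le i : `|e i| <= 1.
Proof.
rewrite -[`|_|]/(mx_norm _) mx_normrE; apply/bigmax_leP; split=> // -[j k] _ /=.
by rewrite mxE; case: (_ && _); rewrite ?normr1 ?normr0.
Qed.

Let is_derive_I s i x : is_derive x (e i) (I s) (I (i :: s) x).
Proof.
have [C HC] := bU (i :: s) x.
pose f (r : R) t := rpartial s (U t) (x + r *: e i).
have df r t : D t -> is_derive r (1:R) (f ^~ t) ('D_(e i) (rpartial s (U t)) (x + r *: e i)).
  by move=> Dt; apply: is_derive_line; exact: rsmooth_derivable (sU Dt).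
have inb (r : R) : `]-1, 1[%classic r -> ball x 1 (x + r *: e i).
  rewrite /= in_itv/= -ltr_norml => r1.
  rewrite -ball_normE/= opprD addNKr normrN normrZ.
  by rewrite (le_lt_trans _ r1)// ler_piMr// norm_delta_le.
have d1 r t : D t -> partial1of2 f r t = rpartial (i :: s) (U t) (x + r *: e i).
  by move=> Dt; rewrite /partial1of2 derive1E; have [_ ->] := df r t Dt.
have I0 : `]-1, 1[%classic (0:R) by rewrite /= in_itv/= ltrN10 ltr01.
have C0 : 0 <= `|C| by [].
have h := @cvg_differentiation_under_integral R _ T mu f D mD 0 (-1) 1 I0
  (fun r _ => integrable_superposition s _)
  (fun r t _ Dt => @ex_derive _ _ _ _ _ _ _ (df r t Dt)) (cst `|C|) (fun=> C0)
  (integrable_bound _).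
have bd r t : `]-1, 1[%classic r -> D t -> `|partial1of2 f r t| <= cst `|C| t.
  by move=> r1 Dt; rewrite d1// (le_trans (HC _ _ Dt (inb _ r1)))// ler_norm.
have {}h := h bd.
have E0 : \int[mu]_(t in D) partial1of2 f 0 t = I (i :: s) x.
  apply: eq_Rintegral => t /set_mem Dt.
  by rewrite d1// scale0r addr0.
have E1 : (fun h : R => h^-1 *: (\int[mu]_(t in D) f (h + 0) t - \int[mu]_(t in D) f 0 t)) =
          (fun h : R => h^-1 *: (I s (h *: e i + x) - I s x)).
  apply/funext => r; congr (_ *: (_ - _)); apply: eq_Rintegral => t _; rewrite /f.
    by rewrite addr0 addrC.
  by rewrite scale0r addr0.
rewrite E0 E1 in h; apply: DeriveDef.
  by apply/cvg_ex; exists (I (i :: s) x).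
exact/cvg_lim.
Qed.

Lemma rpartial_superposition s :
  rpartial s (fun x => \int[mu]_(t in D) U t x) =
  fun x => \int[mu]_(t in D) rpartial s (U t) x.
Proof.
elim: s => [//|i s IH]; rewrite [LHS]/= -/(rpartial _ _) IH.
by apply/funext => x; have [_ ->] := is_derive_I s i x.
Qed.

(** The local bounds on all derivatives allow differentiation under the integral
    sign, and give the continuity of the result by dominated convergence. *)
Lemma rsmooth_superposition : rsmooth (fun x => \int[mu]_(t in D) U t x).
Proof.
move=> s; rewrite rpartial_superposition; split; first exact: continuous_I.
by move=> i x; have [] := is_derive_I s i x.
Qed.

End Superposition.

(** * Weighted derivatives *)

Section Coord_measurable.
Context {R : realType} {n : nat}.

(** Measurability on R^n, tested on vectors depending on a parameter, so that it
    passes at once to [rowt] and to translations in product spaces. *)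
Definition coord_measurable (v : 'rV[R]_n -> R) : Prop :=
  forall d (T : measurableType d) (g : T -> 'rV[R]_n),
    (forall i, measurable_fun setT (fun t => g t ord0 i)) ->
    measurable_fun setT (v \o g).

Lemma coord_measurable_continuous v : continuous v -> coord_measurable v.
Proof. by move=> cv d T g mg; exact: measurable_continuous_coords. Qed.

Lemma coord_measurableM v w : coord_measurable v -> coord_measurable w ->
  coord_measurable (fun x => v x * w x).
Proof.
move=> mv mw d T g mg; apply: measurable_funM; [exact: mv|exact: mw].
Qed.

Lemma coord_measurable_growth (a : nat -> R) (l : R) : weight_seq a -> 0 < l ->
  coord_measurable (fun x => growth a (`|x| / l)).
Proof.
move=> wa l0 d T g mg.
have mN : measurable_fun setT (fun t => `|g t|).
  exact: (coord_measurable_continuous (@norm_continuous _ _) mg).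
pose G (r : R) := growth a (Num.max 0 (r / l)).
have mG : measurable_fun setT G.
  apply: nondecreasing_measurable => // r s rs.
  apply: growth_homo => //; first by rewrite le_max lexx.
  by rewrite ge_max le_max lexx/= le_max ler_pM2r ?invr_gt0// rs orbT.
rewrite (_ : _ \o g = G \o (fun t => `|g t|)); first exact: measurableT_comp.
apply/funext => t /=; rewrite /G max_r// divr_ge0// ltW//.
Qed.

Lemma measurable_rowt_coord (i : 'I_n) :
  measurable_fun setT (fun t => @rowt R n t ord0 i).
Proof. under eq_fun do rewrite mxE; exact: measurable_tnth. Qed.

Lemma coord_measurable_rowt v : coord_measurable v ->
  measurable_fun setT (v \o @rowt R n).
Proof. by apply; exact: measurable_rowt_coord. Qed.

End Coord_measurable.

Section Superposition_norm.
Context {R : realType} {n : nat} d {T : measurableType d}.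
Variable nu : {finite_measure set T -> \bar R}.
Local Open Scope ereal_scope.

(** Jensen, Tonelli and the translation invariance of the Lebesgue measure. *)
Lemma superposition_powR (m r : R) (phi : T -> 'rV[R]_n) (v : 'rV[R]_n -> R) :
  (1 <= r)%R -> nu setT <= m%:E ->
  (forall i, measurable_fun setT (fun t => phi t ord0 i)) ->
  coord_measurable v -> (forall x, 0 <= v x)%R ->
  \int[leb R n]_t (\int[nu]_z (v (rowt t + phi z)%R)%:E) `^ r <=
  ((m + 1) `^ r * m)%:E * \int[leb R n]_t (v (rowt t) `^ r)%:E.
Proof.
move=> r1 num mphi mv v0.
have m0 : (0 <= m)%R by rewrite -lee_fin (le_trans _ num).
have r0 : (0 < r)%R by rewrite (lt_le_trans _ r1).
pose f (tz : n.-tuple (measurableTypeR R) * T) := (v (rowt tz.1 + phi tz.2)%R)%R.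
have mf : measurable_fun setT f.
  apply: (mv _ _ (fun tz => (rowt tz.1 + phi tz.2)%R)) => i.
  under eq_fun do rewrite mxE.
  apply: measurable_funD.
    exact: measurableT_comp (measurable_rowt_coord i) measurable_fst.
  exact: measurableT_comp (mphi i) measurable_snd.
have mfr : measurable_fun setT (fun tz => f tz `^ r)%R.
  exact: (measurableT_comp (measurable_powR r)).
have mft t : measurable_fun setT (fun z => f (t, z)).
  by apply: (measurableT_comp mf); exact: measurable_fun_pair.
have mvr : measurable_fun setT (fun t => (v (rowt t)) `^ r)%R.
  exact: (measurableT_comp (measurable_powR r)) (coord_measurable_rowt mv).
have J0 : 0 <= \int[leb R n]_t (v (rowt t) `^ r)%:E.
  by apply: integral_ge0 => t _; rewrite lee_fin powR_ge0.
pose F t := \int[nu]_z (f (t, z) `^ r)%:E.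
have mF : measurable_fun setT F.
  apply: (measurable_fun_fubini_tonelli_F (m2 := nu) (fun tz => (f tz `^ r)%:E)).
    exact/measurable_EFinP.
  by move=> z; rewrite lee_fin powR_ge0.
have mF1 : measurable_fun setT (fun t => \int[nu]_z (f (t, z))%:E).
  apply: (measurable_fun_fubini_tonelli_F (m2 := nu) (fun tz => (f tz)%:E)).
    exact/measurable_EFinP.
  by move=> z; rewrite lee_fin v0.
apply: (@le_trans _ _ (\int[leb R n]_t (((m + 1) `^ r)%:E * F t))).
  apply: ge0_le_integral => //.
  - by move=> t _; exact: poweR_ge0.
  - exact: (measurableT_comp (measurable_poweR r)).
  - exact: measurable_funeM.
  - move=> t _; exact: (integral_powR_le r1 num (mft t) (fun z => v0 _)).
rewrite ge0_integralZl//; last 2 first.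
- by move=> t _; apply: integral_ge0 => z _; rewrite lee_fin powR_ge0.
- by rewrite lee_fin powR_ge0.
rewrite EFinM -muleA lee_wpmul2l ?lee_fin ?powR_ge0//.
rewrite (fubini_tonelli (m1 := leb R n) (m2 := nu) (fun tz => (f tz `^ r)%:E)); last 2 first.
- exact/measurable_EFinP.
- by move=> z; rewrite lee_fin powR_ge0.
rewrite (eq_integral (fun=> \int[leb R n]_t (v (rowt t) `^ r)%:E)); last first.
  move=> z _; apply: (integral_row_shift (phi z) (F := fun x => (v x `^ r)%:E)).
    exact/measurable_EFinP.
  by move=> x; rewrite lee_fin powR_ge0.
rewrite integral_cst// muleC.
by rewrite lee_wpmul2r.
Qed.

Lemma integral_mrestr (mu : {measure set T -> \bar R}) (D : set T)
    (mD : measurable D) (f : T -> \bar R) :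
  measurable_fun setT f -> (forall x, 0 <= f x) ->
  \int[mrestr mu mD]_x f x = \int[mu]_(x in D) f x.
Proof.
move=> mf f0.
transitivity (\int[mrestr mu mD]_(x in setT `\` ~` D) f x).
  apply: ge0_negligible_integral => //; first exact: measurableC.
  by rewrite -[LHS]/(mu (~` D `&` D)) setICl measure0.
rewrite setTD setCK; apply: eq_measure_integral => A mA AD /=.
by rewrite /mrestr setIidl.
Qed.

End Superposition_norm.

Section Weighted_derivatives.
Context {R : realType} {n : nat}.
Context {M A : nat -> R}.
Hypotheses (wM : weight_seq M) (wA : weight_seq A).
Implicit Types (u : 'rV[R]_n.+1 -> R) (s : seq 'I_n.+1) (l : R).

(** Up to a constant, the membership of [u] in the step of parameter [l]
    bounds all these functions in [L^p]. *)
Definition wder l u s (x : 'rV[R]_n.+1) : R :=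
  `|rpartial s u x| * growth A (`|x| / l) / (l ^+ size s * M (size s)).

Let Mpos q : 0 < M q. Proof. by have [] := wM. Qed.

Lemma growth_norm_gt0 l (x : 'rV[R]_n.+1) : 0 < l -> 0 < growth A (`|x| / l).
Proof. by move=> l0; rewrite growth_gt0// divr_ge0// ltW. Qed.

Lemma wder_den_gt0 l s : 0 < l -> 0 < l ^+ size s * M (size s).
Proof. by move=> l0; rewrite mulr_gt0 ?exprn_gt0. Qed.

Lemma wder_ge0 l u s x : 0 < l -> 0 <= wder l u s x.
Proof.
move=> l0; rewrite /wder divr_ge0 ?(ltW (wder_den_gt0 s l0))//.
by rewrite mulr_ge0 ?(ltW (growth_norm_gt0 x l0)).
Qed.

Lemma coord_measurable_wder l u s : 0 < l -> rsmooth u ->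
  coord_measurable (wder l u s).
Proof.
move=> l0 su d T g mg.
apply: (@measurable_funM _ _ _ _ (fun t => `|rpartial s u (g t)| * growth A (`|g t| / l)) (cst _)) => //.
apply: measurable_funM.
  apply: measurableT_comp => //.
  exact: (coord_measurable_continuous (@rsmooth_continuous _ _ s u su)).
exact: (coord_measurable_growth wA l0).
Qed.

Lemma continuous_bounded (v : 'rV[R]_n.+1 -> R) (rho : R) : continuous v ->
  exists C : R, forall y, `|y| <= rho -> `|v y| <= C.
Proof.
move=> cv; pose B := closed_ball_ (fun x : 'rV[R]_n.+1 => `|x|) 0 rho.
have cB : compact B.
  apply: bounded_closed_compact; last exact: closed_closed_ball_.
  exists rho; split; first exact: num_real.
  by move=> k rk y; rewrite /B/closed_ball_/= sub0r normrN => /le_trans; apply; exact: ltW.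
have /compact_bounded[C [_ HC]] : compact (v @` B).
  by apply: continuous_compact => //; apply: continuous_subspaceT.
exists (C + 1) => y yr; apply: (HC (C + 1)); first by rewrite ltrDl.
by exists y => //; rewrite /B/closed_ball_/= sub0r normrN.
Qed.

Section Translates.
Context d {T : measurableType d}.
Variables (mu : {measure set T -> \bar R}) (D : set T) (m : R).
Hypotheses (mD : measurable D) (muD : (mu D <= m%:E)%E).
Variables (a : T -> R) (phi : T -> 'rV[R]_n.+1) (u : 'rV[R]_n.+1 -> R).
Hypothesis ma : measurable_fun setT a.
Hypothesis mphi : forall i, measurable_fun setT (fun t => phi t ord0 i).
Hypothesis su : rsmooth u.
Hypothesis bu : forall s (x : 'rV[R]_n.+1), exists C : R,
  forall t (y : 'rV[R]_n.+1), D t -> ball x 1 y ->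
    `|a t * rpartial s u (y + phi t)| <= C.

Let finD : (mu D < +oo)%E. Proof. by rewrite (le_lt_trans muD)// ltry. Qed.

Definition translates (x : 'rV[R]_n.+1) : R :=
  \int[mu]_(t in D) (a t * u (x + phi t)).

Let U t (x : 'rV[R]_n.+1) := a t * u (x + phi t).

Let mphix (x : 'rV[R]_n.+1) i : measurable_fun setT (fun t => (x + phi t) ord0 i).
Proof. by under eq_fun do rewrite mxE; apply: measurable_funD. Qed.

Let sU t : D t -> rsmooth (U t). Proof. by move=> _; exact: rsmooth_shift. Qed.

Let mUT s x : measurable_fun setT (fun t => a t * rpartial s u (x + phi t)).
Proof.
apply: measurable_funM => //.
exact: (coord_measurable_continuous (@rsmooth_continuous _ _ s u su) (mphix x)).
Qed.

Let mU s x : measurable_fun D (fun t => rpartial s (U t) x).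
Proof.
under eq_fun do rewrite rpartial_shift//.
exact: measurable_funTS (mUT s x).
Qed.

Let bU s (x : 'rV[R]_n.+1) : exists C : R, forall t (y : 'rV[R]_n.+1),
  D t -> ball x 1 y -> `|rpartial s (U t) y| <= C.
Proof.
have [C HC] := bu s x; exists C => t y Dt xy; rewrite rpartial_shift//.
exact: HC.
Qed.

Lemma rsmooth_translates : rsmooth translates.
Proof. exact: (rsmooth_superposition mD finD sU mU bU). Qed.

Lemma rpartial_translates s : rpartial s translates =
  fun x => \int[mu]_(t in D) (a t * rpartial s u (x + phi t)).
Proof.
rewrite (rpartial_superposition mD finD sU mU bU); apply/funext => x.
by apply: eq_Rintegral => t _; rewrite rpartial_shift.
Qed.

Lemma integrable_translates s x :
  mu.-integrable D (EFin \o (fun t => a t * rpartial s u (x + phi t))).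
Proof.
have := integrable_superposition mD finD mU bU s x.
by under [X in _ (EFin \o X)]eq_fun do rewrite rpartial_shift//.
Qed.

(** By [growthD], the weight at [x] is bounded by the product of those at
    [x + phi t] and [phi t]; the factors 2 appearing there are paid by halving [l]. *)
Lemma wder_translates l K s x : 0 < l ->
  (forall t, D t -> `|a t| * growth A (2 * (`|phi t| / l)) <= K) ->
  ((wder l translates s x)%:E <=
    K%:E * \int[mu]_(t in D) (wder (l / 2) u s (x + phi t))%:E)%E.
Proof.
move=> l0 aK; have l20 : 0 < l / 2 by rewrite divr_gt0.
have [D0|/set0P[t0 Dt0]] := eqVneq D set0.
  rewrite D0 integral_set0 mule0 /wder rpartial_translates D0 Rintegral_set0.
  by rewrite normr0 !mul0r.
have K0 : 0 <= K.
  by rewrite (le_trans _ (aK _ Dt0))// mulr_ge0// ltW// growth_gt0// mulr_ge0// divr_ge0// ltW.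
have mw : measurable_fun D (fun t => wder (l / 2) u s (x + phi t)).
  apply: measurable_funTS.
  exact: (coord_measurable_wder s l20 su (mphix x)).
pose c := growth A (`|x| / l) / (l ^+ size s * M (size s)).
have c0 : 0 <= c by rewrite divr_ge0 ?(ltW (wder_den_gt0 s l0)) ?(ltW (growth_norm_gt0 x l0)).
rewrite -ge0_integralZl//; try exact/measurable_EFinP;
  try by move=> *; rewrite lee_fin ?wder_ge0.
rewrite /wder -mulrA -/c EFinM rpartial_translates EFin_normr_Rintegral//; last first.
  exact: integrable_translates.
have mUx : measurable_fun D (fun t => a t * rpartial s u (x + phi t)).
  exact: measurable_funTS (mUT s x).
apply: (@le_trans _ _ ((\int[mu]_(t in D) `|a t * rpartial s u (x + phi t)|%:E) * c%:E)%E).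
  rewrite lee_wpmul2r ?lee_fin//.
  rewrite (le_trans (le_abse_integral _ _ _))//.
  exact/measurable_EFinP.
rewrite -ge0_integralZr//;
  try (by apply/measurable_EFinP; exact: measurableT_comp).
apply: ge0_le_integral => //.
- by move=> t _; rewrite -EFinM lee_fin mulr_ge0.
- apply/measurable_EFinP; apply: measurable_funM => //.
  exact: measurableT_comp.
- by apply/measurable_EFinP; exact: measurable_funM.
move=> t Dt; rewrite -!EFinM lee_fin /wder /c normrM.
set P := `|rpartial s u (x + phi t)|.
have P0 : 0 <= P by exact: normr_ge0.
have -> : `|x + phi t| / (l / 2) = 2 * (`|x + phi t| / l) by field; rewrite gt_eqF.
set W1 := growth A (2 * _).
have W10 : 0 <= W1 by rewrite ltW// growth_gt0// mulr_ge0// divr_ge0// ltW.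
have W1K : `|a t| * growth A (`|x| / l) <= K * W1.
  apply: (@le_trans _ _ (`|a t| * (W1 * growth A (2 * (`|phi t| / l))))).
    rewrite ler_wpM2l//; apply: (@le_trans _ _ (growth A (`|x + phi t| / l + `|phi t| / l))).
      apply: growth_homo => //; first by rewrite divr_ge0// ltW.
      rewrite -mulrDl ler_pM2r ?invr_gt0//.
      by rewrite -{1}(addrK (phi t) x) (le_trans (ler_normB _ _)).
    by apply: growthD => //; rewrite divr_ge0// ltW.
  rewrite mulrCA mulrC ler_wpM2r//; exact: aK.
rewrite mulrACA [leRHS](_ : _ = K * W1 * (P / ((l / 2) ^+ size s * M (size s)))); last by ring.
have den : (l ^+ size s * M (size s))^-1 <= ((l / 2) ^+ size s * M (size s))^-1.
  rewrite lef_pV2 ?posrE ?wder_den_gt0// ler_wpM2r ?(ltW (Mpos _))//.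
  rewrite lerXn2r ?nnegrE ?(ltW l0) ?(ltW l20)// ler_pdivrMr// ler_peMr ?ltW//.
  by rewrite ltr1n.
apply: ler_pM => //.
- by rewrite mulr_ge0// ltW// growth_norm_gt0.
- by rewrite mulr_ge0// invr_ge0 ltW// wder_den_gt0.
- by rewrite ler_wpM2l.
Qed.

End Translates.

End Weighted_derivatives.
Arguments wder {R n} M A l u s x.

Section Good.
Context {R : realType} {n : nat}.
Context {M A : nat -> R} {p : \bar R}.
Hypotheses (wM : weight_seq M) (wA : weight_seq A).
Hypothesis supM : forall q r, M q * M r <= M (q + r)%N.
Hypothesis p1 : (1 <= p)%E.
Implicit Types (u v : 'rV[R]_n.+1 -> R) (s : seq 'I_n.+1) (l : R).

(** Without further conditions on the weight sequences, the [L^p] steps need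
    not embed into the uniform ones, so both bounds are required. *)
Definition good l u : Prop := rsmooth u /\ exists C : R, forall s,
  (forall x, wder M A l u s x <= C) /\
  forall r : R, p = r%:E ->
    (\int[leb R n.+1]_t (wder M A l u s (rowt t) `^ r)%:E <= C%:E)%E.

Lemma good_bounded l u : 0 < l -> good l u -> exists2 C : R, 0 <= C &
  forall s x, `|rpartial s u x| * growth A (`|x| / l) <= C * (l ^+ size s * M (size s)).
Proof.
move=> l0 [su [C HC]]; exists C.
  have [/(_ 0) h _] := HC [::]; apply: le_trans h; exact: wder_ge0.
move=> s x; have [/(_ x) + _] := HC s.
by rewrite /wder ler_pdivrMr// (wder_den_gt0 wM).
Qed.

Lemma good_norm_le l u : 0 < l -> good l u -> exists2 C : R, 0 <= C &
  forall s x, `|rpartial s u x| <= C * (l ^+ size s * M (size s)).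
Proof.
move=> l0 /(good_bounded l0)[C C0 HC]; exists C => // s x.
rewrite (le_trans _ (HC s x))// ler_peMr// growth_ge1// divr_ge0// ltW//.
Qed.

Section Translates.
Context d {T : measurableType d}.
Variables (mu : {measure set T -> \bar R}) (D : set T) (m : R).
Hypotheses (mD : measurable D) (muD : (mu D <= m%:E)%E).
Variables (a : T -> R) (phi : T -> 'rV[R]_n.+1) (u : 'rV[R]_n.+1 -> R).
Hypothesis ma : measurable_fun setT a.
Hypothesis mphi : forall i, measurable_fun setT (fun t => phi t ord0 i).
Hypothesis su : rsmooth u.
Hypothesis bu : forall s (x : 'rV[R]_n.+1), exists C : R,
  forall t (y : 'rV[R]_n.+1), D t -> ball x 1 y ->
    `|a t * rpartial s u (y + phi t)| <= C.

Let finD : (mu D < +oo)%E. Proof. by rewrite (le_lt_trans muD)// ltry. Qed.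

Lemma translates_powR l K r C s : 0 < l -> 0 <= K -> 1 <= r ->
  (forall t, D t -> `|a t| * growth A (2 * (`|phi t| / l)) <= K) ->
  (\int[leb R n.+1]_t (wder M A (l / 2) u s (rowt t) `^ r)%:E <= C%:E)%E ->
  (\int[leb R n.+1]_t (wder M A l (translates mu D a phi u) s (rowt t) `^ r)%:E <=
   (K `^ r * ((m + 1) `^ r * m) * C)%:E)%E.
Proof.
move=> l0 K0 r1 aK uC; have l20 : 0 < l / 2 by rewrite divr_gt0.
have m0 : 0 <= m by rewrite -lee_fin (le_trans _ muD).
have r0 : 0 <= r by rewrite (le_trans _ r1).
pose nu : {finite_measure set T -> \bar R} := mfrestr mD finD.
have w0 x : 0 <= wder M A (l / 2) u s x by exact: wder_ge0.
have mw : coord_measurable (wder M A (l / 2) u s) by exact: coord_measurable_wder.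
have := @superposition_powR R n.+1 _ T nu m r phi _ r1 _ mphi mw w0.
rewrite -[nu setT]/(mu (setT `&` D)) setTI => /(_ muD) h.
have K00 : (0 <= (K `^ r)%:E)%E by rewrite lee_fin powR_ge0.
have c0 : (0 <= ((m + 1) `^ r * m)%:E)%E by rewrite lee_fin mulr_ge0// powR_ge0.
have := lee_wpmul2l K00 (le_trans h (lee_wpmul2l c0 uC)).
rewrite -!EFinM mulrA; apply: le_trans.
have mW : measurable_fun setT (fun t => wder M A l (translates mu D a phi u) s (rowt t)).
  apply: coord_measurable_rowt; apply: coord_measurable_wder => //.
  exact: (rsmooth_translates mD muD).
pose F (tz : n.+1.-tuple (measurableTypeR R) * T) :=
  wder M A (l / 2) u s (rowt tz.1 + phi tz.2).
have mF : measurable_fun setT F.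
  apply: (mw _ _ (fun tz => (rowt tz.1 + phi tz.2))) => i.
  under eq_fun do rewrite mxE.
  apply: measurable_funD.
    exact: measurableT_comp (measurable_rowt_coord i) measurable_fst.
  exact: measurableT_comp (mphi i) measurable_snd.
have mF1 : measurable_fun setT (fun t => \int[nu]_z (F (t, z))%:E)%E.
  apply: (measurable_fun_fubini_tonelli_F (m2 := nu) (fun tz => (F tz)%:E)).
    exact/measurable_EFinP.
  by move=> z; rewrite lee_fin w0.
rewrite -ge0_integralZl//; last first.
- by move=> t _; exact: poweR_ge0.
- exact: (measurableT_comp (measurable_poweR r)).
apply: ge0_le_integral => //.
- by move=> t _; rewrite lee_fin powR_ge0.
- by apply/measurable_EFinP; exact: (measurableT_comp (measurable_powR r)).
- by apply: measurable_funeM; exact: (measurableT_comp (measurable_poweR r)).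
move=> t _; rewrite -!poweR_EFin -poweRM ?lee_fin//; last first.
  by apply: integral_ge0 => z _; rewrite lee_fin.
apply: ge0_le_poweR => //; first by rewrite lee_fin (wder_ge0 wM wA).
rewrite (le_trans (wder_translates wM wA mD muD ma mphi su bu _ _ l0 aK))//.
rewrite lee_wpmul2l ?lee_fin//.
rewrite -(integral_mrestr mu mD (f := fun z => (F (t, z))%:E))//.
  apply/measurable_EFinP; apply: (measurableT_comp mF).
  exact: measurable_fun_pair.
by move=> z; rewrite lee_fin w0.
Qed.

End Translates.

Lemma good_translates d (T : measurableType d) (mu : {measure set T -> \bar R})
    (D : set T) (m : R) (a : T -> R) (phi : T -> 'rV[R]_n.+1) u l K :
  measurable D -> (mu D <= m%:E)%E -> measurable_fun setT a ->
  (forall i, measurable_fun setT (fun t => phi t ord0 i)) ->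
  0 < l -> 0 <= K ->
  (forall t, D t -> `|a t| * growth A (2 * (`|phi t| / l)) <= K) ->
  good (l / 2) u -> good l (translates mu D a phi u).
Proof.
move=> mD muD ma mphi l0 K0 aK gu; have l20 : 0 < l / 2 by rewrite divr_gt0.
have m0 : 0 <= m by rewrite -lee_fin (le_trans _ muD).
have [C1 C10 HC1] := good_norm_le l20 gu.
have [su [C HC]] := gu.
have aK1 t : D t -> `|a t| <= K.
  move=> /aK; apply: le_trans; rewrite ler_peMr// growth_ge1//.
  by rewrite mulr_ge0// divr_ge0// ltW.
have bu s (x : 'rV[R]_n.+1) : exists C : R,
    forall t (y : 'rV[R]_n.+1), D t -> ball x 1 y ->
    `|a t * rpartial s u (y + phi t)| <= C.
  exists (K * (C1 * ((l / 2) ^+ size s * M (size s)))) => t y Dt _.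
  by rewrite normrM ler_pM// aK1.
split; first exact: (rsmooth_translates mD muD).
have C0 : 0 <= C.
  have [/(_ 0) h _] := HC [::]; apply: le_trans h; exact: wder_ge0.
pose C2 := if p is r%:E then K `^ r * ((m + 1) `^ r * m) * C else 0.
have C20 : 0 <= C2.
  by rewrite /C2; case: (p) => // r; rewrite !mulr_ge0// powR_ge0.
exists (K * (C * m) + C2) => s; split.
  move=> x; rewrite -lee_fin.
  apply: (le_trans (wder_translates wM wA mD muD ma mphi su bu s x l0 aK)).
  apply: (@le_trans _ _ (K * (C * m))%:E); last by rewrite lee_fin lerDl.
  rewrite EFinM lee_wpmul2l ?lee_fin//.
  apply: (@le_trans _ _ (\int[mu]_(t in D) (cst C%:E) t)%E); last first.
    by rewrite integral_cst// EFinM lee_wpmul2l ?lee_fin.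
  apply: ge0_le_integral => //.
  - by move=> t _; rewrite lee_fin wder_ge0.
  - apply/measurable_EFinP; apply: measurable_funTS.
    apply: (coord_measurable_wder (M := M) wA s l20 su) => i.
    by under eq_fun do rewrite mxE; apply: measurable_funD.
  - by move=> t _; rewrite lee_fin; have [] := HC s.
move=> r pr; apply: (@le_trans _ _ C2%:E); last by rewrite lee_fin lerDr !mulr_ge0.
rewrite /C2 pr; apply: (translates_powR mD muD) => //.
- by rewrite -lee_fin -pr.
- by have [_ /(_ r pr)] := HC s.
Qed.

(** Averaging over a small cube turns [L^p] bounds into uniform ones, without
    any loss of derivatives. *)
Lemma good_cube_average (eps a0 K : R) (x0 : 'rV[R]_n.+1) u l :
  0 < eps -> 0 < l -> 0 < K -> rsmooth u ->
  (forall s, (Lp_norm p (fun x => (wder M A (l / 2) u s x)%:E) <= K%:E)%E) ->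
  good l (translates (leb R n.+1) (cube x0 eps) (cst a0) rowt u).
Proof.
move=> eps0 l0 K0 su uK; have l20 : 0 < l / 2 by rewrite divr_gt0.
set D := cube x0 eps; have mD : measurable D by exact: measurable_cube.
have muD : (leb R n.+1 D <= (eps ^+ n.+1)%:E)%E by rewrite leb_cube.
set m := eps ^+ n.+1 in muD; have m0 : 0 <= m by rewrite exprn_ge0// ltW.
have mphi i : measurable_fun setT (fun t => @rowt R n.+1 t ord0 i).
  exact: measurable_rowt_coord.
have phiB t : D t -> `|rowt t| <= `|x0| + eps.
  move=> Dt; rewrite -[`|rowt t|]/(mx_norm _) mx_normrE.
  apply/bigmax_leP; split=> /=; first by rewrite addr_ge0// ltW.
  move=> [j k] _ /=; rewrite mxE; have := Dt k; rewrite /= in_itv/= => /andP[? ?].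
  have xk : `|x0 ord0 k| <= `|x0|.
    rewrite -[leRHS]/(mx_norm _) mx_normrE.
    exact: (le_bigmax _ (fun ij : 'I_1 * 'I_n.+1 => `|x0 ij.1 ij.2|) (ord0, k)).
  move: xk; rewrite !ler_norml => /andP[? ?]; apply/andP; split; lra.
have bu s (x : 'rV[R]_n.+1) : exists C : R,
    forall t (y : 'rV[R]_n.+1), D t -> ball x 1 y ->
    `|cst a0 t * rpartial s u (y + rowt t)| <= C.
  have [C HC] := continuous_bounded (`|x| + 1 + (`|x0| + eps))
    (@rsmooth_continuous _ _ s u su).
  exists (`|a0| * C) => t y Dt xy; rewrite normrM ler_wpM2l//; apply: HC.
  rewrite (le_trans (ler_normD _ _))// lerD ?phiB//.
  rewrite -[y](subrK x) addrC (le_trans (ler_normD _ _))// lerD2l.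
  by move: xy; rewrite -ball_normE/= distrC => /ltW.
pose K1 := `|a0| * growth A (2 * ((`|x0| + eps) / l)).
have K10 : 0 <= K1.
  rewrite mulr_ge0// ltW// growth_gt0// mulr_ge0// divr_ge0// ?(ltW l0)//.
  by rewrite addr_ge0// ltW.
have aK t : D t -> `|cst a0 t| * growth A (2 * (`|rowt t| / l)) <= K1.
  move=> Dt; rewrite ler_wpM2l// growth_homo//.
    by rewrite mulr_ge0// divr_ge0// ltW.
  by rewrite ler_pM2l// ler_pM2r ?invr_gt0// phiB.
clearbody K1.
have w0 s x : 0 <= wder M A (l / 2) u s x by exact: wder_ge0.
have mw s : coord_measurable (wder M A (l / 2) u s) by exact: coord_measurable_wder.
split; first exact: (rsmooth_translates (mu := leb R n.+1) mD muD (measurable_cst a0) mphi su bu).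
pose C2 := if p is r%:E then K1 `^ r * ((m + 1) `^ r * m) * K `^ r else 0.
have C20 : 0 <= C2.
  by rewrite /C2; case: (p) => // r; rewrite !mulr_ge0// powR_ge0.
exists (K1 * (K * (m + 1)) + C2) => s; split; last first.
  move=> r pr; apply: (@le_trans _ _ C2%:E); last first.
    rewrite lee_fin lerDr; apply: mulr_ge0 => //.
    by apply: mulr_ge0; [exact: ltW|exact: addr_ge0].
  have r1 : 1 <= r by rewrite -lee_fin -pr.
  have r0 : 0 < r by rewrite (lt_le_trans _ r1).
  rewrite /C2 pr; apply: (translates_powR (mu := leb R n.+1) mD muD) => //.
  have := uK s; rewrite /Lp_norm pr => /(ge0_le_poweR (ltW r0) (Lnorm_ge0 _ _ _)).
  rewrite poweR_Lnorm ?gt_eqF// poweR_EFin; apply: le_trans.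
  rewrite le_eqVlt; apply/orP; left; apply/eqP; apply: eq_integral => t _.
  by rewrite /= ger0_norm.
move=> x; rewrite -lee_fin.
apply: (le_trans (wder_translates (mu := leb R n.+1) wM wA mD muD (measurable_cst _) mphi su bu s x l0 aK)).
apply: (@le_trans _ _ (K1 * (K * (m + 1)))%:E); last by rewrite lee_fin lerDl.
rewrite EFinM lee_wpmul2l ?lee_fin//.
pose c : 'rV[R]_n.+1 := x.
pose psi (t : n.+1.-tuple (measurableTypeR R)) : R := \1_D (tshift ((- c) ord0) t).
have psi01 t : 0 <= psi t <= 1.
  by rewrite /psi indicE; case: (_ \in _); rewrite ?lexx ?ler01.
have mD1 : measurable_fun setT (\1_D : _ -> R) by exact: measurable_indic.
have mpsi : measurable_fun setT psi.
  exact: measurableT_comp mD1 (measurable_tshift _).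
have mwr : measurable_fun setT (fun t => wder M A (l / 2) u s (rowt t)).
  exact: coord_measurable_rowt.
have := Lnorm_integral p1 K0 mwr mpsi (fun t => w0 s (rowt t)) psi01 (uK s).
have shiftc t : tshift ((- c) ord0) (tshift (c ord0) t) = t.
  by apply: eq_from_tnth => i; rewrite !tnth_mktuple [(- c) _ _]mxE addrK.
have -> : (\int[leb R n.+1]_t (psi t)%:E = leb R n.+1 D)%E.
  rewrite -(integral_tshift (c ord0))//.
  - under eq_integral do rewrite /psi shiftc.
    by rewrite integral_indic// setIT.
  - exact/measurable_EFinP.
  - by move=> t; rewrite lee_fin; have /andP[] := psi01 t.
rewrite -(integral_tshift (c ord0))//; last 2 first.
- by apply/measurable_EFinP; exact: measurable_funM.
- by move=> t; rewrite lee_fin mulr_ge0//; have /andP[] := psi01 t.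
move=> /(fun h => le_trans h _) h; apply: (le_trans _ (h _ _)); last first.
  by rewrite EFinM lee_wpmul2l ?lee_fin ?(ltW K0)// EFinD leeD2r.
rewrite [leLHS]integral_mkcond le_eqVlt; apply/orP; left; apply/eqP.
apply: eq_integral => t _; rewrite /psi shiftc rowt_tshift patchE indicE.
case: (t \in D); rewrite ?mulr1 ?mulr0//.
by rewrite /c addrC.
Qed.

End Good.
Arguments good {R n} M A p l u.

Section Products.
Context {R : realType} {n : nat}.
Context {M A : nat -> R} {p : \bar R}.
Hypotheses (wM : weight_seq M) (wA : weight_seq A).
Hypothesis supM : forall q r, M q * M r <= M (q + r)%N.
Hypothesis p1 : (1 <= p)%E.
Implicit Types (u v : 'rV[R]_n.+1 -> R) (s : seq 'I_n.+1) (l : R).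

Let Mpos q : 0 < M q. Proof. by have [] := wM. Qed.

Lemma powR_sum_le (I : eqType) (l : seq I) (w : I -> R) (r : R) : 0 < r ->
  (forall i, 0 <= w i) ->
  (\sum_(i <- l) w i) `^ r <= (size l)%:R `^ r * \sum_(i <- l) w i `^ r.
Proof.
move=> r0 w0; set S := \sum_(i <- l) w i `^ r.
have S0 : 0 <= S by apply: sumr_ge0 => i _; exact: powR_ge0.
have wS i : i \in l -> w i <= S `^ r^-1.
  move=> il; rewrite -[leLHS](powRr1 (w0 i)) -(mulfV (lt0r_neq0 r0)) powRrM.
  apply: ge0_ler_powR; rewrite ?nnegrE ?powR_ge0 ?invr_ge0 ?(ltW r0)//.
  rewrite /S (big_rem i)//= lerDl.
  by apply: sumr_ge0 => j _; exact: powR_ge0.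
have sumle : \sum_(i <- l) w i <= (size l)%:R * S `^ r^-1.
  rewrite mulr_natl -sum1_size -sumrMnr big_seq [leRHS]big_seq.
  by apply: ler_sum => i il; rewrite mulr1n; exact: wS.
apply: (@le_trans _ _ (((size l)%:R * S `^ r^-1) `^ r)).
  apply: ge0_ler_powR; rewrite ?nnegrE ?(ltW r0) ?mulr_ge0 ?powR_ge0//.
  exact: sumr_ge0.
by rewrite powRM ?powR_ge0// -powRrM mulVf ?gt_eqF// powRr1.
Qed.

(** The factor 4 absorbs the number of terms in Leibniz's formula. *)
Lemma good_multiplier u v l : 0 < l -> rsmooth v ->
  (exists C : R, forall s x, `|rpartial s v x| <= C * (l ^+ size s * M (size s))) ->
  good M A p l u -> good M A p (4 * l) (fun x => v x * u x).
Proof.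
move=> l0 sv [C HC] [su [C' HC']]; have l40 : 0 < 4 * l by rewrite mulr_gt0.
have C0 : 0 <= C.
  have := HC [::] 0; rewrite /= expr0 mul1r.
  have [_ -> _] := wM; rewrite mulr1; exact: le_trans.
have w0 s x : 0 <= wder M A l u s x by exact: wder_ge0.
have C'0 : 0 <= C' by have [/(_ 0) + _] := HC' [::]; exact: le_trans.
have swap s x : wder M A (4 * l) (fun x => v x * u x) s x <=
    4^-1 ^+ size s * (C * \sum_(q <- splits s) wder M A l u q.2 x).
  rewrite /wder rpartialM// ler_pdivrMr ?(wder_den_gt0 wM)//.
  apply: (@le_trans _ _ ((\sum_(q <- splits s) `|rpartial q.1 v x * rpartial q.2 u x|) *
      growth A (`|x| / l))).
    rewrite ler_pM ?ler_norm_sum// ?(ltW (growth_norm_gt0 wA x l40))//.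
    apply: growth_homo => //; first by rewrite divr_ge0// ltW.
    by rewrite ler_wpM2l// lef_pV2 ?posrE// ler_peMl ?ltW// ltr1n.
  rewrite mulr_suml mulr_sumr mulr_sumr mulr_suml big_seq [leRHS]big_seq.
  apply: ler_sum => q qs; rewrite normrM.
  set W := growth A _; have W0 : 0 < W by exact: growth_norm_gt0.
  apply: (@le_trans _ _ (C * (l ^+ size q.1 * M (size q.1)) * `|rpartial q.2 u x| * W)).
    by rewrite ler_wpM2r ?(ltW W0)// ler_wpM2r.
  have [s1 s2] : l ^+ size s = l ^+ size q.1 * l ^+ size q.2 /\
      M (size q.1) * M (size q.2) <= M (size s).
    by rewrite -exprD (size_splitsP qs) -(size_splitsP qs); split.
  have e4 : (4^-1 : R) ^+ size s * (4 * l) ^+ size s = l ^+ size q.1 * l ^+ size q.2.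
    by rewrite -exprMn mulrA mulVf// mul1r.
  rewrite [leRHS](_ : _ = C * (l ^+ size q.1 * l ^+ size q.2 *
     (`|rpartial q.2 u x| * W / (l ^+ size q.2 * M (size q.2)))) * M (size s)); last first.
    by rewrite -e4; ring.
  rewrite [leLHS](_ : _ = C * (l ^+ size q.1 * l ^+ size q.2 *
     (`|rpartial q.2 u x| * W / (l ^+ size q.2 * M (size q.2)))) * (M (size q.1) * M (size q.2))); last first.
    by field; rewrite expf_neq0 gt_eqF.
  have X0 : 0 <= `|rpartial q.2 u x| * W / (l ^+ size q.2 * M (size q.2)).
    by rewrite divr_ge0 ?(ltW (wder_den_gt0 wM _ l0))// mulr_ge0// ltW.
  rewrite ler_wpM2l//; apply: mulr_ge0 => //; apply: mulr_ge0 => //.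
  by rewrite mulr_ge0 ?exprn_ge0 ?(ltW l0).
split; first exact: rsmoothM.
pose C2 := if p is r%:E then C `^ r * C' else 0.
have C20 : 0 <= C2 by rewrite /C2; case: (p) => // r; rewrite mulr_ge0 ?powR_ge0.
have q20 (k : nat) : (4^-1 : R) ^+ k * (2 ^ k)%:R = 2^-1 ^+ k.
  by rewrite natrX -exprMn; congr (_ ^+ _); field.
exists (C * C' + C2) => s; split.
  move=> x; apply: (le_trans (swap s x)); apply: (@le_trans _ _ (C * C')); last by rewrite lerDl.
  apply: (@le_trans _ _ (4^-1 ^+ size s * (C * \sum_(q <- splits s) C'))).
    rewrite ler_wpM2l ?exprn_ge0// ler_wpM2l//; apply: ler_sum => q _.
    by have [] := HC' q.2.
  rewrite big_const_seq count_predT size_splits iter_addr addr0 -[C' *+ _]mulr_natr.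
  rewrite [leLHS](_ : _ = 4^-1 ^+ size s * (2 ^ size s)%:R * (C * C')); last by ring.
  by rewrite q20 ler_piMl ?mulr_ge0// exprn_ile1 ?invr_ge0// invf_le1// ler1n.
move=> r pr; have r1 : 1 <= r by rewrite -lee_fin -pr.
have r0 : 0 < r by rewrite (lt_le_trans _ r1).
apply: (@le_trans _ _ C2%:E); last by rewrite lee_fin lerDr mulr_ge0.
rewrite /C2 pr.
have mw q : measurable_fun setT (fun t => wder M A l u q (rowt t) `^ r).
  apply: (measurableT_comp (measurable_powR r)).
  by apply: coord_measurable_rowt; exact: coord_measurable_wder.
pose k := 4^-1 ^+ size s * C; have k0 : 0 <= k by rewrite mulr_ge0 ?exprn_ge0.
pose c := k `^ r * (2 ^ size s)%:R `^ r.
have c0 : 0 <= c by rewrite mulr_ge0 ?powR_ge0.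
apply: (@le_trans _ _ (\int[leb R n.+1]_t
    (c%:E * \sum_(q <- splits s) (wder M A l u q.2 (rowt t) `^ r)%:E))%E).
  apply: ge0_le_integral => //.
  - by move=> t _; rewrite lee_fin powR_ge0.
  - apply/measurable_EFinP; apply: (measurableT_comp (measurable_powR r)).
    apply: coord_measurable_rowt; apply: coord_measurable_wder => //; exact: rsmoothM.
  - apply: measurable_funeM; apply: emeasurable_fun_sum => q.
    exact/measurable_EFinP.
  move=> t _; rewrite sumEFin -EFinM lee_fin.
  rewrite /c -mulrA -size_splits.
  apply: (@le_trans _ _ ((k * \sum_(q <- splits s) wder M A l u q.2 (rowt t)) `^ r)).
    apply: ge0_ler_powR; rewrite ?nnegrE ?(ltW r0) ?wder_ge0//.
      by rewrite mulr_ge0// sumr_ge0.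
    by rewrite /k -mulrA; exact: swap.
  rewrite powRM ?sumr_ge0// ler_wpM2l ?powR_ge0//.
  exact: (powR_sum_le _ r0).
rewrite ge0_integralZl//; last 2 first.
- by apply: emeasurable_fun_sum => q; exact/measurable_EFinP.
- by move=> t _; apply: sume_ge0 => q _; rewrite lee_fin powR_ge0.
rewrite ge0_integral_sum//; last 2 first.
- by move=> q; exact/measurable_EFinP.
- by move=> q t _; rewrite lee_fin powR_ge0.
apply: (@le_trans _ _ (c%:E * \sum_(q <- splits s) C'%:E)%E).
  rewrite lee_wpmul2l ?lee_fin//; apply: lee_sum => q _.
  by have [_ /(_ r pr)] := HC' q.2.
rewrite sumEFin -EFinM lee_fin big_const_seq count_predT size_splits iter_addr addr0.
rewrite -[C' *+ _]mulr_natr /c /k powRM ?exprn_ge0//.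
set e := size s; rewrite [leLHS](_ : _ = ((4^-1 ^+ e) `^ r * (2 ^ e)%:R `^ r * (2 ^ e)%:R) * (C `^ r * C')); last by ring.
rewrite ler_piMl ?mulr_ge0 ?powR_ge0// -powRM ?exprn_ge0// q20.
apply: (@le_trans _ _ (2^-1 ^+ e * (2 ^ e)%:R)).
  rewrite ler_wpM2r//; apply: ge1r_powR => //.
  by rewrite exprn_gt0 ?invr_gt0// exprn_ile1 ?invr_ge0// invf_le1// ler1n.
by rewrite natrX -exprMn mulVf// expr1n.
Qed.

Lemma good_sqr u l : 0 < l -> good M A p l u -> good M A p (4 * l) (fun x => u x * u x).
Proof.
move=> l0 gu; apply: good_multiplier => //; first by have [] := gu.
by have [C _ HC] := good_norm_le wM wA l0 gu; exists C.
Qed.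

End Products.

(** * A test function *)

Definition for_case (R : numDomainType) (c : limit_case) (P : R -> Prop) : Prop :=
  match c with
  | Beurling => forall l, 0 < l -> P l
  | Roumieu => exists2 l, 0 < l & P l
  end.

Lemma for_case_scale (R : numFieldType) (c : limit_case) (k : R) (P Q : R -> Prop) :
  0 < k -> (forall l, 0 < l -> P l -> Q (k * l)) -> for_case c P -> for_case c Q.
Proof.
move=> k0 PQ; case: c => [cP l l0|[l l0 Pl]]; last first.
  by exists (k * l); [rewrite mulr_gt0|exact: PQ].
have lk : 0 < l / k by rewrite divr_gt0.
by have := PQ _ lk (cP _ lk); rewrite mulrC divfK// gt_eqF.
Qed.

Lemma for_case_exists (R : numDomainType) (c : limit_case) (P : R -> Prop) :
  for_case c P -> exists2 l, 0 < l & P l.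
Proof. by case: c => //= cP; exists 1 => //; exact: cP. Qed.

Section Lnorm_le.
Context {R : realType} d {T : measurableType d}.
Variable mu : {measure set T -> \bar R}.
Local Open Scope ereal_scope.

Lemma Lnorm_leZ (p : \bar R) (k : R) (g f : T -> R) : 1 <= p -> (0 < k)%R ->
  measurable_fun setT g -> measurable_fun setT f ->
  (forall x, 0 <= g x)%R -> (forall x, g x <= k * f x)%R ->
  'N[mu]_p[EFin \o g] <= k%:E * 'N[mu]_p[EFin \o f].
Proof.
move=> p1 k0 mg mf g0 gf.
have f0 x : (0 <= f x)%R by rewrite -(pmulr_rge0 _ k0) (le_trans (g0 x)).
case: p p1 => [r| |//]; rewrite ?lee_fin => r1.
  have r0 : (0 < r)%R by rewrite (lt_le_trans _ r1).
  rewrite unlock /=.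
  have -> : k%:E = (k%:E `^ r) `^ r^-1.
    by rewrite -poweRrM mulfV ?gt_eqF// poweRe1// lee_fin ltW.
  have I0 (h : T -> R) : 0 <= \int[mu]_x (`|h x| `^ r)%:E.
    by apply: integral_ge0 => x _; rewrite lee_fin powR_ge0.
  rewrite -poweRM ?poweR_ge0//; apply: ge0_le_poweR => //.
    by rewrite invr_ge0 ltW.
  have mfr (h : T -> R) : measurable_fun setT h ->
      measurable_fun setT (fun x => (`|h x| `^ r)%:E).
    move=> mh; apply/measurable_EFinP; apply: (measurableT_comp (measurable_powR r)).
    exact: measurableT_comp.
  rewrite poweR_EFin -ge0_integralZl ?lee_fin ?powR_ge0//; try exact: mfr;
    try by move=> x _; rewrite lee_fin powR_ge0.
  apply: ge0_le_integral => //.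
  - exact: mfr.
  - by apply: emeasurable_funM => //; exact: mfr.
  move=> x _; rewrite !ger0_norm// -EFinM lee_fin -powRM ?(ltW k0)//.
  by apply: ge0_ler_powR; rewrite ?nnegrE ?(ltW r0)// mulr_ge0// ltW.
rewrite unlock; case: ifPn => mu0; last by rewrite mule0.
apply/ess_supP; have := ess_sup_ge mu (abse \o (EFin \o f)).
apply: filterS => x /= h; rewrite ger0_norm//.
apply: (@le_trans _ _ (k%:E * `|f x|%:E)).
  by rewrite ger0_norm// -EFinM lee_fin.
by rewrite lee_wpmul2l// lee_fin ltW.
Qed.

Lemma Rintegral_ge_on (D B : set T) (f : T -> R) (e m : R) : measurable D ->
  measurable B -> B `<=` D -> mu.-integrable D (EFin \o f) ->
  (forall x, D x -> 0 <= f x)%R -> (0 <= e)%R -> (forall x, B x -> e <= f x)%R ->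
  m%:E <= mu B -> (e * m <= \int[mu]_(x in D) f x)%R.
Proof.
move=> mD mB BD if0 f0 e0 ef mB0.
have mf := measurable_int mu if0.
rewrite -lee_fin /Rintegral fineK; last exact: integrable_fin_num.
apply: (@le_trans _ _ (\int[mu]_(x in B) (EFin \o f) x)); last first.
  by apply: ge0_subset_integral => // x Dx; rewrite lee_fin f0.
apply: (@le_trans _ _ (\int[mu]_(x in B) (cst e%:E) x)).
  by rewrite integral_cst// EFinM lee_wpmul2l.
apply: ge0_le_integral => //.
exact: measurable_funS mf.
Qed.

End Lnorm_le.

Section Spaces.
Context {R : realType} {n : nat}.
Context {M A : nat -> R} {p : \bar R}.
Hypotheses (wM : weight_seq M) (wA : weight_seq A) (p1 : (1 <= p)%E).
Implicit Types (f : 'rV[R]_n.+1 -> R[i]) (u : 'rV[R]_n.+1 -> R).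
Local Notation MM := (isotropic n.+1 M).
Local Notation AA := (isotropic n.+1 A).

Let Mpos q : 0 < M q. Proof. by have [] := wM. Qed.

Lemma size_mlist (a : multi n.+1) : size (mlist a) = mlen a.
Proof.
rewrite /mlist size_flatten /shape -map_comp sumnE big_map big_enum /mlen.
by apply: eq_bigr => i _ /=; rewrite size_nseq.
Qed.

Lemma perm_mlist (s : seq 'I_n.+1) : perm_eq s (mlist [ffun i => count_mem i s]).
Proof.
apply/allP => i _ /=; apply/eqP; rewrite /mlist count_flatten -map_comp sumnE.
rewrite big_map big_enum/= (bigD1 i)//= ffunE count_nseq /= eqxx mul1n.
rewrite big1 ?addn0// => j ji; by rewrite count_nseq/= (negbTE ji) mul0n.
Qed.

(** The term of index [a] in the definition of [X_norm]. *)
Lemma X_norm_termE l f (a : multi n.+1) : 0 < l ->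
  (fun x => (Normc.normc (partial a f x))%:E * expeR (omega AA (l^-1 *: x)))%E =
  (fun x => (Normc.normc (partial a f x) * growth A (`|x| / l))%:E).
Proof. by move=> l0; apply/funext => x; rewrite (expeR_omegaZ wA)// EFinM. Qed.

Lemma continuous_normc_partial f (a : multi n.+1) : smooth f ->
  continuous (fun x => Normc.normc (partial a f x)).
Proof.
move=> [sRe sIm] x; rewrite /partial /=.
pose u := rpartial (mlist a) (fun y => complex.Re (f y)).
pose v := rpartial (mlist a) (fun y => complex.Im (f y)).
have cu : {for x, continuous u} by exact: rsmooth_continuous.
have cv : {for x, continuous v} by exact: rsmooth_continuous.
have cuv : {for x, continuous (u * u + v * v)}.
  exact: (continuousD (continuousM cu cu) (continuousM cv cv)).
have := continuous_comp cuv (@sqrt_continuous _ _).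
by congr ({for x, continuous _}); apply/funext => y /=; rewrite !expr2.
Qed.

Lemma measurable_X_norm_term l f (a : multi n.+1) : 0 < l -> smooth f ->
  measurable_fun setT
    (fun t => Normc.normc (partial a f (rowt t)) * growth A (`|@rowt R n.+1 t| / l)).
Proof.
move=> l0 sf; apply: (@coord_measurable_rowt R n.+1
  (fun x => Normc.normc (partial a f x) * growth A (`|x| / l))).
apply: coord_measurableM; last exact: coord_measurable_growth.
exact/coord_measurable_continuous/continuous_normc_partial.
Qed.

Lemma X_set_Lp_bound l f : 0 < l -> X_set MM AA p l f ->
  exists2 K : R, 0 < K & forall a : multi n.+1,
    ((l ^+ mlen a * M (mlen a))^-1%:E * Lp_norm p (fun x =>
      (Normc.normc (partial a f x) * growth A (`|x| / l))%:E) <= K%:E)%E.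
Proof.
move=> l0 [sf Xf].
have term a : ((l ^+ mlen a * M (mlen a))^-1%:E * Lp_norm p (fun x =>
      (Normc.normc (partial a f x) * growth A (`|x| / l))%:E) <= X_norm MM AA p l f)%E.
  apply: ereal_sup_ubound; exists a => //.
  by rewrite muleC (X_norm_termE _ _ l0).
have term0 a : (0 <= (l ^+ mlen a * M (mlen a))^-1%:E * Lp_norm p (fun x =>
      (Normc.normc (partial a f x) * growth A (`|x| / l))%:E))%E.
  by rewrite mule_ge0 ?Lnorm_ge0// lee_fin invr_ge0 mulr_ge0 ?exprn_ge0 ?(ltW l0) ?(ltW (Mpos _)).
case: (X_norm _ _ _ _ _) Xf term => [K _ term| // |_ term]; last first.
  by have := le_trans (term0 [ffun=> 0%N]) (term [ffun=> 0%N]).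
exists (K + 1); first by rewrite ltr_pwDr// -lee_fin (le_trans (term0 [ffun=> 0%N])).
by move=> a; rewrite (le_trans (term a))// lee_fin lerDl.
Qed.

Lemma X_set_wder (part : R[i] -> R) l f : part = @complex.Re R \/ part = @complex.Im R ->
  0 < l -> X_set MM AA p l f ->
  exists2 K : R, 0 < K &
    forall s, (Lp_norm p (fun x => (wder M A l (part \o f) s x)%:E) <= K%:E)%E.
Proof.
move=> partE l0 Xf; have [K K0 HK] := X_set_Lp_bound l0 Xf; exists K => // s.
have [sf _] := Xf; have [sRe sIm] := sf.
have spart : rsmooth (part \o f) by case: partE => ->.
pose a : multi n.+1 := [ffun i => count_mem i s].
have ps := perm_mlist s.
have sa : size s = mlen a by rewrite (perm_size ps) size_mlist.
apply: le_trans (HK a); rewrite /Lp_norm.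
apply: (@Lnorm_leZ R _ _ (leb R n.+1) p _ (fun t => wder M A l (part \o f) s (rowt t))
  (fun t => Normc.normc (partial a f (rowt t)) * growth A (`|rowt t| / l)) p1).
- by rewrite invr_gt0 mulr_gt0 ?exprn_gt0.
- by apply: coord_measurable_rowt; exact: coord_measurable_wder.
- exact: measurable_X_norm_term.
- by move=> t; exact: wder_ge0.
- move=> t; rewrite /wder sa mulrC ler_wpM2l//.
    by rewrite invr_ge0 mulr_ge0 ?exprn_ge0 ?(ltW l0) ?(ltW (Mpos _)).
  rewrite ler_wpM2r ?(ltW (growth_norm_gt0 wA _ l0))//.
  rewrite (rpartial_perm spart ps) /partial/= -sqrtr_sqr.
  by rewrite ler_sqrt ?addr_ge0 ?sqr_ge0//; case: partE => ->; rewrite ?lerDl ?lerDr sqr_ge0.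
Qed.

End Spaces.

Section Real_embedding.
Context {R : realType} {n : nat}.
Context {M A : nat -> R} {p : \bar R}.
Hypotheses (wM : weight_seq M) (wA : weight_seq A) (p1 : (1 <= p)%E).
Implicit Types (f : 'rV[R]_n.+1 -> R[i]) (u : 'rV[R]_n.+1 -> R).
Local Notation MM := (isotropic n.+1 M).
Local Notation AA := (isotropic n.+1 A).

Let Mpos q : 0 < M q. Proof. by have [] := wM. Qed.

Lemma rpartial_cst0 (s : seq 'I_n.+1) :
  rpartial s (fun=> 0 : R) = (fun=> 0).
Proof.
elim: s => [//|i s IH]; rewrite [LHS]/= -/(rpartial _ _) IH.
by apply/funext => x; exact: derive_cst.
Qed.

Lemma rsmooth_cst0 : rsmooth ((fun=> 0 : R) : 'rV[R]_n.+1 -> R).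
Proof.
move=> s; rewrite rpartial_cst0; split; first exact: cst_continuous.
by move=> i x; exact: derivable_cst.
Qed.

Lemma good_Lp_norm l u : 0 < l -> good M A p l u ->
  exists2 K : R, 0 < K & forall s, (Lp_norm p (fun x => (wder M A l u s x)%:E) <= K%:E)%E.
Proof.
move=> l0 [su [C HC]].
have C0 : 0 <= C.
  have [/(_ 0) h _] := HC [::]; apply: le_trans h; exact: wder_ge0.
pose K := if p is r%:E then C `^ r^-1 else C.
have K0 : 0 <= K by rewrite /K; case: (p) => // r; rewrite powR_ge0.
exists (K + 1); first by rewrite ltr_pwDr.
move=> s; apply: (@le_trans _ _ K%:E); last by rewrite lee_fin lerDl.
have [HC1 HC2] := HC s; rewrite /K /Lp_norm; case: (p) p1 HC2 => [r| |//] pr1 HC2.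
  have r0 : 0 < r by rewrite -lte_fin (lt_le_trans _ pr1).
  rewrite unlock -poweR_EFin; apply: ge0_le_poweR; first by rewrite invr_ge0 ltW.
    by apply: integral_ge0 => t _; exact: poweR_ge0.
  rewrite (le_trans _ (HC2 r _))// le_eqVlt; apply/orP; left; apply/eqP.
  by apply: eq_integral => t _; rewrite /= ger0_norm// wder_ge0.
rewrite unlock; case: ifPn => // mu0.
apply/ess_supP; apply: aeW => t /=.
by rewrite lee_fin ger0_norm ?wder_ge0//; exact: HC1.
Qed.

Lemma good_X_set l u : 0 < l -> good M A p l u ->
  X_set MM AA p l (fun x => (u x)%:C%C).
Proof.
move=> l0 gu; have [K K0 HK] := good_Lp_norm l0 gu; have [su _] := gu.
have sf : smooth (fun x => (u x)%:C%C) by split => //; exact: rsmooth_cst0.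
split=> //; apply: (@le_lt_trans _ _ K%:E); last exact: ltry.
apply: ge_ereal_sup => _ [a _ <-]; rewrite (X_norm_termE wA)//.
pose den := l ^+ mlen a * M (mlen a).
have den0 : 0 < den by rewrite mulr_gt0 ?exprn_gt0.
rewrite -/den muleC -lee_pdivlMl ?invr_gt0// invrK.
apply: le_trans (lee_wpmul2l _ (HK (mlist a))); last by rewrite lee_fin ltW.
apply: (@Lnorm_leZ R _ _ (leb R n.+1) p den (fun t => Normc.normc (partial a _ (rowt t)) * growth A (`|rowt t| / l))
  (fun t => wder M A l u (mlist a) (rowt t)) p1) => //.
- exact: measurable_X_norm_term.
- by apply: coord_measurable_rowt; exact: coord_measurable_wder.
- by move=> t; rewrite mulr_ge0 ?(ltW (growth_norm_gt0 wA _ l0))//= sqrtr_ge0.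
move=> t; rewrite /wder size_mlist -/den [leRHS]mulrC divfK ?gt_eqF//.
by rewrite /partial/= rpartial_cst0 expr0n/= addr0 sqrtr_sqr.
Qed.

Lemma GS_for_case c f : GS MM AA p c f <-> for_case c (fun l => X_set MM AA p l f).
Proof.
by case: c.
Qed.

Lemma GS_nonzero c : GS MM AA p c <> [set 0] ->
  exists f x0, GS MM AA p c f /\ f x0 <> 0.
Proof.
move=> GS0; apply: contrapT => /forallNP nex; apply: GS0; apply/seteqP; split => f.
  move=> GSf; apply/funext => x; apply: contrapT => fx.
  by apply: (nex f); exists x.
move=> ->; have z : for_case c (fun l => X_set MM AA p l (fun=> (0 : R)%:C%C)).
  have X0 l : 0 < l -> X_set MM AA p l (fun=> (0 : R)%:C%C).
    move=> l0; apply: (@good_X_set l (fun=> 0)) => //; split; first exact: rsmooth_cst0.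
    have w0 s (x : 'rV[R]_n.+1) : wder M A l (fun=> 0) s x = 0.
      by rewrite /wder rpartial_cst0 normr0 !mul0r.
    exists 0 => s; split=> [x|r pr]; first by rewrite w0.
    have r0 : r != 0 by rewrite gt_eqF// -lte_fin -pr (lt_le_trans _ p1).
    rewrite (eq_integral (cst 0%E)) ?integral0// => t _.
    by rewrite w0 powR0.
  by case: (c) => /= [l l0|]; [exact: X0|exists 1 => //; exact: X0].
exact/GS_for_case.
Qed.

End Real_embedding.

Section Test_function.
Context {R : realType} {n : nat}.
Context {M A : nat -> R} {p : \bar R}.
Hypotheses (wM : weight_seq M) (wA : weight_seq A) (p1 : (1 <= p)%E).
Hypothesis supM : forall q r, M q * M r <= M (q + r)%N.
Implicit Types (u : 'rV[R]_n.+1 -> R).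
Local Notation MM := (isotropic n.+1 M).
Local Notation AA := (isotropic n.+1 A).
Local Notation e0 := (delta_mx ord0 ord0 : 'rV[R]_n.+1).

Lemma continuous_same_sign u x : continuous u -> u x != 0 ->
  exists2 eps : R, 0 < eps & forall y, `|y - x| <= eps -> u x ^+ 2 / 2 <= u x * u y.
Proof.
move=> cu ux; have e2 : 0 < `|u x| / 2 by rewrite divr_gt0// normr_gt0.
have /cvgrPdist_lt/(_ _ e2)/nbhs_ballP[d /= d0 H] := cu x.
exists (d / 2); first by rewrite divr_gt0.
move=> y yx; have /H : ball x d y.
  rewrite -ball_normE/= distrC (le_lt_trans yx)// ltr_pdivrMr// ltr_pMr//.
  by rewrite ltr1n.
move: (u x) (u y) => a b ab; move: ab; rewrite ltr_norml => /andP[h1 h2].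
have [a0|a0] := lerP 0 a.
  by move: h1 h2; rewrite (ger0_norm a0) => h1 h2; nra.
by move: h1 h2; rewrite (ltr0_norm a0) => h1 h2; nra.
Qed.

Lemma cube_close (z : 'rV[R]_n.+1) eps t : 0 < eps -> cube z eps t ->
  `|rowt t - z| <= eps.
Proof.
move=> eps0 zt; rewrite -[leLHS]/(mx_norm _) mx_normrE.
apply/bigmax_leP; split=> /=; first exact: ltW.
move=> [j k] _ /=; rewrite !mxE (ord1 j); have := zt k; rewrite /= in_itv/=.
by move=> /andP[? ?]; rewrite ger0_norm ?subr_ge0// lerBlDl.
Qed.

Let mu := @lebesgue_measure R.

(** [k (x + 2 pi e0) - k x] is the first partial derivative of this average. *)
Definition period_average u : 'rV[R]_n.+1 -> R :=
  translates mu `[0, 2 * pi]%classic (cst 1) (fun s : R => s *: e0) u.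

Let pi2_gt0 : 0 < 2 * pi :> R. Proof. by rewrite mulr_gt0// pi_gt0. Qed.

Let muI : (mu `[0%R, (2 * pi)%R]%classic <= (2 * pi)%:E)%E.
Proof. by rewrite /mu lebesgue_measure_itv/= lte_fin pi2_gt0 oppr0 adde0. Qed.

Let mphi i : measurable_fun setT (fun s : R => (s *: e0) ord0 i).
Proof. by under eq_fun do rewrite mxE; apply: measurable_funM. Qed.

Let norm_se0 (s : R) : `|s *: e0| <= `|s|.
Proof. by rewrite normrZ ler_piMr// norm_delta_le. Qed.

Lemma good_period_average l u : 0 < l -> good M A p (l / 2) u ->
  good M A p l (period_average u).
Proof.
move=> l0 gu.
apply: (@good_translates R n M A p wM wA p1 _ _ mu _ (2 * pi) (cst 1) _ u l
  (growth A (2 * (2 * pi / l)))) => //.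
- by rewrite ltW// growth_gt0// mulr_ge0// divr_ge0// ltW.
- move=> s; rewrite /= in_itv/= => /andP[s0 s2]; rewrite normr1 mul1r.
  apply: growth_homo => //; first by rewrite mulr_ge0// divr_ge0// ltW.
  rewrite ler_pM2l// ler_pM2r ?invr_gt0// (le_trans (norm_se0 s))//.
  by rewrite ger0_norm.
Qed.

Section Period_average.
Variable u : 'rV[R]_n.+1 -> R.
Hypothesis su : rsmooth u.
Hypothesis bu : forall s, exists C : R, forall x, `|rpartial s u x| <= C.

Let bu1 s (x : 'rV[R]_n.+1) : exists C : R,
  forall t (y : 'rV[R]_n.+1), `[0%R, 2 * pi]%classic t -> ball x 1 y ->
    `|cst (1 : R) t * rpartial s u (y + t *: e0)| <= C.
Proof.
have [C HC] := bu s; exists C => t y _ _.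
by rewrite mul1r HC.
Qed.

Lemma rpartial_period_average (s : seq 'I_n.+1) x :
  rpartial s (period_average u) x =
  \int[mu]_(t in `[0, 2 * pi]) rpartial s u (x + t *: e0).
Proof.
rewrite (rpartial_translates _ muI _ mphi su bu1)//.
by apply: eq_Rintegral => t _; rewrite mul1r.
Qed.

Lemma integrable_period_average x : mu.-integrable `[0, 2 * pi]%classic
  (EFin \o (fun t : R => u (x + t *: e0))).
Proof.
have := @integrable_translates _ _ _ _ mu `[0, 2 * pi]%classic (2 * pi) _ muI
  (cst 1) _ u _ mphi su bu1 [::] x.
rewrite (_ : (fun t : R => cst 1 t * _) = (fun t : R => u (x + t *: e0))).
  by apply => //; exact: measurable_itv.
by apply/funext => t; rewrite mul1r.
Qed.

Lemma derive_period_average x :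
  'D_e0 (period_average u) x = u (x + (2 * pi) *: e0) - u x.
Proof.
rewrite -[LHS]/(rpartial [:: ord0] _ _) rpartial_period_average.
pose g (t : R) := u (x + t *: e0).
pose dg (t : R) := rpartial [:: ord0] u (x + t *: e0).
have dgP (t : R) : is_derive t (1 : R) g (dg t).
  by apply: is_derive_line; exact: (@rsmooth_derivable _ _ [::]).
have cdg : continuous dg.
  move=> t; apply: (@continuous_comp _ _ _ (fun t : R => x + t *: e0)); last first.
    exact: rsmooth_continuous.
  apply: (continuousD (@cst_continuous _ _ x t)).
  exact: (continuousZ (@cvg_id _ _) (@cst_continuous _ _ e0 t)).
have cg : continuous g.
  by move=> t; apply: differentiable_continuous; apply/derivable1_diffP; have [] := dgP t.
rewrite /Rintegral (@continuous_FTC2 R dg g 0 (2 * pi) pi2_gt0).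
- by rewrite -EFinB /= /g scale0r addr0.
- exact: continuous_subspaceT.
- split.
  + by move=> t _; have [] := dgP t.
  + by apply: cvg_at_right_filter; exact: cg.
  + by apply: cvg_at_left_filter; exact: cg.
- by move=> t _; rewrite derive1E; have [_ ->] := dgP t.
Qed.

End Period_average.

(** From any nonzero element: averaging over a small cube makes it uniformly
    bounded, squaring makes it nonnegative, and averaging over a period makes
    the Fourier transform in the first variable vanish at the nonzero
    integers. *)
Lemma test_function c : GS MM AA p c <> [set 0] ->
  exists h k : 'rV[R]_n.+1 -> R,
    [/\ for_case c (fun l => good M A p l h), for_case c (fun l => good M A p l k),
        forall x, 0 <= h x, 0 < h 0 &
        forall x, 'D_e0 h x = k (x + (2 * pi) *: e0) - k x].
Proof.
move=> /(GS_nonzero wM wA p1)[f [x0 [GSf fx0]]].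
have [part [partE fx]] : exists part, (part = @complex.Re R \/ part = @complex.Im R) /\
    part (f x0) != 0.
  have [r0|] := eqVneq (complex.Re (f x0)) 0; last first.
    by exists (@complex.Re R); split=> //; left.
  exists (@complex.Im R); split; first by right.
  by apply/eqP => i0; apply: fx0; move: r0 i0; case: (f x0) => a b /= -> ->.
have /GS_for_case Xf := GSf.
have sf : smooth f by have [l _ []] := for_case_exists Xf.
pose u := part \o f.
have su : rsmooth u by have [? ?] := sf; rewrite /u; case: partE => ->.
have cu : continuous u by exact: (@rsmooth_continuous _ _ [::]).
have [eps eps0 Heps] := continuous_same_sign cu fx.
pose h1 := translates (leb R n.+1) (cube x0 eps) (cst (u x0)) rowt u.
have gh1 : for_case c (fun l => good M A p l h1).
  apply: for_case_scale Xf => [|l l0 Xl]; first exact: (ltr0n R 2).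
  have l20 : 0 < 2 * l by rewrite mulr_gt0.
  have [K K0 HK] := X_set_wder wM wA p1 partE l0 Xl.
  apply: (good_cube_average wM wA p1 _ _ eps0 l20 K0 su).
  by rewrite (_ : 2 * l / 2 = l)//; field.
have [l1 l10 gl1] := for_case_exists gh1.
have [sh1 _] := gl1.
have ch1 : continuous h1 by exact: (@rsmooth_continuous _ _ [::]).
have h10 : 0 < h1 0.
  rewrite /h1 /translates.
  have e0 : 0 < u x0 ^+ 2 / 2 by rewrite divr_gt0// exprn_even_gt0.
  apply: (@lt_le_trans _ _ (u x0 ^+ 2 / 2 * eps ^+ n.+1)).
    by rewrite mulr_gt0// exprn_gt0.
  have pos t : cube x0 eps t -> u x0 ^+ 2 / 2 <= cst (u x0) t * u (0 + rowt t).
    by move=> xt; rewrite add0r Heps// cube_close.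
  apply: (Rintegral_ge_on (B := cube x0 eps)) => //.
  - exact: measurable_cube.
  - exact: measurable_cube.
  - apply: measurable_bounded_integrable.
    + exact: measurable_cube.
    + apply: (@le_lt_trans _ _ (eps ^+ n.+1)%:E); last exact: ltry.
      by have /eqP := leb_cube x0 eps0; rewrite eq_le => /andP[].
    + apply: measurable_funTS; apply: measurable_funM => //.
      under eq_fun do rewrite add0r; exact: measurable_rowt.
    + have [C HC] := continuous_bounded (eps + `|x0|) cu.
      exists (`|u x0| * C); split; first exact: num_real.
      move=> K CK t xt /=; rewrite normrM (le_trans _ (ltW CK))// ler_wpM2l// HC//.
      by rewrite add0r -(subrK x0 (rowt t)) (le_trans (ler_normD _ _))// lerD2r cube_close.
  - by move=> t /pos; apply: le_trans; exact: ltW.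
  - exact: ltW.
  - by have /eqP := leb_cube x0 eps0; rewrite eq_le => /andP[].
pose k x := h1 x * h1 x.
have gk : for_case c (fun l => good M A p l k).
  apply: for_case_scale gh1 => [|l l0]; first exact: (ltr0n R 4).
  exact: good_sqr.
have gh : for_case c (fun l => good M A p l (period_average k)).
  apply: for_case_scale gk => [|l l0 gl]; first exact: (ltr0n R 2).
  apply: good_period_average; first by rewrite mulr_gt0.
  by rewrite (_ : 2 * l / 2 = l)//; field.
have sk : rsmooth k by have [l _ []] := for_case_exists gk.
have bk s : exists C : R, forall x, `|rpartial s k x| <= C.
  have [l l0 gl] := for_case_exists gk.
  have [C _ HC] := good_norm_le wM wA l0 gl.
  by exists (C * (l ^+ size s * M (size s))).
exists (period_average k), k; split=> //.
- move=> x; apply: Rintegral_ge0 => t _; rewrite mul1r /k -expr2; exact: sqr_ge0.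
- have k0 : 0 < k 0 by rewrite mulr_gt0.
  have ck : continuous k by exact: (@rsmooth_continuous _ _ [::]).
  have [d d0 Hd] := continuous_same_sign ck (lt0r_neq0 k0).
  pose d' := Num.min d (2 * pi).
  have d'0 : 0 < d' by rewrite lt_min d0.
  apply: (@lt_le_trans _ _ (k 0 / 2 * d')); first by rewrite !mulr_gt0// invr_gt0.
  have mud : (d'%:E <= mu `[0%R, d']%classic)%E.
    by rewrite /mu lebesgue_measure_itv/= lte_fin d'0 oppr0 adde0.
  rewrite /period_average /translates.
  have := @Rintegral_ge_on R _ _ mu `[0, 2 * pi]%classic `[0, d']%classic
    (fun t => cst 1 t * k (0 + t *: e0)) (k 0 / 2) d'.
  apply => //.
  - by apply: subset_itvl; rewrite bnd_simp ge_min lexx orbT.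
  - under [X in EFin \o X]eq_fun do rewrite mul1r.
    exact: integrable_period_average.
  - by move=> t _; rewrite mul1r /k -expr2; exact: sqr_ge0.
  - by rewrite ltW// divr_gt0.
  - move=> t; rewrite /= in_itv/= le_min => /and3P[t0 td _].
    have td' : `|t *: e0 - 0| <= d.
      by rewrite subr0 (le_trans (norm_se0 t))// ger0_norm.
    by have := Hd _ td'; rewrite mul1r add0r expr2 -mulrA ler_pM2l.
- move=> x; exact: derive_period_average.
Qed.

End Test_function.

(** * Integrals on lines *)

Section Line_integrals.
Context {R : realType}.
Implicit Types (f F K H : R -> R).
Local Notation mu := (@lebesgue_measure R).

(** A class of functions on which integration by parts on the whole line has no
    boundary terms. *)
Definition decays f : Prop := continuous f /\
  exists C : R, forall s, `|f s| <= C * (oneDsqr s)^-1.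

Lemma integrable_oneDsqrV :
  mu.-integrable setT (EFin \o (fun s : R => (oneDsqr s)^-1)).
Proof.
apply/integrableP; split.
  apply/measurable_EFinP; apply: continuous_measurable_fun.
  exact: continuous_oneDsqrV.
have -> : (\int[mu]_s `|(EFin \o (fun s : R => (oneDsqr s)^-1)%R) s| =
    \int[mu]_s ((oneDsqr s)^-1)%:E)%E.
  by apply: eq_integral => s _ /=; rewrite ger0_norm.
rewrite (@ge0_symfun_integralT _ (fun s : R => (oneDsqr s)^-1))//.
- have -> : [set x : R | 0 <= x] = `[0, +oo[%classic.
    by apply/seteqP; split=> x /=; rewrite in_itv/= andbT.
  by rewrite integral0y_oneDsqr -EFinM ltry.
- exact: continuous_oneDsqrV.
- by move=> s; rewrite /= /oneDsqr sqrrN.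
Qed.

Lemma decays_measurable f : decays f -> measurable_fun setT f.
Proof. by case=> cf _; exact: continuous_measurable_fun. Qed.

Lemma decays_integrable f : decays f -> mu.-integrable setT (EFin \o f).
Proof.
move=> df; have [cf [C HC]] := df.
apply: (le_integrable _ _ _ (integrableZl _ C integrable_oneDsqrV)) => //.
  by apply/measurable_EFinP; exact: decays_measurable.
move=> s _ /=; rewrite lee_fin (le_trans (HC s))//.
exact: ler_norm.
Qed.

Lemma decays_mul_bounded f (g : R -> R) : decays f -> continuous g ->
  (exists C : R, forall s, `|g s| <= C) -> decays (fun s => f s * g s).
Proof.
move=> [cf [C HC]] cg [D HD]; split.
  by move=> s; exact: (continuousM (cf s) (cg s)).
exists (C * D) => s; rewrite normrM mulrAC; apply: ler_pM => //.
Qed.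

Lemma decaysD f (g : R -> R) : decays f -> decays g -> decays (fun s => f s + g s).
Proof.
move=> [cf [C HC]] [cg [D HD]]; split.
  by move=> s; exact: (continuousD (cf s) (cg s)).
by exists (C + D) => s; rewrite (le_trans (ler_normD _ _))// mulrDl lerD.
Qed.

Lemma decays_cvg0 f (u : nat -> R) : decays f -> (forall k, k%:R <= `|u k|) ->
  f (u k) @[k --> \oo] --> 0.
Proof.
move=> [_ [C HC]] uk; have C0 : 0 <= C.
  have := HC 0; rewrite -ler_pdivrMr ?invr_gt0//; apply: le_trans.
  by rewrite divr_ge0.
have kk (m : nat) : (m%:R : R) <= m%:R ^+ 2.
  by rewrite -natrX ler_nat; case: m => // m; rewrite leq_pmulr.
apply/cvgr0Pnorm_lt => e e0; near=> k.
apply: (@le_lt_trans _ _ (C / (1 + k%:R))).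
  rewrite (le_trans (HC _))// ler_wpM2l// lef_pV2 ?posrE ?ltr_wpDr ?sqr_ge0//.
  rewrite /oneDsqr lerD2l -real_normK ?num_real// (le_trans (kk k))//.
  by rewrite lerXn2r// nnegrE.
rewrite ltr_pdivrMr ?ltr_wpDr// mulrC -ltr_pdivrMr//.
rewrite (lt_le_trans (truncnS_gt _))// -natr1 addrC lerD2l ler_nat.
by near: k; exact: nbhs_infty_ge.
Unshelve. all: end_near. Qed.

Lemma integral_derive_eq0 F f : (forall s : R, is_derive s (1 : R) F (f s)) ->
  decays F -> decays f -> \int[mu]_s f s = 0.
Proof.
move=> dF decF decf; have [cf _] := decf.
have cF : continuous F by have [] := decF.
pose g k (s : R) : \bar R := ((f \_ `[- k.+1%:R, k.+1%:R]) s)%:E.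
have gE k : (\int[mu]_s g k s = (F k.+1%:R)%:E - (F (- k.+1%:R))%:E)%E.
  rewrite -(@continuous_FTC2 R f F); last 4 first.
  - by rewrite gt0_cp.
  - exact: continuous_subspaceT.
  - split.
    + by move=> t _; have [] := dF t.
    + by apply: cvg_at_right_filter; exact: cF.
    + by apply: cvg_at_left_filter; exact: cF.
  - by move=> t _; rewrite derive1E; have [_ ->] := dF t.
  by rewrite [RHS]integral_mkcond; apply: eq_integral => s _; rewrite /g !patchE; case: ifP.
have lim0 : (\int[mu]_s g k s @[k --> \oo] --> 0)%E.
  under eq_fun do rewrite gE.
  suff : ((F k.+1%:R)%:E - (F (- k.+1%:R))%:E @[k --> \oo] --> 0 - 0)%E.
    by rewrite sube0.
  apply: cvgeB => //.
    apply: cvg_EFin; first exact: nearW.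
    apply: (@decays_cvg0 F (fun k => k.+1%:R)) => // k.
    by rewrite ger0_norm// ler_nat.
  apply: cvg_EFin; first exact: nearW.
  apply: (@decays_cvg0 F (fun k => - k.+1%:R)) => // k.
  by rewrite normrN ger0_norm// ler_nat.
have limf : (\int[mu]_s g k s @[k --> \oo] --> \int[mu]_s (f s)%:E)%E.
  apply: (@dominated_cvg _ _ _ mu _ measurableT g (fun s => (f s)%:E) (fun s => `|f s|%:E)) => //.
  - move=> k; apply/measurable_EFinP.
    apply/(measurable_restrictT _ _).1 => //.
    by apply: measurable_funTS; exact: decays_measurable.
  - move=> s _; apply: cvg_near_cst; near=> k; rewrite /g patchE ifT//.
    rewrite inE/= in_itv/= -ler_norml.
    rewrite (le_trans (ltW (truncnS_gt _)))// ler_nat ltnS.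
    by near: k; exact: nbhs_infty_ge.
  - exact: integrable_norm (decays_integrable decf).
  - by move=> k s _; rewrite lee_fin /g patchE; case: ifP; rewrite ?normr0.
have : (\int[mu]_s (f s)%:E = 0)%E.
  exact: (cvg_unique _ limf lim0).
by rewrite /Rintegral => ->.
Unshelve. all: end_near. Qed.

Lemma decays_shift f (c : R) : decays f -> decays (fun s => f (s + c)).
Proof.
move=> [cf [C HC]]; have C0 : 0 <= C.
  have := HC 0; rewrite -ler_pdivrMr ?invr_gt0//; apply: le_trans.
  by rewrite divr_ge0.
split.
  move=> s; apply: (@continuous_comp _ _ _ (fun s => s + c) f); last exact: cf.
  exact: (continuousD (@cvg_id _ _) (@cst_continuous _ _ c s)).
exists (C * (2 * (1 + c ^+ 2))) => s; rewrite (le_trans (HC _))// -mulrA ler_wpM2l//.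
rewrite ler_pdivlMr// mulrC ler_pdivrMr// /oneDsqr.
by have := sqr_ge0 c; have := sqr_ge0 (s + 2 * c); have := sqr_ge0 (c * (s + c)); nra.
Qed.

Lemma Rintegral_shift f (c : R) : decays f ->
  \int[mu]_s f (s + c) = \int[mu]_s f s.
Proof.
move=> df; have mf := decays_measurable df; have intf := decays_integrable df.
rewrite /Rintegral; congr fine.
have ms := measurable_shift c.
transitivity (\int[pushforward mu (fun x : measurableTypeR R => (x + c)%R : measurableTypeR R)]_x (f x)%:E)%E.
  rewrite (integral_pushforward ms)//.
  - exact/measurable_EFinP.
  - by rewrite preimage_setT; exact: decays_integrable (decays_shift c df).
by apply: eq_measure_integral => //= A mA _; exact: lebesgue_measure_shift.
Qed.

Lemma is_derive_cos_affine (t b s : R) :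
  is_derive s (1 : R) (fun s => cos (t * s + b)) (t * cos (t * s + b + pi / 2)).
Proof.
have d1 : is_derive s (1 : R) (fun s => t * s + b) t.
  have := is_deriveD (is_deriveZ t (is_derive_id s (1 : R))) (is_derive_cst b s (1 : R)).
  by rewrite addr0 [_ *: _]mulr1.
have := @is_derive1_comp R cos (fun s => t * s + b) s _ _ (is_derive_cos (t * s + b)) d1.
by rewrite cosDpihalf mulrC.
Qed.

Lemma continuous_cos_affine (t b : R) : continuous (fun s => cos (t * s + b)).
Proof.
move=> s; apply: differentiable_continuous; apply/derivable1_diffP.
by have [] := is_derive_cos_affine t b s.
Qed.

Lemma decays_cos f (t b : R) : decays f -> decays (fun s => f s * cos (t * s + b)).
Proof.
move=> df; apply: decays_mul_bounded => //; first exact: continuous_cos_affine.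
by exists 1 => s; rewrite ler_norml cos_geN1 cos_le1.
Qed.

Lemma decaysZ f (c : R) : decays f -> decays (fun s => c * f s).
Proof.
move=> df; rewrite (_ : (fun s => _) = (fun s => f s * cst c s)).
  by apply: decays_mul_bounded => //; [exact: cst_continuous|exists `|c|].
by apply/funext => s; rewrite mulrC.
Qed.

Lemma Rintegral_by_parts_cos F f (t b : R) :
  (forall s : R, is_derive s (1 : R) F (f s)) -> decays F -> decays f ->
  \int[mu]_s (f s * cos (t * s + b)) =
  - t * \int[mu]_s (F s * cos (t * s + (b + pi / 2))).
Proof.
move=> dF decF decf; have dfc := decays_cos t b decf.
have dFc : decays (fun s => t * (F s * cos (t * s + (b + pi / 2)))).
  exact/decaysZ/decays_cos.
have dd (s : R) : is_derive s (1 : R) (fun s => F s * cos (t * s + b))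
    (f s * cos (t * s + b) + t * (F s * cos (t * s + (b + pi / 2)))).
  have := is_deriveM (dF s) (is_derive_cos_affine t b s).
  rewrite /GRing.scale/= addrC => h; apply: is_derive_eq h _.
  by rewrite addrA; ring.
have := integral_derive_eq0 dd (decays_cos t b decF) (decaysD dfc dFc).
rewrite RintegralD//; try exact: decays_integrable.
rewrite RintegralZl//; last exact/decays_integrable/decays_cos.
by move=> /eqP; rewrite addr_eq0 mulNr => /eqP.
Qed.

Lemma Rintegral_iter_parts_cos (G : nat -> R -> R) (t b : R) (q : nat) :
  (forall q (s : R), is_derive s (1 : R) (G q) (G q.+1 s)) ->
  (forall q, decays (G q)) ->
  \int[mu]_s (G q s * cos (t * s + b)) =
  (- t) ^+ q * \int[mu]_s (G 0%N s * cos (t * s + (b + q%:R * (pi / 2)))).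
Proof.
move=> dG decG; elim: q b => [|q IH] b; first by rewrite expr0 mul1r mul0r addr0.
rewrite (Rintegral_by_parts_cos t b (dG q))// IH mulrA -exprS.
congr (_ * _); apply: eq_Rintegral => s _; congr (_ * cos (_ + _)).
by rewrite -natr1; ring.
Qed.

(** The phase is chosen so that [q] integrations by parts lead to a cosine. *)
Lemma le_Rintegral_derive (G : nat -> R -> R) (t : R) (q : nat) : 0 <= t ->
  (forall q (s : R), is_derive s (1 : R) (G q) (G q.+1 s)) ->
  (forall q, decays (G q)) ->
  t ^+ q * \int[mu]_s (G 0%N s * cos (t * s)) <= \int[mu]_s `|G q s|.
Proof.
move=> t0 dG decG.
have := Rintegral_iter_parts_cos t (- (q%:R * (pi / 2))) q dG decG.
rewrite addNr; under [in RHS]eq_Rintegral do rewrite addr0.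
set I := \int[mu]_s (G 0%N s * _) => E.
apply: (@le_trans _ _ `|(- t) ^+ q * I|).
  by rewrite normrM normrX normrN (ger0_norm t0) ler_wpM2l ?exprn_ge0// ler_norm.
rewrite -E.
have dq := decays_cos t (- (q%:R * (pi / 2))) (decG q).
rewrite (le_trans (le_normr_Rintegral _ (decays_integrable dq)))//.
have dn f : decays f -> mu.-integrable setT (EFin \o (fun s => `|f s|)).
  by move=> df; exact: integrable_norm (decays_integrable df).
apply: le_Rintegral => //; [exact: dn|exact: dn|] => s _.
by rewrite normrM ler_piMr// ler_norml cos_geN1 cos_le1.
Qed.

Section Period.
Variables H K : R -> R.
Hypothesis dH : forall s : R, is_derive s (1 : R) H (K (s + 2 * pi) - K s).
Hypotheses (decH : decays H) (decK : decays K).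

Lemma cos_period (m : nat) (b s : R) :
  cos (m%:R * (s + 2 * pi) + b) = cos (m%:R * s + b).
Proof.
have -> : m%:R * (s + 2 * pi) + b = (m%:R * s + b) + (pi *+ 2) *+ m.
  by rewrite -[_ *+ m]mulr_natl -[pi *+ 2]mulr_natl; ring.
exact: (periodicn (@cosD2pi R)).
Qed.

(** An integration by parts replaces [H] by its derivative, which is the
    difference of [K] and one of its translates by a period of the sine. *)
Lemma Rintegral_cos_eq0 (m : nat) : (0 < m)%N ->
  \int[mu]_s (H s * cos (m%:R * s)) = 0.
Proof.
move=> m0; have dK2 := decays_shift (2 * pi) decK.
have decdH : decays (fun s => K (s + 2 * pi) - K s).
  have := decaysD dK2 (decaysZ (-1) decK).
  by under [X in decays X -> _]eq_fun do rewrite mulN1r.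
have := Rintegral_by_parts_cos m%:R (- (pi / 2)) dH decH decdH.
under eq_Rintegral do rewrite mulrBl.
rewrite RintegralB//; try exact/decays_integrable/decays_cos.
have -> : \int[mu]_s (K (s + 2 * pi) * cos (m%:R * s + - (pi / 2))) =
    \int[mu]_s (K s * cos (m%:R * s + - (pi / 2))).
  rewrite -[RHS](Rintegral_shift (2 * pi)); last exact: decays_cos.
  by apply: eq_Rintegral => s _; rewrite cos_period.
rewrite subrr addNr; under [in X in _ = X -> _]eq_Rintegral do rewrite addr0.
by move=> /esym/eqP; rewrite mulf_eq0 oppr_eq0 pnatr_eq0 gtn_eqF//= => /eqP.
Qed.

Hypothesis H0 : forall s, 0 <= H s.

Lemma Rintegral_cos_ge0 (m : nat) : 0 <= \int[mu]_s (H s * cos (m%:R * s)).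
Proof.
case: m => [|m]; last by rewrite Rintegral_cos_eq0.
apply: Rintegral_ge0 => s _; by rewrite mul0r cos0 mulr1.
Qed.

Lemma Rintegral_coscos (a b : nat) : (b <= a)%N ->
  \int[mu]_s (H s * (cos (a%:R * s) * cos (b%:R * s))) =
  2^-1 * (\int[mu]_s (H s * cos ((a - b)%:R * s)) +
          \int[mu]_s (H s * cos ((a + b)%:R * s))).
Proof.
move=> ba.
have dc (m : nat) : decays (fun s => H s * cos (m%:R * s)).
  have := decays_cos m%:R 0 decH.
  by under [X in decays X -> _]eq_fun do rewrite addr0.
rewrite -RintegralD//; try exact/decays_integrable/dc.
rewrite -RintegralZl//; last exact/decays_integrable/decaysD.
apply: eq_Rintegral => s _; rewrite natrB// natrD mulrBl mulrDl cosB cosD.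
move: (cos _) (cos _) (sin _) (sin _) (H s) => c1 c2 s1 s2 h; by field.
Qed.

(** Different frequencies do not interfere, since the cosines of the sum and of the
    difference integrate to nonnegative numbers. *)
Lemma Rintegral_coscos_ge0 (a b : nat) :
  0 <= \int[mu]_s (H s * (cos (a%:R * s) * cos (b%:R * s))).
Proof.
wlog ba : a b / (b <= a)%N.
  move=> wl; have [ba|/ltnW ab] := leqP b a; first exact: wl.
  by under eq_Rintegral do rewrite [cos _ * _]mulrC; exact: wl.
by rewrite Rintegral_coscos// mulr_ge0 ?invr_ge0 ?addr_ge0 ?Rintegral_cos_ge0.
Qed.

Lemma Rintegral_cossqr_ge (a : nat) :
  2^-1 * \int[mu]_s H s <= \int[mu]_s (H s * (cos (a%:R * s) * cos (a%:R * s))).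
Proof.
rewrite Rintegral_coscos// subnn ler_wpM2l ?invr_ge0//.
under [in X in _ <= X + _]eq_Rintegral do rewrite mul0r cos0 mulr1.
by rewrite lerDl Rintegral_cos_ge0.
Qed.

End Period.

End Line_integrals.

(** * Superpositions of modulations *)

Section Poisson.
Context {R : realType}.

(** Any finite measure charging every natural number would do: it turns series
    into integrals. *)
Definition poisson : probability nat R := poisson_prob (1 : R) 0%N.

Lemma poisson_pmf_gt0 k : 0 < poisson_pmf (1 : R) k.
Proof.
by rewrite /poisson_pmf ltr01 mulr_gt0 ?expR_gt0// expr1n mul1r invr_gt0 ltr0n fact_gt0.
Qed.

Lemma poisson_set1 k : poisson [set k] = (poisson_pmf (1 : R) k)%:E.
Proof.
rewrite -[LHS]/(poisson_prob (1 : R) 0%N [set k]) /poisson_prob ltr01 esum_set1//.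
by rewrite lee_fin poisson_pmf_ge0.
Qed.

Lemma measurable_fun_nat (f : nat -> R) : measurable_fun setT f.
Proof. by []. Qed.

Lemma poisson_bounded_integrable (f : nat -> R) (C : R) :
  (forall j, `|f j| <= C) -> poisson.-integrable setT (EFin \o f).
Proof.
move=> fC; apply: measurable_bounded_integrable => //.
  by apply: (@le_lt_trans _ _ 1%E); [exact: probability_le1|exact: ltry].
exists C; split; first exact: num_real.
by move=> K CK j _ /=; rewrite (le_trans (fC j))// ltW.
Qed.

End Poisson.

Section Modulation.
Context {R : realType} {n : nat}.
Local Notation e i := (delta_mx ord0 i : 'rV[R]_n.+1).

Lemma is_derive_of_line (v : 'rV[R]_n.+1 -> R) x w (d : R) :
  is_derive (0 : R) (1 : R) (fun r : R => v (x + r *: w)) d -> is_derive x w v d.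
Proof.
move=> [dv <-].
have E : (fun h : R => h^-1 *: (v (h *: w + x) - v x)) =
  (fun h : R => h^-1 *: (v (x + (h *: (1 : R) + 0) *: w) - v (x + 0 *: w))).
  apply/funext => h; rewrite addr0 scale0r addr0 [h *: (1 : R)]mulr1.
  by rewrite (addrC x).
by apply: DeriveDef; rewrite /derivable /derive E.
Qed.

Lemma is_derive_cos_coord (a t b : R) (i : 'I_n.+1) (x : 'rV[R]_n.+1) :
  is_derive x (e i) (fun x : 'rV[R]_n.+1 => a * cos (t * x ord0 ord0 + b))
    (if i == ord0 then a * t * cos (t * x ord0 ord0 + (b + pi / 2)) else 0).
Proof.
apply: is_derive_of_line; case: eqVneq => [->|i0].
  rewrite (_ : (fun _ => _) = a \*: (fun r : R => cos (t * r + (t * x ord0 ord0 + b)))).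
    have := is_deriveZ a (is_derive_cos_affine t (t * x ord0 ord0 + b) 0).
    by rewrite mulr0 add0r /GRing.scale/= mulrA addrA.
  apply/funext => r; rewrite /= !mxE eqxx/= mulr1 /GRing.scale/=.
  by congr (_ * cos _); ring.
rewrite (_ : (fun _ => _) = cst (a * cos (t * x ord0 ord0 + b))).
  exact: is_derive_cst.
apply/funext => r; rewrite /= !mxE eqxx/= eq_sym (negbTE i0).
by rewrite mulr0 addr0.
Qed.

Lemma rpartial_cos (s : seq 'I_n.+1) (a t : R) :
  rpartial s (fun x : 'rV[R]_n.+1 => a * cos (t * x ord0 ord0)) =
  fun x => if all (pred1 ord0) s
    then a * t ^+ size s * cos (t * x ord0 ord0 + (size s)%:R * (pi / 2)) else 0.
Proof.
elim: s => [|i s IH].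
  by apply/funext => x; rewrite /= mul0r addr0 expr0 mulr1.
rewrite [LHS]/= -/(rpartial _ _) IH; apply/funext => x /=.
case: (all _ s) => /=; last by rewrite andbF; exact: derive_cst.
have [_ ->] := is_derive_cos_coord (a * t ^+ size s) t ((size s)%:R * (pi / 2)) i x.
rewrite andbT; case: eqP => // _; rewrite exprSr mulrA -natr1.
by congr (_ * cos (_ + _)); ring.
Qed.

Lemma rsmooth_cos (a t : R) :
  rsmooth (fun x : 'rV[R]_n.+1 => a * cos (t * x ord0 ord0)).
Proof.
move=> s; rewrite rpartial_cos; split; last first.
  move=> i x; case: (all _ s); last exact: derivable_cst.
  by have [] := is_derive_cos_coord (a * t ^+ size s) t ((size s)%:R * (pi / 2)) i x.
case: (all _ s); last exact: cst_continuous.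
move=> x; set b := _ * (pi / 2); set c := a * _.
have cc : {for x, continuous ((fun s : R => cos (t * s + b)) \o (fun x : 'rV[R]_n.+1 => x ord0 ord0))}.
  by apply: continuous_comp; [exact: coord_continuous|exact: continuous_cos_affine].
exact: (continuousM (@cst_continuous _ _ c x) cc).
Qed.

Lemma norm_rpartial_cos (s : seq 'I_n.+1) (a t : R) x : 0 <= a -> 0 <= t ->
  `|rpartial s (fun x : 'rV[R]_n.+1 => a * cos (t * x ord0 ord0)) x| <= a * t ^+ size s.
Proof.
move=> a0 t0; have at0 : 0 <= a * t ^+ size s by rewrite mulr_ge0 ?exprn_ge0.
rewrite rpartial_cos; case: (all _ s); last by rewrite normr0.
by rewrite normrM ger0_norm// ler_piMr// ler_norml cos_geN1 cos_le1.
Qed.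

Section Theta.
Variables (M : nat -> R) (c : nat -> R) (t : nat -> nat).
Hypothesis c0 : forall j, 0 < c j.
Hypothesis ct : forall l : R, 0 < l -> exists2 C : R, 0 < C &
  forall j s, c j * (t j)%:R ^+ s <= C * l ^+ s * M s.

Definition cos_series (x : 'rV[R]_n.+1) : R :=
  \int[poisson]_j (c j * cos ((t j)%:R * x ord0 ord0)).

Let U j (x : 'rV[R]_n.+1) := c j * cos ((t j)%:R * x ord0 ord0).

Let sU j : setT j -> rsmooth (U j). Proof. by move=> _; exact: rsmooth_cos. Qed.

Let mU (s : seq 'I_n.+1) (x : 'rV[R]_n.+1) :
  measurable_fun setT (fun j => rpartial s (U j) x).
Proof. exact: measurable_fun_nat. Qed.

Let bU1 (l : R) : 0 < l -> exists2 C : R, 0 <= C & forall (s : seq 'I_n.+1) j x,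
  `|rpartial s (U j) x| <= C * (l ^+ size s * M (size s)).
Proof.
move=> /ct[C C0 HC]; exists C; first exact: ltW.
move=> s j x; apply: (le_trans (norm_rpartial_cos s x (ltW (c0 j)) (ler0n R (t j)))).
by rewrite mulrA.
Qed.

Let bU (s : seq 'I_n.+1) (x : 'rV[R]_n.+1) : exists C : R,
  forall j (y : 'rV[R]_n.+1), setT j -> ball x 1 y -> `|rpartial s (U j) y| <= C.
Proof.
have [C C0 HC] := bU1 ltr01; exists (C * (1 ^+ size s * M (size s))) => j y _ _.
exact: HC.
Qed.

Let finP : (@poisson R setT < +oo)%E.
Proof. by rewrite probability_setT ltry. Qed.

Lemma rsmooth_cos_series : rsmooth cos_series.
Proof. exact: (rsmooth_superposition (mu := @poisson R) measurableT finP sU mU bU). Qed.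

Lemma cos_series_bound (l : R) : 0 < l -> exists C : R, forall s x,
  `|rpartial s cos_series x| <= C * (l ^+ size s * M (size s)).
Proof.
move=> /bU1[C C0 HC]; exists C => s x.
rewrite (rpartial_superposition (mu := @poisson R) measurableT finP sU mU bU).
have ii := integrable_superposition (mu := @poisson R) measurableT finP mU bU s x.
rewrite (le_trans (le_normr_Rintegral _ ii))//.
apply: (@le_trans _ _ (\int[poisson]_j (cst (C * (l ^+ size s * M (size s))) j))).
  apply: le_Rintegral => //.
  - exact: integrable_norm ii.
  - exact: finite_measure_integrable_cst.
by rewrite Rintegral_cst// [X in fine X]probability_setT mulr1.
Qed.

End Theta.

End Modulation.

(** * Lower bounds along lines *)

Section Lines.
Context {R : realType} {n : nat}.
Context {M A : nat -> R} {p : \bar R}.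
Hypotheses (wM : weight_seq M) (wA : weight_seq A).
Local Notation e0 := (delta_mx ord0 ord0 : 'rV[R]_n.+1).
Local Notation mu := (@lebesgue_measure R).

Lemma oneDsqr_le_growth (a : nat -> R) l (x : 'rV[R]_n.+1) : weight_seq a -> 0 < l ->
  oneDsqr (x ord0 ord0) <= (1 + l ^+ 2 * a 2%N) * growth a (`|x| / l).
Proof.
move=> wa l0; have [apos _ _] := wa.
have r0 : 0 <= `|x| / l by rewrite divr_ge0// ltW.
rewrite mulrDl mul1r lerD ?growth_ge1//.
rewrite -ler_pdivrMl ?mulr_gt0 ?exprn_gt0// (le_trans _ (growth_ub wa 2 r0))//.
rewrite invfM mulrC expr_div_n mulrA ler_pM2r ?invr_gt0//.
rewrite ler_pM2r ?invr_gt0 ?exprn_gt0//.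
have x0 : `|x ord0 ord0| <= `|x|.
  rewrite -[leRHS]/(mx_norm _) mx_normrE.
  exact: (le_bigmax _ (fun ij : 'I_1 * 'I_n.+1 => `|x ij.1 ij.2|) (ord0, ord0)).
by rewrite -real_normK ?num_real// lerXn2r// nnegrE.
Qed.

Lemma line_coord0 (y : 'rV[R]_n.+1) (r : R) : y ord0 ord0 = 0 ->
  (y + r *: e0) ord0 ord0 = r.
Proof. by move=> y0; rewrite !mxE y0 eqxx mulr1 add0r. Qed.

Lemma good_decays l v s (y : 'rV[R]_n.+1) : 0 < l -> good M A p l v ->
  y ord0 ord0 = 0 -> decays (fun r => rpartial s v (y + r *: e0)).
Proof.
move=> l0 gv y0; have [sv _] := gv; split.
  move=> r; apply: (@continuous_comp _ _ _ (fun r : R => y + r *: e0)); last first.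
    exact: rsmooth_continuous.
  apply: (continuousD (@cst_continuous _ _ y r)).
  exact: (continuousZ (@cvg_id _ _) (@cst_continuous _ _ e0 r)).
have [C C0 HC] := good_bounded wM wA l0 gv.
exists (C * (l ^+ size s * M (size s)) * (1 + l ^+ 2 * A 2%N)) => r.
rewrite ler_pdivlMr//; set x := y + r *: e0.
have := oneDsqr_le_growth x wA l0; rewrite line_coord0// => h.
apply: (@le_trans _ _ (`|rpartial s v x| * ((1 + l ^+ 2 * A 2%N) * growth A (`|x| / l)))).
  by rewrite ler_wpM2l.
have [Apos _ _] := wA.
rewrite mulrCA [leRHS]mulrC ler_wpM2l// addr_ge0// mulr_ge0 ?exprn_ge0 ?(ltW l0)//.
by rewrite ltW.
Qed.

Lemma is_derive_rpartial_line (v : 'rV[R]_n.+1 -> R) (y : 'rV[R]_n.+1) q (s : R) :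
  rsmooth v -> is_derive s (1 : R) (fun s => rpartial (nseq q ord0) v (y + s *: e0))
    (rpartial (nseq q.+1 ord0) v (y + s *: e0)).
Proof. by move=> sv; apply: is_derive_line; exact: rsmooth_derivable. Qed.

Section Frequency.
Variables (c : nat -> R) (t : nat -> nat) (C0 : R).
Hypothesis c0 : forall j, 0 < c j.
Hypothesis cC : forall j, c j <= C0.
Variables H K : R -> R.
Hypothesis dH : forall s : R, is_derive s (1 : R) H (K (s + 2 * pi) - K s).
Hypotheses (decH : decays H) (decK : decays K) (H0 : forall s, 0 <= H s).

Let F (m : nat) (sj : R * nat) : R :=
  c sj.2 * (H sj.1 * (cos ((t sj.2)%:R * sj.1) * cos (m%:R * sj.1))).

Let normF m sj : `|F m sj| <= C0 * H sj.1.
Proof.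
rewrite /F !normrM (ger0_norm (ltW (c0 _))) (ger0_norm (H0 _)).
rewrite ler_pM ?mulr_ge0 ?normr_ge0 ?(ltW (c0 _))// ler_piMr//.
by rewrite mulr_ile1// ler_norml cos_geN1 cos_le1.
Qed.

Let mF m : measurable_fun [set: measurableTypeR R * nat] (F m).
Proof.
apply: measurable_funM.
  by apply: (measurableT_comp (measurable_fun_nat c)); exact: measurable_snd.
apply: measurable_funM.
  apply: (measurableT_comp (decays_measurable decH)); exact: measurable_fst.
have mcos : measurable_fun setT (@cos R).
  by apply: continuous_measurable_fun; exact: continuous_cos.
have mt : measurable_fun [set: measurableTypeR R * nat] (fun sj => (t sj.2)%:R : R).
  by apply: (measurableT_comp (measurable_fun_nat (fun j => (t j)%:R : R))); exact: measurable_snd.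
apply: measurable_funM.
  by apply: (measurableT_comp mcos); apply: measurable_funM => //; exact: measurable_fst.
apply: (measurableT_comp mcos); apply: (@measurable_funM _ _ _ _ (cst m%:R)) => //.
Qed.

Let decF m j : decays (fun s => F m (s, j)).
Proof.
have := decaysZ (c j) (decays_cos m%:R 0 (decays_cos (t j)%:R 0 decH)).
rewrite (_ : (fun s => c j * _) = (fun s => F m (s, j)))//.
by apply/funext => s; rewrite /F/= !addr0 (mulrA (H s)).
Qed.

Lemma Rintegral_cos_superposition (m : nat) :
  \int[mu]_s (\int[poisson]_j (c j * cos ((t j)%:R * s)) * H s * cos (m%:R * s)) =
  \int[poisson]_j (c j * \int[mu]_s (H s * (cos ((t j)%:R * s) * cos (m%:R * s)))).
Proof.
have Cge0 : 0 <= C0 by rewrite (le_trans _ (cC 0))// ltW.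
have intFs s : (@poisson R).-integrable setT (EFin \o (fun j => F m (s, j))).
  apply: (@poisson_bounded_integrable _ _ (C0 * H s)) => j; exact: normF.
have intF : (mu \x (@poisson R))%E.-integrable setT (EFin \o F m).
  apply/integrable12ltyP; first exact/measurable_EFinP.
  apply: (@le_lt_trans _ _ (\int[mu]_s (C0 * H s)%:E)%E); last first.
    have /integrableP[_] := decays_integrable (decaysZ C0 decH).
    rewrite (_ : (\int[mu]_s `|_|)%E = (\int[mu]_s (C0 * H s)%:E)%E)//.
    by apply: eq_integral => s _ /=; rewrite ger0_norm ?mulr_ge0.
  apply: ge0_le_integral => //.
  - by move=> s _; apply: integral_ge0.
  - apply: (measurable_fun_fubini_tonelli_F (m2 := @poisson R) (fun sj => `|(F m sj)%:E|%E)) => //.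
    apply: measurableT_comp => //; apply/measurable_EFinP; exact: mF.
  - apply/measurable_EFinP; exact: decays_measurable (decaysZ C0 decH).
  move=> s _; apply: (@le_trans _ _ (\int[poisson]_j (cst (C0 * H s)%:E j))%E).
    apply: ge0_le_integral => //.
    by move=> j _; rewrite lee_fin; exact: (normF m (s, j)).
  by rewrite integral_cst// [X in (_ * X)%E]probability_setT mule1.
have eL : \int[mu]_s (\int[poisson]_j (c j * cos ((t j)%:R * s)) * H s * cos (m%:R * s)) =
    fine (\int[mu]_s \int[poisson]_j (EFin \o F m) (s, j))%E.
  congr fine; apply: eq_integral => s _.
  rewrite -[RHS]fineK; last exact: integrable_fin_num (intFs s).
  congr (_%:E); rewrite -[RHS]/(\int[poisson]_j (F m (s, j))).
  rewrite -mulrA -RintegralZr//; last first.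
    apply: (@poisson_bounded_integrable _ _ C0) => j.
    rewrite normrM (ger0_norm (ltW (c0 j))).
    rewrite (le_trans _ (cC j))// ler_piMr ?(ltW (c0 j))//.
    by rewrite ler_norml cos_geN1 cos_le1.
  by apply: eq_Rintegral => j _; rewrite /F/=; ring.
have eR : \int[poisson]_j (c j * \int[mu]_s (H s * (cos ((t j)%:R * s) * cos (m%:R * s)))) =
    fine (\int[poisson]_j \int[mu]_s (EFin \o F m) (s, j))%E.
  congr fine; apply: eq_integral => j _.
  rewrite -[RHS]fineK; last exact: integrable_fin_num (decays_integrable (decF m j)).
  congr (_%:E); rewrite -[RHS]/(\int[mu]_s (F m (s, j))) -RintegralZl//.
  have := decays_integrable (decays_cos m%:R 0 (decays_cos (t j)%:R 0 decH)).
  rewrite (_ : (fun s => _) = (fun s => H s * (cos ((t j)%:R * s) * cos (m%:R * s))))//.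
  by apply/funext => s; rewrite !addr0 mulrA.
by rewrite eL eR; congr fine; exact: (Fubini intF).
Qed.

(** All the terms are nonnegative, so the one of index [j] bounds the sum. *)
Lemma Rintegral_cos_superposition_ge (j : nat) :
  poisson_pmf 1 j * (c j * (2^-1 * \int[mu]_s H s)) <=
  \int[mu]_s (\int[poisson]_j (c j * cos ((t j)%:R * s)) * H s * cos ((t j)%:R * s)).
Proof.
rewrite Rintegral_cos_superposition.
pose I i := \int[mu]_s (H s * (cos ((t i)%:R * s) * cos ((t j)%:R * s))).
have I0 i : 0 <= I i by apply: (Rintegral_coscos_ge0 dH decH decK H0).
have IH i : I i <= \int[mu]_s H s.
  apply: le_Rintegral => //.
  - have := decays_integrable (decays_cos (t j)%:R 0 (decays_cos (t i)%:R 0 decH)).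
    rewrite (_ : (fun s => _) = (fun s => H s * (cos ((t i)%:R * s) * cos ((t j)%:R * s))))//.
    by apply/funext => s; rewrite !addr0 mulrA.
  - exact: decays_integrable.
  by move=> s _; apply: ler_piMr.
have IHj : 2^-1 * \int[mu]_s H s <= I j by exact: (Rintegral_cossqr_ge dH decH decK H0).
rewrite mulrC; apply: (Rintegral_ge_on (mu := @poisson R) (B := [set j])) => //.
- apply: (@poisson_bounded_integrable _ _ (C0 * \int[mu]_s H s)) => i.
  by rewrite normrM (ger0_norm (ltW (c0 i))) (ger0_norm (I0 i)) ler_pM// ltW.
- by move=> i _; rewrite mulr_ge0 ?I0// ltW.
- by rewrite mulr_ge0 ?(ltW (c0 j))// mulr_ge0 ?invr_ge0// Rintegral_ge0.
- by move=> i ->; rewrite ler_wpM2l// ltW.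
- by have /eqP := poisson_set1 (R := R) j; rewrite eq_le => /andP[].
Qed.

End Frequency.

End Lines.

(** * Necessity of the domination *)

Section Necessity.
Context {R : realType} {n : nat}.
Context {M A N B : nat -> R} {p : \bar R} {c : limit_case}.
Hypotheses (wM : weight_seq M) (wA : weight_seq A).
Hypotheses (wN : weight_seq N) (wB : weight_seq B).
Hypotheses (lcM : log_convex_seq M) (lcA : log_convex_seq A).
Hypothesis p1 : (1 <= p)%E.
Local Notation MM := (isotropic n.+1 M).
Local Notation AA := (isotropic n.+1 A).
Local Notation NN := (isotropic n.+1 N).
Local Notation BB := (isotropic n.+1 B).
Local Notation e0 := (delta_mx ord0 ord0 : 'rV[R]_n.+1).
Local Notation mu := (@lebesgue_measure R).
Hypothesis incl : GS MM AA p c `<=` GS NN BB p c.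

Let supM := log_convex_supermul wM lcM.

Lemma image_bound (g : 'rV[R]_n.+1 -> R) : for_case c (fun l => good M A p l g) ->
  exists l K : R, [/\ 0 < l, 0 < K & forall s,
    (Lp_norm p (fun x => (wder N B l g s x)%:E) <= K%:E)%E].
Proof.
move=> gg; have Xg : GS NN BB p c (fun x => (g x)%:C%C).
  apply/incl/GS_for_case; apply: for_case_scale gg; first exact: ltr01.
  by move=> l l0 gl; rewrite mul1r; exact: good_X_set.
have /GS_for_case/for_case_exists[l l0 Xl] := Xg.
have [K K0 HK] := X_set_wder wN wB p1 (or_introl erefl) l0 Xl.
by exists l, K.
Qed.

(** Testing the norm against the indicator of a cube, as in [Lnorm_integral],
    treats all the exponents alike. *)
Lemma Lp_norm_cube (F : 'rV[R]_n.+1 -> R) (z : 'rV[R]_n.+1) (eps K k : R) :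
  0 < eps -> 0 < K -> 0 <= k -> coord_measurable F -> (forall x, 0 <= F x) ->
  (Lp_norm p (fun x => (F x)%:E) <= K%:E)%E ->
  (forall t, cube z eps t -> k <= F (rowt t)) ->
  k * eps ^+ n.+1 <= K * (eps ^+ n.+1 + 1).
Proof.
move=> eps0 K0 k0 mF F0 FK Fk.
have mFr : measurable_fun setT (fun t => F (rowt t)) by exact: coord_measurable_rowt.
pose psi (t : n.+1.-tuple (measurableTypeR R)) : R := \1_(cube z eps) t.
have psi01 t : 0 <= psi t <= 1.
  by rewrite /psi indicE; case: (_ \in _); rewrite ?lexx ?ler01.
have mpsi : measurable_fun setT psi.
  by apply: measurable_indic; exact: measurable_cube.
have psiE : (\int[leb R n.+1]_t (psi t)%:E = (eps ^+ n.+1)%:E)%E.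
  rewrite integral_indic//; last exact: measurable_cube.
  by rewrite setIT; exact: leb_cube.
have := Lnorm_integral p1 K0 mFr mpsi (fun t => F0 _) psi01 FK.
rewrite psiE -lee_fin EFinM => h; rewrite [leRHS]EFinM EFinD; apply: le_trans h.
rewrite -psiE -ge0_integralZl//; last 2 first.
- exact/measurable_EFinP.
- by move=> t _; rewrite lee_fin; have /andP[] := psi01 t.
apply: ge0_le_integral => //.
- by move=> t _; rewrite -EFinM lee_fin mulr_ge0//; have /andP[] := psi01 t.
- by apply/measurable_EFinP; exact: measurable_funM.
- by apply/measurable_EFinP; exact: measurable_funM.
move=> t _; rewrite -EFinM lee_fin /psi indicE.
have [tz|tz] := boolP (t \in cube z eps); rewrite ?mulr1 ?mulr0//.
by apply: Fk; exact: set_mem.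
Qed.

Lemma rowt_tuple_cons (x : R) (t : n.-tuple (measurableTypeR R)) :
  rowt (tuple_cons (x, t)) = rowt (tuple_cons (0, t)) + x *: e0.
Proof.
apply/rowP => i; rewrite !mxE eqxx/=; case: (unliftP ord0 i) => [j|] ->.
  by rewrite !tnth_tuple_consS mulr0 addr0.
by rewrite mulr1 add0r.
Qed.

(** The weight [oneDsqr^-1] is integrable along the first axis, so bounds for the
    integrals on the lines in that direction turn into a bound for the norm,
    whatever the exponent. *)
Lemma Lp_norm_lines (l : R) (v : 'rV[R]_n.+1 -> R) s (eps K L : R) :
  0 < l -> 0 < eps -> 0 < K -> rsmooth v -> 0 <= L ->
  (Lp_norm p (fun x => (wder N B l v s x)%:E) <= K%:E)%E ->
  (forall t, cube 0 eps t ->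
    (L%:E <= \int[mu]_x `|rpartial s v (rowt (tuple_cons (0, t)) + x *: e0)|%:E)%E) ->
  L * eps ^+ n <= (1 + l ^+ 2 * B 2%N) * (l ^+ size s * N (size s)) *
    (K * (fine (\int[mu]_x ((oneDsqr x)^-1)%:E)%E * eps ^+ n + 1)).
Proof.
move=> l0 eps0 K0 sv L0 vK vL; have [Bpos _ _] := wB; have [Npos _ _] := wN.
pose F x := wder N B l v s x.
pose ind (t : n.-tuple (measurableTypeR R)) : R := \1_(cube 0 eps) t.
have ind01 t : 0 <= ind t <= 1 by rewrite /ind indicE; case: (_ \in _); rewrite ?lexx ?ler01.
have mind : measurable_fun setT ind by apply: measurable_indic; exact: measurable_cube.
have indE : (\int[leb R n]_t (ind t)%:E = (eps ^+ n)%:E)%E.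
  rewrite integral_indic//; last exact: measurable_cube.
  by rewrite setIT; exact: leb_cube.
pose tl (t : n.+1.-tuple (measurableTypeR R)) := [tuple of behead t].
have tlE x t : tl (tuple_cons (x, t)) = t by exact: val_inj.
have mtl : measurable_fun setT tl by exact: measurable_behead.
pose psi (t : n.+1.-tuple (measurableTypeR R)) : R := (oneDsqr (tnth t ord0))^-1 * ind (tl t).
have mw : measurable_fun setT (fun x : R => (oneDsqr x)^-1).
  by apply: continuous_measurable_fun; exact: continuous_oneDsqrV.
have mpsi : measurable_fun setT psi.
  apply: measurable_funM; last exact: measurableT_comp mind mtl.
  by apply: (measurableT_comp mw); exact: measurable_tnth.
have oneDV1 (x : R) : (oneDsqr x)^-1 <= 1.
  by rewrite invf_le1// /oneDsqr lerDl sqr_ge0.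
have psi01 t : 0 <= psi t <= 1.
  have /andP[i0 i1] := ind01 (tl t).
  by rewrite /psi mulr_ge0//= mulr_ile1.
have mF : measurable_fun setT (fun t => F (rowt t)).
  exact: (coord_measurable_rowt (coord_measurable_wder wB s l0 sv)).
have F0 x : 0 <= F x by exact: (wder_ge0 wN wB _ _ _ l0).
set I := (\int[mu]_x ((oneDsqr x)^-1)%:E)%E.
have I0 : (0 <= I)%E by apply: integral_ge0 => x _; rewrite lee_fin.
have Ifin : I \is a fin_num.
  have /integrable_fin_num := @integrable_oneDsqrV R; exact.
have psiE : (\int[leb R n.+1]_t (psi t)%:E = I * (eps ^+ n)%:E)%E.
  rewrite integral_lebS; last 2 first.
  - exact/measurable_EFinP.
  - by move=> t; rewrite lee_fin; have /andP[] := psi01 t.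
  rewrite -indE -ge0_integralZl//; last 2 first.
  - exact/measurable_EFinP.
  - by move=> t _; rewrite lee_fin; have /andP[] := ind01 t.
  apply: eq_integral => t _; rewrite -ge0_integralZr//; last 2 first.
  - exact/measurable_EFinP.
  - by rewrite lee_fin; have /andP[] := ind01 t.
  by apply: eq_integral => x _; rewrite /psi tlE.
have := Lnorm_integral p1 K0 mF mpsi (fun t => F0 _) psi01 vK.
rewrite psiE => h.
set W := (1 + _) * _.
have W0 : 0 < W.
  by rewrite /W mulr_gt0 ?(wder_den_gt0 wN)// ltr_wpDr// mulr_ge0 ?exprn_ge0 ?(ltW l0) ?(ltW (Bpos _)).
have den0 := wder_den_gt0 wN s l0.
have mv : measurable_fun setT (fun t => `|rpartial s v (rowt t)| * ind (tl t)).
  apply: measurable_funM; last exact: measurableT_comp mind mtl.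
  apply: measurableT_comp => //.
  by apply: measurable_rowt; exact: rsmooth_continuous.
rewrite -lee_fin [leRHS]EFinM [X in (_ <= _ * X)%E]EFinM EFinD.
rewrite [in leRHS](EFinM (fine I)) fineK//.
apply: (@le_trans _ _ (W%:E * \int[leb R n.+1]_t (F (rowt t) * psi t)%:E)%E); last first.
  by rewrite lee_wpmul2l// lee_fin ltW.
rewrite -ge0_integralZl//; last 3 first.
- by apply/measurable_EFinP; exact: measurable_funM.
- by move=> t _; rewrite lee_fin mulr_ge0//; have /andP[] := psi01 t.
- by rewrite lee_fin ltW.
apply: (@le_trans _ _ (\int[leb R n.+1]_t (`|rpartial s v (rowt t)| * ind (tl t))%:E)%E); last first.
  apply: ge0_le_integral => //.
  - by move=> t _; rewrite lee_fin mulr_ge0//; have /andP[] := ind01 (tl t).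
  - exact/measurable_EFinP.
  - by apply/measurable_EFinP; apply: (@measurable_funM _ _ _ _ (cst W)) => //; exact: measurable_funM.
  move=> t _; rewrite -EFinM lee_fin /psi /F /wder !mulrA ler_wpM2r//.
  rewrite [leRHS](_ : _ = `|rpartial s v (rowt t)| *
      ((1 + l ^+ 2 * B 2%N) * growth B (`|rowt t| / l)) / oneDsqr (tnth t ord0)); last first.
    by rewrite /W; field; rewrite !gt_eqF ?exprn_gt0.
  rewrite ler_pdivlMr// ler_wpM2l//.
  by have := oneDsqr_le_growth (rowt t) wB l0; rewrite mxE.
rewrite integral_lebS; last 2 first.
- exact/measurable_EFinP.
- by move=> t; rewrite lee_fin mulr_ge0//; have /andP[] := ind01 (tl t).
rewrite EFinM -indE -ge0_integralZl//; last 2 first.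
- exact/measurable_EFinP.
- by move=> t _; rewrite lee_fin; have /andP[] := ind01 t.
have mvc : measurable_fun setT (fun xt =>
    (`|rpartial s v (rowt (tuple_cons xt))| * ind (tl (tuple_cons xt)))%:E).
  apply/measurable_EFinP; exact: (measurableT_comp mv (@measurable_tuple_cons R n)).
apply: ge0_le_integral => //.
- by move=> t _; rewrite -EFinM lee_fin mulr_ge0//; have /andP[] := ind01 t.
- by apply/measurable_EFinP; apply: (@measurable_funM _ _ _ _ (cst L)).
- apply: (measurable_fun_fubini_tonelli_G (m1 := mu) _ mvc) => z.
  by rewrite lee_fin mulr_ge0//; have /andP[] := ind01 (tl (tuple_cons z)).
move=> t _; rewrite -EFinM.
have [tz|tz] := boolP (t \in cube 0 eps); last first.
  rewrite [X in (L * X)%:E](_ : _ = 0); last by rewrite /ind indicE (negbTE tz).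
  rewrite mulr0; apply: integral_ge0 => x _.
  by rewrite lee_fin mulr_ge0//; have /andP[] := ind01 (tl (tuple_cons (x, t))).
rewrite [X in (L * X)%:E](_ : _ = 1); last by rewrite /ind indicE tz.
rewrite mulr1 (le_trans (vL t (set_mem tz)))// le_eqVlt; apply/orP; left; apply/eqP.
by apply: eq_integral => x _; rewrite tlE /ind indicE tz mulr1 (rowt_tuple_cons x).
Qed.

Section With_test_function.
Variables h k : 'rV[R]_n.+1 -> R.
Hypothesis gh : for_case c (fun l => good M A p l h).
Hypothesis gk : for_case c (fun l => good M A p l k).
Hypotheses (h0 : forall x, 0 <= h x) (h00 : 0 < h 0).
Hypothesis dh : forall x, 'D_e0 h x = k (x + (2 * pi) *: e0) - k x.

Let sh : rsmooth h. Proof. by have [l _ []] := for_case_exists gh. Qed.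

Let h_near0 : exists2 eps : R, 0 < eps & forall y, `|y| <= eps -> h 0 / 2 <= h y.
Proof.
have [eps eps0 Heps] :=
  continuous_same_sign (@rsmooth_continuous _ _ [::] h sh) (lt0r_neq0 h00).
exists eps => // y ye; have := Heps y; rewrite subr0 => /(_ ye).
by rewrite expr2 -mulrA ler_pM2l.
Qed.

(** If [A] is not dominated by [B], the points [t j] and amplitudes [a j] of
    [gap_sequences] make a superposition of the translates [h (x - t j e0)].
    The decay of [h] is shifted by [t j], which costs a factor of the order of
    [growth A (2 * t j / l)], compensated by [a j]; but near [t j e0] the sum is at
    least a multiple of [a j], too large for the weight [growth B]. *)
Lemma domination_translates :
  exists C H : R, [/\ 0 < C, 0 < H & forall q, A q <= C * H ^+ q * B q].
Proof.
apply: contrapT => nAB.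
have [a [t [q [a0 at_ gap]]]] := gap_sequences wA lcA wB poisson_pmf_gt0 nAB.
have [Bpos _ _] := wB; have [Apos _ _] := wA.
pose phi (j : nat) : 'rV[R]_n.+1 := - ((t j)%:R *: e0).
have mphi i : measurable_fun setT (fun j => phi j ord0 i) by exact: measurable_fun_nat.
have nphi j : `|phi j| <= (t j)%:R.
  by rewrite normrN normrZ ger0_norm// ler_piMr// norm_delta_le.
pose g := translates (@poisson R) setT a phi h.
have pois1 : (@poisson R setT <= 1%:E)%E by exact: probability_le1.
have agrowth l : 0 < l -> exists2 K : R, 0 <= K & forall j,
    `|a j| * growth A (2 * (`|phi j| / l)) <= K.
  move=> l0; have l20 : 0 < l / 2 by rewrite divr_gt0.
  have [C C0 HC] := at_ _ l20; exists C; first exact: ltW.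
  move=> j; rewrite (ger0_norm (ltW (a0 j))) mulrC -ler_pdivlMr//.
  apply: growth_le => s.
  rewrite ler_pdivrMr// mulrAC ler_pdivlMr// mulrC.
  have e : 2 * (`|phi j| / l) <= (t j)%:R / (l / 2).
    rewrite [leRHS](_ : _ = 2 * ((t j)%:R / l)); last by field; rewrite gt_eqF.
    by rewrite ler_pM2l// ler_pM2r ?invr_gt0.
  apply: (@le_trans _ _ (a j * ((t j)%:R / (l / 2)) ^+ s)).
    have n1 : 0 <= 2 * (`|phi j| / l) by rewrite mulr_ge0// divr_ge0// ltW.
    have n2 : 0 <= (t j)%:R / (l / 2) by rewrite divr_ge0// ltW.
    by rewrite ler_wpM2l ?(ltW (a0 j))// lerXn2r.
  rewrite expr_div_n mulrA ler_pdivrMr ?exprn_gt0// mulrAC.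
  exact: HC.
have gg : for_case c (fun l => good M A p l g).
  apply: for_case_scale gh => [|l l0 gl]; first exact: (ltr0n R 2).
  have l20 : 0 < 2 * l by rewrite mulr_gt0.
  have [K K0 HK] := agrowth _ l20.
  have gt := @good_translates R n M A p wM wA p1 _ _ (@poisson R) setT 1 a phi h
    (2 * l) K measurableT pois1 (measurable_fun_nat a) mphi l20 K0 (fun j _ => HK j).
  have e : 2 * l / 2 = l by field.
  by rewrite e in gt; exact: (gt gl).
have [l [K [l0 K0 HK]]] := image_bound gg.
have [eps eps0 Heps] := h_near0.
have [lh lh0 glh] := for_case_exists gh.
have gge j x : `|x - (t j)%:R *: e0| <= eps -> h 0 / 2 * a j * poisson_pmf 1 j <= g x.
  move=> xt; apply: (Rintegral_ge_on (mu := @poisson R) (B := [set j])) => //.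
  - have [Ch Ch0 HCh] := good_norm_le wM wA lh0 glh.
    have [K1 K10 HK1] := agrowth _ ltr01.
    apply: (@poisson_bounded_integrable _ _ (K1 * (Ch * (lh ^+ 0 * M 0%N)))) => i.
    rewrite normrM ler_pM//; last exact: (HCh [::]).
    apply: le_trans (HK1 i); rewrite ler_peMr// growth_ge1// mulr_ge0// divr_ge0//.
  - by move=> i _; rewrite mulr_ge0// ltW.
  - by rewrite mulr_ge0 ?(ltW (a0 j))// divr_ge0// ltW.
  - by move=> i ->; rewrite mulrC ler_wpM2l ?(ltW (a0 j))// Heps.
  - by have /eqP := poisson_set1 (R := R) j; rewrite eq_le => /andP[].
have sg : rsmooth g by have [l1 _ []] := for_case_exists gg.
pose E := eps ^+ n.+1; have E0 : 0 < E by rewrite exprn_gt0.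
have [j] := gap l (K * (E + 1) / E / (h 0 / 2)) l0.
apply/negP; rewrite -leNgt.
pose kap := h 0 / 2 * a j * poisson_pmf 1 j * (((t j)%:R / l) ^+ q j / B (q j)).
have hap0 : 0 <= h 0 / 2 * a j * poisson_pmf 1 j.
  by rewrite mulr_ge0 ?(ltW (poisson_pmf_gt0 j))// mulr_ge0 ?(ltW (a0 j))// divr_ge0// ltW.
have tl0 : 0 <= ((t j)%:R / l) ^+ q j / B (q j).
  by rewrite divr_ge0 ?(ltW (Bpos _))// exprn_ge0// divr_ge0// ltW.
have := @Lp_norm_cube (wder N B l g [::]) ((t j)%:R *: e0) eps K kap eps0 K0.
move=> /(_ (mulr_ge0 hap0 tl0) (coord_measurable_wder wB _ l0 sg)
  (fun x => wder_ge0 wN wB _ _ _ l0) (HK [::])) cubeP.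
(* On the cube with corner [t j e0], [g] is at least the term of index [j], and
   [growth B] at least the term of index [q j] of its supremum. *)
have {cubeP} : kap * E <= K * (E + 1).
  apply: cubeP => z zt; rewrite /wder/= expr0 mul1r.
  have [_ -> _] := wN; rewrite divr1.
  have zc : `|rowt z - (t j)%:R *: e0| <= eps by exact: cube_close.
  apply: ler_pM => //; first by rewrite (le_trans (gge j _ zc))// ler_norm.
  rewrite (le_trans _ (growth_ub wB (q j) _)) ?divr_ge0 ?(ltW l0)//.
  rewrite ler_wpM2r ?invr_ge0 ?(ltW (Bpos _))// lerXn2r ?nnegrE ?divr_ge0 ?(ltW l0)//.
  rewrite ler_pM2r ?invr_gt0//.
  have := zt ord0; rewrite /= in_itv/= !mxE eqxx/= mulr1 => /andP[tz _].
  rewrite (le_trans tz)// (le_trans (ler_norm _))//.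
  rewrite -[leRHS]/(mx_norm _) mx_normrE.
  have := le_bigmax 0 (fun ij : 'I_1 * 'I_n.+1 => `|rowt z ij.1 ij.2|) (ord0, ord0).
  by rewrite /= mxE.
have lB0 : 0 < l ^+ q j * B (q j) by rewrite mulr_gt0// exprn_gt0.
rewrite -ler_pdivlMr// => kE.
have -> : K * (E + 1) / E / (h 0 / 2) * l ^+ q j * B (q j) =
  (K * (E + 1) / E) * (l ^+ q j * B (q j)) / (h 0 / 2) by ring.
rewrite ler_pdivlMr ?divr_gt0//.
have -> : poisson_pmf 1 j * a j * (t j)%:R ^+ q j * (h 0 / 2) = kap * (l ^+ q j * B (q j)).
  rewrite /kap expr_div_n; field.
  by rewrite !gt_eqF ?exprn_gt0.
by rewrite ler_wpM2r// ltW.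
Qed.

(** The dual construction: if [M] is not dominated by [N], modulations replace the
    translations. The derivatives of order [s] of [a j * cos (t j * x_0)] are of
    size [a j * t j ^ s], hence bounded as required by [M]; that the derivative of
    order [q j] is large is detected by integrating it against [cos (t j * x_0)] on
    lines. *)
Lemma domination_modulations :
  exists C H : R, [/\ 0 < C, 0 < H & forall q, M q <= C * H ^+ q * N q].
Proof.
apply: contrapT => nMN.
have [a [t [q [a0 at_ gap]]]] := gap_sequences wM lcM wN poisson_pmf_gt0 nMN.
have [Bpos _ _] := wB; have [Npos _ _] := wN; have [_ M0 _] := wM.
pose g x := cos_series a t x * h x.
have scos := rsmooth_cos_series (n := n) a0 at_.
have gg : for_case c (fun l => good M A p l g).
  apply: for_case_scale gh => [|l l0 gl]; first exact: (ltr0n R 4).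
  exact: (good_multiplier wM wA supM p1 l0 scos (cos_series_bound a0 at_ l0) gl).
have sg : rsmooth g by have [l1 _ []] := for_case_exists gg.
have [l [K [l0 K0 HK]]] := image_bound gg.
have [eps eps0 Heps] := h_near0.
have [lh lh0 glh] := for_case_exists gh.
have [lk lk0 glk] := for_case_exists gk.
have [lg lg0 glg] := for_case_exists gg.
have [C0 C00 HC0] := at_ 1 ltr01.
have aC0 j : a j <= C0 by have := HC0 j 0%N; rewrite !expr0 M0 !mulr1.
pose kap := h 0 / 2 * eps / 2.
have kap0 : 0 < kap by rewrite /kap !divr_gt0// mulr_gt0// divr_gt0.
set I := fine (\int[mu]_x ((oneDsqr x)^-1)%:E)%E.
have En0 : 0 < eps ^+ n by rewrite exprn_gt0.
have [j] := gap l ((1 + l ^+ 2 * B 2%N) * (K * (I * eps ^+ n + 1)) / eps ^+ n / kap) l0.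
apply/negP; rewrite -leNgt.
pose pj := poisson_pmf (1 : R) j * a j * (t j)%:R ^+ q j.
have pj0 : 0 <= pj by rewrite !mulr_ge0 ?exprn_ge0 ?(ltW (a0 j)) ?(ltW (poisson_pmf_gt0 j)).
suff : pj * kap * eps ^+ n <=
    (1 + l ^+ 2 * B 2%N) * (l ^+ q j * N (q j)) * (K * (I * eps ^+ n + 1)).
  rewrite -ler_pdivlMr// -ler_pdivlMr// => /le_trans; apply.
  by rewrite le_eqVlt; apply/orP; left; apply/eqP; ring.
have := @Lp_norm_lines l g (nseq (q j) ord0) eps K (pj * kap) l0 eps0 K0 sg.
rewrite size_nseq; apply; [by rewrite mulr_ge0// ltW|exact: HK|].
(* The lines considered pass close to the origin, where [h] is at least [h 0 / 2]. *)
move=> z cz; set y := rowt _.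
have y0 : y ord0 ord0 = 0 by rewrite mxE.
pose H s := h (y + s *: e0); pose Kf s := k (y + s *: e0).
have dH (s : R) : is_derive s (1 : R) H (Kf (s + 2 * pi) - Kf s).
  rewrite /Kf scalerDl addrA -dh; apply: is_derive_line.
  exact: (rsmooth_derivable (s := [::])).
have decH : decays H by exact: (good_decays wM wA [::] lh0 glh y0).
have decK : decays Kf by exact: (good_decays wM wA [::] lk0 glk y0).
have H0 s : 0 <= H s by exact: h0.
pose G i s := rpartial (nseq i ord0) g (y + s *: e0).
have dG i (s : R) : is_derive s (1 : R) (G i) (G i.+1 s).
  exact: is_derive_rpartial_line.
have decG i : decays (G i) by exact: (good_decays wM wA _ lg0 glg y0).
have IH : h 0 / 2 * eps <= \int[mu]_s H s.
  apply: (Rintegral_ge_on (mu := mu) (B := `[0, eps]%classic)) => //.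
  - exact: decays_integrable.
  - by rewrite divr_ge0// ltW.
  - move=> s; rewrite /= in_itv/= => sE; apply: Heps; rewrite /y -rowt_tuple_cons.
    rewrite -[X in `|X|]subr0; apply: cube_close => // i; rewrite mxE add0r.
    case: (unliftP ord0 i) => [i'|] ->; last by rewrite /= in_itv.
    by rewrite tnth_tuple_consS; have := cz i'; rewrite mxE add0r.
  - have e := @lebesgue_measure_itv R `[0, eps].
    rewrite /= lte_fin eps0 -EFinB subr0 in e.
    by rewrite -[X in (X <= _)%E]e; exact: lexx.
(* [q j] integrations by parts bring the factor [t j ^ q j]. *)
have bigint := le_Rintegral_derive (q j) (ler0n R (t j)) dG decG.
rewrite -[leRHS]fineK; last first.
  exact: (integrable_fin_num measurableT (integrable_norm (decays_integrable (decG (q j))))).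
rewrite lee_fin; apply: le_trans bigint.
rewrite (_ : pj * kap = (t j)%:R ^+ q j *
    (poisson_pmf 1 j * (a j * (2^-1 * (h 0 / 2 * eps))))); last first.
  by rewrite /pj /kap; ring.
rewrite ler_wpM2l ?exprn_ge0//.
apply: (@le_trans _ _ (poisson_pmf 1 j * (a j * (2^-1 * \int[mu]_s H s)))).
  by rewrite !ler_wpM2l ?invr_ge0 ?(ltW (a0 j)) ?(ltW (poisson_pmf_gt0 j)).
have := Rintegral_cos_superposition_ge t a0 aC0 dH decH decK H0 j.
move=> /le_trans; apply; rewrite le_eqVlt; apply/orP; left; apply/eqP.
apply: eq_Rintegral => s _; rewrite /G /= /g /cos_series line_coord0//.
Qed.

End With_test_function.

End Necessity.

(** * Sufficiency of the domination *)

Section Difference.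
Context {R : realType} {n : nat}.

Lemma rsmoothB (u v : 'rV[R]_n -> R) : rsmooth u -> rsmooth v ->
  rsmooth (fun x => u x - v x).
Proof.
move=> su sv.
have E s : rpartial s (fun x => u x - v x) = fun x => rpartial s u x - rpartial s v x.
  elim: s => [//|i s IH]; rewrite [LHS]/= -/(rpartial _ _) IH; apply/funext => x.
  by apply: deriveB; exact: rsmooth_derivable.
move=> s; rewrite E; split=> [x|i x].
  have h := continuousB (@rsmooth_continuous _ _ s u su x)
    (@rsmooth_continuous _ _ s v sv x).
  exact: h.
by apply: derivableB; exact: rsmooth_derivable.
Qed.

Lemma smoothB (f g : 'rV[R]_n -> R[i]) : smooth f -> smooth g -> smooth (f - g)%R.
Proof.
move=> [fr fi] [gr gi]; split.
  rewrite (_ : (fun x => _) = fun x => complex.Re (f x) - complex.Re (g x)).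
    exact: rsmoothB.
  by apply/funext => x; rewrite !fctE; case: (f x) (g x) => ? ? [].
rewrite (_ : (fun x => _) = fun x => complex.Im (f x) - complex.Im (g x)).
  exact: rsmoothB.
by apply/funext => x; rewrite !fctE; case: (f x) (g x) => ? ? [].
Qed.

End Difference.

Section Norm_domination.
Context {R : realType} {n : nat} {M A N B : nat -> R} {p : \bar R}.
Hypotheses (wM : weight_seq M) (wA : weight_seq A).
Hypotheses (wN : weight_seq N) (wB : weight_seq B) (p1 : (1 <= p)%E).
Local Notation MM := (isotropic n.+1 M).
Local Notation AA := (isotropic n.+1 A).
Local Notation NN := (isotropic n.+1 N).
Local Notation BB := (isotropic n.+1 B).
Context {C H : R}.
Hypotheses (C0 : 0 < C) (H0 : 0 < H).
Hypothesis dom : forall q, M q <= C * H ^+ q * N q /\ A q <= C * H ^+ q * B q.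

(** Term by term: one factor [C] comes from the weights on the derivatives, the
    other from the weights on the variable. *)
Lemma X_norm_domination l (f : 'rV[R]_n.+1 -> R[i]) : 0 < l -> smooth f ->
  (X_norm NN BB p l f <= (C ^+ 2)%:E * X_norm MM AA p (l / H) f)%E.
Proof.
move=> l0 sf; have lH0 : 0 < l / H by rewrite divr_gt0.
have C20 : 0 < C ^+ 2 by rewrite exprn_gt0.
have [Mpos _ _] := wM; have [Npos _ _] := wN.
apply: ge_ereal_sup => _ [a _ <-].
pose F l' b x := Normc.normc (partial a f x) * growth b (`|x| / l').
have normc_ge0 x : 0 <= Normc.normc (partial a f x).
  by case: (partial a f x) => ? ? /=; exact: sqrtr_ge0.
have FB : (Lp_norm p (fun x => (F l B x)%:E) <=
    C%:E * Lp_norm p (fun x => (F (l / H)%R A x)%:E))%E.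
  apply: (@Lnorm_leZ _ _ _ (leb R n.+1) p C (fun t => F l B (rowt t))
    (fun t => F (l / H) A (rowt t)) p1 C0).
  - exact: measurable_X_norm_term.
  - exact: measurable_X_norm_term.
  - move=> t; rewrite /F mulr_ge0 ?normc_ge0 ?(ltW (growth_gt0 _ _)) ?divr_ge0 ?(ltW l0)//.
  - move=> t; rewrite /F mulrCA ler_wpM2l//.
    rewrite (_ : `|rowt t| / (l / H) = H * (`|rowt t| / l)); last first.
      by field; rewrite !gt_eqF.
    apply: growth_mono => //; first by move=> q; have [] := dom q.
    by rewrite divr_ge0// ltW.
rewrite (X_norm_termE wB _ _ l0) -/(F l B).
pose wM' : \bar R := (((l / H) ^+ mlen a * M (mlen a))^-1)%:E.
have wle : (((l ^+ mlen a * N (mlen a))^-1)%:E <= C%:E * wM')%E.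
  rewrite -EFinM lee_fin -[leLHS]mul1r ler_pdivrMr ?mulr_gt0 ?exprn_gt0//.
  rewrite mulrAC -/(_ / _) ler_pdivlMr ?mulr_gt0 ?exprn_gt0//.
  rewrite mul1r expr_div_n mulrAC ler_pdivrMr ?exprn_gt0//.
  rewrite -mulrA mulrCA -!mulrA ler_wpM2l ?exprn_ge0 ?(ltW l0)//.
  have [h _] := dom (mlen a); apply: le_trans h _.
  by rewrite le_eqVlt; apply/orP; left; apply/eqP; ring.
apply: (@le_trans _ _ ((C%:E * Lp_norm p (fun x => (F (l / H)%R A x)%:E)) * (C%:E * wM'))%E).
  apply: lee_pmul => //.
  - exact: Lnorm_ge0.
  - by rewrite lee_fin invr_ge0 mulr_ge0 ?exprn_ge0 ?(ltW l0) ?(ltW (Npos _)).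
rewrite muleACA -EFinM -expr2 lee_wpmul2l ?lee_fin ?(ltW C20)//.
rewrite /F -(X_norm_termE wA _ _ lH0).
by apply: ereal_sup_ubound; exists a.
Qed.

Lemma X_set_domination l : 0 < l -> X_set MM AA p (l / H) `<=` X_set NN BB p l.
Proof.
move=> l0 f [sf Xf]; split=> //; apply: le_lt_trans (X_norm_domination l0 sf) _.
by rewrite lte_mul_pinfty// lee_fin exprn_ge0// ltW.
Qed.

Lemma X_norm_domination_lt l e (f : 'rV[R]_n.+1 -> R[i]) : 0 < l -> smooth f ->
  (X_norm MM AA p (l / H) f < (e / C ^+ 2)%:E)%E -> (X_norm NN BB p l f < e%:E)%E.
Proof.
move=> l0 sf fe; apply: le_lt_trans (X_norm_domination l0 sf) _.
have C20 : 0 < C ^+ 2 by rewrite exprn_gt0.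
rewrite -[X in (_ < X%:E)%E](mulfVK (lt0r_neq0 C20)) [ltRHS]EFinM [ltRHS]muleC.
by rewrite lte_pmul2l// ltW.
Qed.

Lemma continuous_X_inclusion l (l0 : 0 < l) :
  continuous (subfun (X_set_domination l0) :
    X_space MM AA p (l / H) -> X_space NN BB p l).
Proof.
apply/continuousP => O oO.
suff : X_open (subfun (X_set_domination l0) @^-1` O) by [].
have {}oO : X_open O by exact: oO.
move=> f Of; have [e e0 He] := oO _ Of.
exists (e / C ^+ 2); first by rewrite divr_gt0 ?exprn_gt0.
move=> g gfe; apply: He; apply: X_norm_domination_lt gfe => //.
have [[sg _] [sf _]] := (set_valP g, set_valP f).
exact: smoothB.
Qed.

Lemma GS_domination c : GS MM AA p c `<=` GS NN BB p c.
Proof.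
case: c => f; last first.
  move=> [l /= l0 Xf]; have lH : 0 < l * H by rewrite mulr_gt0.
  exists (l * H) => //; apply: (X_set_domination lH).
  by rewrite mulfK// gt_eqF.
move=> Xf l l0; apply: (X_set_domination l0); apply: Xf => /=.
by rewrite divr_gt0.
Qed.

Lemma continuous_proj (l : {posnum R}) :
  continuous (@Defs.proj R n.+1 MM AA p l : proj_limit_topology MM AA p -> _).
Proof.
move=> f; have := @cvg_id _ (nbhs (f : proj_limit_topology MM AA p)).
move=> /(cvg_sup _ _ _).1 => /(_ l) h.
apply: cvg_trans (@initial_continuous _ _ (@Defs.proj R n.+1 MM AA p l) f).
exact: cvg_app.
Qed.

Lemma continuous_GS_inclusion c (i : GS MM AA p c `<=` GS NN BB p c) :
  continuous (subfun i : GS_space MM AA p c -> GS_space NN BB p c).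
Proof.
case: c i => i.
  suff cont : continuous (subfun i :
      proj_limit_topology MM AA p -> proj_limit_topology NN BB p).
    by apply/continuousP => O; move/continuousP: cont; apply.
  move=> f.
  have ff : Filter (fmap (subfun i) (@nbhs _ (proj_limit_topology MM AA p) f)).
    exact: (@fmap_filter _ _ _ _ (@nbhs_filter (proj_limit_topology MM AA p) f)).
  have [_ +] := @cvg_sup _ _ (fun l : {posnum R} =>
    Topological.on (initial_topology (@Defs.proj R n.+1 NN BB p l))) _ (subfun i f) ff.
  apply=> l.
  have lH : 0 < l%:num / H by rewrite divr_gt0.
  have comp : continuous (@Defs.proj R n.+1 NN BB p l \o (subfun i :
      proj_limit_topology MM AA p -> _)).
    have -> : @Defs.proj R n.+1 NN BB p l \o subfun i =
      subfun (X_set_domination (gt0 l)) \o @Defs.proj R n.+1 MM AA p (PosNum lH).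
      by apply/funext => g; apply/val_inj.
    move=> g; apply: continuous_comp; first exact: continuous_proj.
    exact: continuous_X_inclusion.
  exact: (continuous_comp_initial comp).
apply/continuousP => O oO.
suff : ind_open (subfun i @^-1` O) by [].
have {}oO : ind_open O by exact: oO.
move=> f Of; have [U [cU UX UO]] := oO _ Of.
(* The same absolutely convex set serves in the smaller space. *)
exists U; split=> //.
  move=> l l0; have lH : 0 < l * H by rewrite mulr_gt0.
  have [e e0 He] := UX _ lH; have lHK : l * H / H = l by rewrite mulfK// gt_eqF.
  exists (e / C ^+ 2); first by rewrite divr_gt0 ?exprn_gt0.
  move=> h; rewrite -{1 2}lHK => Xh he; apply: He; first exact: X_set_domination.
  by have [sh _] := Xh; exact: X_norm_domination_lt.
by move=> g; exact: (UO (subfun i g)).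
Qed.

End Norm_domination.

(** * The equivalence *)

Lemma domination_of_inclusion (R : realType) (n : nat) (p : \bar R)
    (M N A B : nat -> R) (c : limit_case) :
  weight_seq M -> weight_seq N -> weight_seq A -> weight_seq B ->
  log_convex_seq M -> log_convex_seq A -> (1 <= p)%E ->
  GS (isotropic n.+1 M) (isotropic n.+1 A) p c <> [set 0] ->
  GS (isotropic n.+1 M) (isotropic n.+1 A) p c `<=`
    GS (isotropic n.+1 N) (isotropic n.+1 B) p c ->
  exists C H : R, [/\ 0 < C, 0 < H &
    forall q, M q <= C * H ^+ q * N q /\ A q <= C * H ^+ q * B q].
Proof.
move=> wM wN wA wB lcM lcA p1 nz incl.
have [h [k [gh gk h0 h00 dh]]] := test_function wM wA p1 (log_convex_supermul wM lcM) nz.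
have [C [H [C0 H0 MN]]] := domination_modulations wM wA wN wB lcM p1 incl gh gk h0 h00 dh.
have [C' [H' [C'0 H'0 AB]]] := domination_translates wM wA wN wB lcA p1 incl gh h0 h00.
have [[Npos _ _] [Bpos _ _]] := (wN, wB).
exists (C + C'), (H + H'); split; rewrite ?addr_gt0// => q; split.
  apply: le_trans (MN q) _; rewrite ler_wpM2r ?(ltW (Npos q))//.
  by rewrite ler_pM ?exprn_ge0 ?(ltW C0) ?(ltW H0) ?lerDl ?(ltW C'0)// lerXn2r
    ?nnegrE ?addr_ge0 ?lerDl// ltW.
apply: le_trans (AB q) _; rewrite ler_wpM2r ?(ltW (Bpos q))//.
by rewrite ler_pM ?exprn_ge0 ?(ltW C'0) ?(ltW H'0) ?lerDr ?(ltW C0)// lerXn2r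
  ?nnegrE ?addr_ge0 ?lerDr// ltW.
Qed.

Theorem theorem1p1 (R : realType) (n : nat) (p : \bar R)
    (M N A B : nat -> R) (c : limit_case) :
  (1 <= n)%N -> (1 <= p)%E ->
  weight_sequence (isotropic n M) -> weight_sequence (isotropic n N) ->
  weight_sequence (isotropic n A) -> weight_sequence (isotropic n B) ->
  log_convex (isotropic n M) -> log_convex (isotropic n A) ->
  GS (isotropic n M) (isotropic n A) p c <> [set 0] ->
  [<-> exists C H : R, [/\ 0 < C, 0 < H &
         forall q : nat,
           M q <= C * H ^+ q * N q /\ A q <= C * H ^+ q * B q];
       GS (isotropic n M) (isotropic n A) p c `<=`
         GS (isotropic n N) (isotropic n B) p c;
       exists i : GS (isotropic n M) (isotropic n A) p c `<=`
                  GS (isotropic n N) (isotropic n B) p c,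
         continuous (subfun i :
           GS_space (isotropic n M) (isotropic n A) p c ->
           GS_space (isotropic n N) (isotropic n B) p c)].
Proof.
case: n => [//|n] _ p1 wMn wNn wAn wBn lcMn lcAn nz.
have [wM wN] := (weight_sequence_isotropic wMn, weight_sequence_isotropic wNn).
have [wA wB] := (weight_sequence_isotropic wAn, weight_sequence_isotropic wBn).
have [[Mpos _ _] [Apos _ _]] := (wM, wA).
have [lcM lcA] := (log_convex_isotropic Mpos lcMn, log_convex_isotropic Apos lcAn).
have nec := domination_of_inclusion wM wN wA wB lcM lcA p1 nz.
split=> [[C [H [C0 H0 dom]]]|]; first exact: (GS_domination wM wA wN wB p1 C0 H0 dom).
split=> [i|[i _]]; last exact: nec.
have [C [H [C0 H0 dom]]] := nec i.
by exists i; exact: (continuous_GS_inclusion wM wA wN wB p1 C0 H0 dom).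
Qed.
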